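(* $P_h(\mathbb{A})=\{n\in\mathbb{Z}:n\geq5\}\cup\{+\infty\}$, $P_h(\mathbb{O})=\{n\in\mathbb{Z}:n\geq4\}\cup\{+\infty\}$, and $P_h(\mathbb{U})=\{n\in\mathbb{Z}:n\geq1\}\cup\{+\infty\}$.
   Context: Three topological spaces have underlying set $[0,1]\times[0,1]$ (points are written $\langle x,y\rangle$). (i) $\mathbb{U}$ has the subspace topology of the Euclidean plane $\mathbb{R}^2$. (ii) $\mathbb{O}$ has the order topology of the lexicographic order: $\langle x,y\rangle\preceq_\ell\langle s,t\rangle$ iff $x<s$, or $x=s$ and $y\le t$. (iii) $\mathbb{A}$ (the Alexandroff square) has the topology generated by the basis consisting of all sets $\{x\}\times U$ with $x\in[0,1]$, $U$ open in $[0,1]$ (Euclidean topology) and $x\notin U$, together with all sets $([0,1]\times U)\setminus(\{x_1,\ldots,x_n\}\times[0,1])$ with $U$ open in $[0,1]$ and $x_1,\dots,x_n\in[0,1]$ finitely many points. All three spaces are compact Hausdorff. For a topological space $X$, $\mathcal{G}_X$ denotes the group of all homeomorphisms $X\to X$ under composition. A subgroup $G$ of $\mathcal{G}_X$ (with the discrete topology) acts on $X$ by evaluation. The orbit of $x\in X$ is $Gx=\{gx:g\in G\}$. A nonempty subset $D\subseteq X$ is invariant if $GD=\{gy:g\in G,y\in D\}\subseteq D$. The height of $(G,X)$ is $$h(G,X)=\sup\{n\ge0:\text{there exist closed invariant subsets }D_0,\ldots,D_n\text{ of }X\text{ with }\varnothing\ne D_0\subsetneq D_1\subsetneq\cdots\subsetneq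 D_n=X\};$$ equivalently, $h(G,X)=+\infty$ if $\{\overline{Gx}:x\in X\}$ is infinite, and $h(G,X)=\mathrm{card}(\{\overline{Gx}:x\in X\})-1$ otherwise. The set of possible heights of $X$ is $P_h(X)=\{h(G,X):G\text{ is a subgroup of }\mathcal{G}_X\}$. *)

(* Defs.v *)
From HB Require Import structures.
From mathcomp Require Import all_boot all_order all_algebra.
From mathcomp Require Import all_classical all_reals all_analysis.

Set Implicit Arguments.
Unset Strict Implicit.
Unset Printing Implicit Defensive.

Import Order.TTheory GRing.Theory Num.Theory.
Import numFieldNormedType.Exports.

Local Open Scope classical_set_scope.
Local Open Scope ring_scope.

Record homeo (X : topologicalType) : Type := Homeo {
  homeo_fun :> X -> X;
  homeo_inv : X -> X;
  homeo_funK : cancel homeo_fun homeo_inv;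
  homeo_invK : cancel homeo_inv homeo_fun;
  homeo_fun_continuous : continuous homeo_fun;
  homeo_inv_continuous : continuous homeo_inv }.

Section HomeoGroup.
Variable X : topologicalType.
Implicit Types f g h : homeo X.

Lemma homeoP f g : f =1 g -> f = g.
Proof.
case: f g => [f f' fK f'K cf cf'] [g g' gK g'K cg cg'] /= /funext fg.
subst g; have fg' : f' = g' by apply/funext => x; rewrite -{1}(g'K x) fK.
subst g'; congr Homeo; exact: Prop_irrelevance.
Qed.

Definition homeo_one : homeo X :=
  @Homeo X idfun idfun (fun=> erefl) (fun=> erefl)
    (fun _ => cvg_id) (fun _ => cvg_id).

Definition homeo_mul f g : homeo X :=
  @Homeo X (f \o g) (homeo_inv g \o homeo_inv f)
    (can_comp (homeo_funK f) (homeo_funK g))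
    (can_comp (homeo_invK g) (homeo_invK f))
    (fun x => continuous_comp (@homeo_fun_continuous X g x)
                (@homeo_fun_continuous X f (g x)))
    (fun x => continuous_comp (@homeo_inv_continuous X f x)
                (@homeo_inv_continuous X g (homeo_inv f x))).

Definition homeo_recip f : homeo X :=
  Homeo (homeo_invK f) (homeo_funK f)
    (@homeo_inv_continuous X f) (@homeo_fun_continuous X f).

Lemma homeo_mulA : associative homeo_mul.
Proof. by move=> f g h; exact: homeoP. Qed.

Lemma homeo_mul1f : left_id homeo_one homeo_mul.
Proof. by move=> f; exact: homeoP. Qed.

Lemma homeo_mulf1 : right_id homeo_one homeo_mul.
Proof. by move=> f; exact: homeoP. Qed.

Lemma homeo_mulVf : left_inverse homeo_one homeo_recip homeo_mul.
Proof. by move=> f; apply: homeoP => x /=; rewrite homeo_funK. Qed.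

Lemma homeo_mulfV : right_inverse homeo_one homeo_recip homeo_mul.
Proof. by move=> f; apply: homeoP => x /=; rewrite homeo_invK. Qed.

HB.instance Definition _ := gen_eqMixin (homeo X).
HB.instance Definition _ := gen_choiceMixin (homeo X).
HB.instance Definition _ := isGroup.Build (homeo X)
  homeo_mulA homeo_mul1f homeo_mulf1 homeo_mulVf homeo_mulfV.

End HomeoGroup.

Definition invariant (X : topologicalType) (G : {pred homeo X}) (D : set X) :=
  D !=set0 /\ [set (g : homeo X) y | g in [set` G] & y in D] `<=` D.

(* Only [D 0], ..., [D n] are constrained. *)
Definition invariant_chain (X : topologicalType) (G : {pred homeo X}) (n : nat)
    (D : nat -> set X) :=
  [/\ forall i, (i <= n)%N -> closed (D i) /\ invariant G (D i),
      forall i, (i < n)%N -> D i `<` D i.+1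
    & D n = [set: X]].

Definition height (R : realType) (X : topologicalType) (G : {pred homeo X})
    : \bar R :=
  ereal_sup [set (n%:R)%:E |
             n in [set n : nat | exists D, invariant_chain G n D]].

Definition possible_heights (R : realType) (X : topologicalType)
    : set (\bar R) :=
  [set height R G | G in [set G : {pred homeo X} | group_closed G]].

Arguments possible_heights R X : clear implicits.

Definition unit_interval (R : realType) : Type := `[0 : R, 1]%classic.

HB.instance Definition _ (R : realType) :=
  Topological.copy (unit_interval R) (set_type `[0 : R, 1]%classic).
HB.instance Definition _ (R : realType) :=
  SubType.copy (unit_interval R) (set_type `[0 : R, 1]%classic).
HB.instance Definition _ (R : realType) :=
  [Order of unit_interval R by <:].

Definition euclidean_square (R : realType) : topologicalType :=
  initial_topology (fun p : unit_interval R * unit_interval R =>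
                      (\val p.1, \val p.2) : R * R).

Definition lexicographic_square (R : realType) : topologicalType :=
  order_topology (unit_interval R *l unit_interval R).

Definition alexandroff_square (R : realType) : Type :=
  (unit_interval R * unit_interval R)%type.

Definition alexandroff_base (R : realType) : set (set (alexandroff_square R)) :=
  [set B | exists (x : unit_interval R) (U : set (unit_interval R)),
     [/\ open U, ~ U x & B = [set x] `*` U]] `|`
  [set B | exists U F : set (unit_interval R),
     [/\ open U, finite_set F & B = ([set: _] `*` U) `\` (F `*` [set: _])]].

Section AlexandroffTopology.
Variable R : realType.
Local Notation A := (alexandroff_square R).

Lemma alexandroff_base_cover :
  \bigcup_(B in @alexandroff_base R) id B = [set: A].
Proof.
rewrite -subTset => p _; exists [set: A] => //; right.
exists setT, set0; split => //; first exact: openT.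
by rewrite set0X setD0 setXTT.
Qed.

Lemma alexandroff_base_join (B C : set A) (p : A) :
  alexandroff_base B -> alexandroff_base C -> id B p -> id C p ->
  exists E, [/\ alexandroff_base E, id E p & id E `<=` id B `&` id C].
Proof.
move=> BB BC Bp Cp; exists (B `&` C); split=> //.
have mixed (x : unit_interval R) (U V F : set (unit_interval R)) :
    ~ F x ->
    ([set x] `*` U) `&` (([set: _] `*` V) `\` (F `*` [set: _])) =
    [set x] `*` (U `&` V) :> set A.
  move=> nFx; apply/seteqP; split=> [[a b]|[a b]] /=.
    by move=> [[-> ?] [[_ ?] _]].
  by move=> [-> [? ?]]; do !split=> //; case.
case: BB => [[x [U [oU Ux eB]]]|[U [F [oU fF eB]]]];
  case: BC => [[y [V [oV Vy eC]]]|[V [K [oV fK eC]]]];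
  rewrite {}eB in Bp *; rewrite {}eC in Cp *.
- have xy : x = y by case: Bp Cp => /= <- _ [].
  left; exists x, (U `&` V); split; [exact: openI|by case|].
  by rewrite xy -setXI setIid.
- left; exists x, (U `&` V); split; [exact: openI|by case|].
  apply: mixed => Kx; case: Bp Cp => /= px _ [_]; apply.
  by rewrite px.
- left; exists y, (V `&` U); split; [exact: openI|by case|].
  rewrite setIC; apply: mixed => Fy; case: Cp Bp => /= py _ [_]; apply.
  by rewrite py.
- right; exists (U `&` V), (F `|` K); split; [exact: openI| |].
    by rewrite finite_setU.
  apply/seteqP; split=> [[a b]|[a b]] /=.
    by move=> [[[_ ?] nF] [[_ ?] nK]]; do !split=> //; case=> -[|] ? _;
      [apply: nF|apply: nK].
  move=> [[_ [? ?]] nFK]; do !split=> //; case=> ? _; apply: nFK; split=> //.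
    by left.
  by right.
Qed.

HB.instance Definition _ :=
  Choice.copy A (unit_interval R * unit_interval R)%type.
HB.instance Definition _ := isBaseTopological.Build A
  alexandroff_base_cover alexandroff_base_join.

End AlexandroffTopology.

(* Main.v *)
(* A closed invariant set is a union of classes of points with the same orbit
   closure. If a colouring c : X -> {0, ..., n} is onto and lower semicontinuous,
   and the group G of all homeomorphisms preserving c is transitive (up to
   closure) on each colour, then the sets {c <= i} form a longest chain and G
   has height n. This realizes every finite height; the trivial group has
   infinite height.

   On the Alexandroff and lexicographic squares the colours are those of the
   orbits of the full homeomorphism group, except that the interiors of the two
   extreme columns, exchanged by (x, y) |-> (1 - x, 1 - y), carry a pattern with
   an arbitrary number r + 1 of orbits. On the Euclidean square one fixes k
   interior points; moving around them by shears, and around the corners by a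
   twist, leaves only the boundary and the remaining interior as further orbits.

   For the lower bounds, the colouring with r = 0 is invariant under every
   homeomorphism: the points with a neighbourhood filled by a curve, the
   components they form and the endpoints of those components are topological
   notions that determine the colour. For the Euclidean square, the boundary is
   invariant because its points are Z-points and, by the Poincare-Miranda
   theorem in dimension 2, interior points are not. *)
Require Import Defs.
From mathcomp Require Import all_boot all_order all_algebra.
From mathcomp Require Import all_classical all_reals all_analysis.
From mathcomp Require Import lra.

Set Implicit Arguments.
Unset Strict Implicit.
Unset Printing Implicit Defensive.

Import Order.TTheory GRing.Theory Num.Theory.
Import numFieldNormedType.Exports.

Local Open Scope classical_set_scope.
Local Open Scope ring_scope.

(** * Heights from orbit colourings *)

Section Heights.
Variables (R : realType) (X : topologicalType).
Implicit Types G : {pred homeo X}.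

(** Chains consist of closed invariant sets, so a colour class need not be one orbit; equal orbit
    closures suffice. This matters only for the boundary of the Euclidean square, where the
    available shears fix the corners and closedness fills them in. On the other two squares every
    colour class is an exact orbit. The least heights 5, 4 and 1 are one less than the numbers six,
    five and two of colours present in the simplest colouring. Further colours are placed where they
    disturb nothing else: no homeomorphism sends an extreme column to an inner one, so a pattern
    there leaves the inner orbits alone; fixed interior points of the Euclidean square are harmless
    because all motions near the boundary fix a central square. Curves see the fine structure
    because the line is separable: a neighbourhood of an inner diagonal point of the Alexandroff
    square, or of an end of an inner column of the lexicographic square, meets uncountably many
    disjoint open sets and cannot lie in the image of a curve. On the Euclidean square the closure
    of the removable points is a nonempty closed invariant set missing the interior, which already
    gives a chain of length 1. *)

Lemma height_max G (n : nat) :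
  (exists D, invariant_chain G n D) ->
  (forall m D, invariant_chain G m D -> (m <= n)%N) ->
  height R G = n%:R%:E.
Proof.
move=> exn bnd; apply/eqP; rewrite eq_le; apply/andP; split.
  apply: ge_ereal_sup => _ [m [D Dm] <-]; rewrite lee_fin ler_nat.
  exact: bnd Dm.
by apply: ereal_sup_ubound; exists n.
Qed.

Lemma height_unbounded G :
  (forall m, exists n D, (m <= n)%N /\ invariant_chain G n D) ->
  height R G = +oo%E.
Proof.
move=> unb; apply/eqyP => A A0.
have [n [D [mn Dn]]] := unb (Num.bound A).
apply: (@le_trans _ _ n%:R%:E).
  rewrite lee_fin (le_trans (ltW (archi_boundP (ltW A0))))//.
  by rewrite ler_nat.
by apply: ereal_sup_ubound; exists n => //; exists D.
Qed.

(** A supremum of natural numbers is attained or infinite, and the given chain keeps an attained one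
    at least k. *)
Lemma height_dichotomy G (k : nat) :
  (exists D, invariant_chain G k D) ->
  (exists2 n, (k <= n)%N & height R G = n%:R%:E) \/ height R G = +oo%E.
Proof.
move=> exk.
have [[b bnd]|unb] := pselect (exists b, forall m D, invariant_chain G m D -> (m <= b)%N).
  left.
  have exP : exists i, `[< exists D, invariant_chain G i D >].
    by exists k; exact/asboolP.
  have ubP i : `[< exists D, invariant_chain G i D >] -> (i <= b)%N.
    by move=> /asboolP[D /bnd].
  case: (ex_maxnP exP ubP) => n /asboolP exn nmax; exists n.
    exact/nmax/asboolP.
  apply: height_max => // m D Dm; apply: nmax; apply/asboolP; by exists D.
right; apply: height_unbounded => m; apply: contrapT => H; apply: unb.
exists m => n D Dn; rewrite leqNgt; apply/negP => mn; apply: H.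
by exists n, D; rewrite ltnW.
Qed.

Lemma possible_heightsE (k : nat) :
  (forall G, exists D, invariant_chain G k D) ->
  (forall n, (k <= n)%N ->
    exists2 G : {pred homeo X}, group_closed G & height R G = n%:R%:E) ->
  (exists2 G : {pred homeo X}, group_closed G & height R G = +oo%E) ->
  possible_heights R X =
    [set (n%:~R)%:E | n in [set n : int | k%:Z <= n]] `|` [set +oo%E].
Proof.
move=> lower real [G0 gG0 hG0]; apply/seteqP; split => [_ [G gG <-]|h].
  have [[n kn ->]|->] := height_dichotomy (lower G); last by right.
  by left; exists n%:Z.
move=> [[n kn <-]|->]; last by exists G0.
case: n kn => // n; rewrite /= lez_nat => /real[G gG hG]; exists G => //.
Qed.

Definition color_stabilizer (c : X -> nat) : {pred homeo X} :=
  [pred g | `[< forall p, c ((g : homeo X) p) = c p >]].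

Lemma color_stabilizerP (c : X -> nat) (g : homeo X) :
  reflect (forall p, c (g p) = c p) (g \in color_stabilizer c).
Proof. exact: asboolP. Qed.

Lemma color_stabilizer_group (c : X -> nat) : group_closed (color_stabilizer c).
Proof.
split; first exact/color_stabilizerP.
move=> g h /color_stabilizerP gc /color_stabilizerP hc; apply/color_stabilizerP => p.
change (c (g (homeo_inv h p)) = c p).
by rewrite gc -{2}(homeo_invK h p) hc.
Qed.

Lemma lower_semicontinuous_closed (c : X -> nat) (i : nat) :
  (forall p, \forall q \near p, (c p <= c q)%N) -> closed [set p | (c p <= i)%N].
Proof.
move=> lsc; rewrite -openC openE => p /= /negP; rewrite -ltnNge => ip.
have := lsc p; apply: filterS => q cpq /=; apply/negP; rewrite -ltnNge.
exact: leq_trans cpq.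
Qed.

(** The sublevel sets of c form the chain; surjectivity makes it strict. Besides stabilizers this
    serves an arbitrary group, once c is known to be invariant under all homeomorphisms, and then
    bounds every height from below. *)
Lemma color_chain G (c : X -> nat) (n : nat) :
  (forall g p, g \in G -> c (g p) = c p) ->
  (forall p, (c p <= n)%N) ->
  (forall i, (i <= n)%N -> exists p, c p = i) ->
  (forall p, \forall q \near p, (c p <= c q)%N) ->
  exists D, invariant_chain G n D.
Proof.
move=> Gc cn surj lsc; exists (fun i => [set p | (c p <= i)%N]); split.
- move=> i /surj[p cp]; split; first exact: lower_semicontinuous_closed.
  split; first by exists p; rewrite /= cp.
  by move=> _ [g gG] [y /= cy <-] /=; rewrite Gc.
- move=> i /surj[p cp]; split; first by move=> q /= /leq_trans; apply.
  by move=> /(_ p); rewrite /mkset cp ltnn leqnn => /(_ isT).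
- by apply/seteqP; split => // p _ /=.
Qed.

(** By the last hypothesis a closed stable set is determined by the colours it meets, so a chain is
    no longer than a chain of nonempty sets of colours. *)
Lemma color_height (c : X -> nat) (n : nat) :
  (forall p, (c p <= n)%N) ->
  (forall i, (i <= n)%N -> exists p, c p = i) ->
  (forall p, \forall q \near p, (c p <= c q)%N) ->
  (forall p q D, c p = c q -> closed D ->
     (forall g y, g \in color_stabilizer c -> D y -> D (g y)) -> D p -> D q) ->
  height R (color_stabilizer c) = n%:R%:E.
Proof.
move=> cn surj lsc trans; apply: height_max.
  by apply: color_chain => // g p /color_stabilizerP.
move=> m D [Dinv Dlt _].
pose col i : {set 'I_n.+1} := [set k : 'I_n.+1 | `[< exists2 p, D i p & c p = k >]]%SET.
have colP i (k : 'I_n.+1) : reflect (exists2 p, D i p & c p = k) (k \in col i).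
  by rewrite inE; exact: asboolP.
have Dg i g y : (i <= m)%N -> g \in color_stabilizer c -> D i y -> D i (g y).
  move=> /Dinv[_ [_ H]] gc Dy; apply: H; exists g => //.
  by exists y.
(* [D 0] meets some colour, and each strict inclusion adds at least one more: a new point of an old
   colour would already lie in the smaller set. *)
have card i : (i <= m)%N -> (i < #|col i|)%N.
  elim: i => [_|i IH im].
    have [_ [[p Dp] _]] := Dinv 0%N (leq0n _).
    apply/card_gt0P; have cp : (c p < n.+1)%N by rewrite ltnS.
    by exists (Ordinal cp); apply/colP; exists p.
  apply: leq_ltn_trans (IH (ltnW im)) _; apply: proper_card.
  have [sub nsub] := Dlt i im.
  apply/properP; split.
    by apply/fintype.subsetP => k /colP[p Dp ck]; apply/colP; exists p => //; exact: sub.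
  have [p [Dp nDp]] : exists p, D i.+1 p /\ ~ D i p.
    apply: contrapT => H; apply: nsub => p Dp; apply: contrapT => nDp; apply: H.
    by exists p.
  have cp : (c p < n.+1)%N by rewrite ltnS.
  exists (Ordinal cp); first by apply/colP; exists p.
  apply/colP => -[q Dq /= cq]; apply: nDp; apply: trans cq _ _ Dq.
    by have [] := Dinv i (ltnW im).
  by move=> g y; apply: Dg; exact: ltnW.
have := card m (leqnn m); move=> /leq_trans/(_ (max_card _)).
by rewrite card_ord ltnS.
Qed.

Lemma height_pred1_one (u : nat -> X) :
  (forall p : X, closed [set p]) -> injective u ->
  height R (pred1 (homeo_one X)) = +oo%E.
Proof.
move=> cl1 uinj.
apply: height_unbounded => m; exists m.
(* The second term is empty for i < m and the whole space from m on: finite sets grow by one point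
   at each stage, and the last member is padded to X. *)
exists (fun i => [set u j | j in [set j | (j <= i)%N]] `|` [set p | (m <= i)%N]).
split=> //; split.
- move=> i _; split; last first.
    split; first by exists (u 0%N); left; exists 0%N.
    by move=> _ [g /eqP ->] [y ? <-].
  have [mi|im] := leqP m i.
    rewrite (_ : _ `|` _ = setT); first exact: closedT.
    by apply/seteqP; split => // p _; right.
  rewrite (_ : _ `|` _ = \bigcup_(j in `I_i.+1) [set u j]).
    by apply: closed_bigcup => // ; exact: finite_II.
  apply/seteqP; split => [p [[j /= ji <-]|//]|p [j /= ji ->]].
    by exists j.
  by left; exists j.
- move=> i im; split.
    move=> p [[j /= ji <-]|/= mi].
      by left; exists j => //=; exact: leqW.
    by right; exact: leqW.
  move=> /(_ (u i.+1)) []; first by left; exists i.+1 => /=.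
    by move=> [j /= ji /uinj ij]; rewrite ij ltnn in ji.
  by rewrite /= leqNgt im.
- by apply/seteqP; split => // p _; right => /=.
Qed.

Lemma pred1_group : group_closed (pred1 (homeo_one X) : {pred homeo X}).
Proof.
split; first exact: eqxx.
move=> g h /eqP -> /eqP ->; apply/eqP.
exact: homeoP.
Qed.

End Heights.

Section SameOrbit.
Variables (X : topologicalType) (c : X -> nat).

Definition same_orbit (p q : X) := exists2 g, g \in color_stabilizer c & g p = q.

Lemma same_orbit_refl p : same_orbit p p.
Proof. by exists (homeo_one X) => //; exact/color_stabilizerP. Qed.

Lemma same_orbit_sym p q : same_orbit p q -> same_orbit q p.
Proof.
move=> [g /color_stabilizerP gc <-]; exists (homeo_recip g); last exact: homeo_funK.
by apply/color_stabilizerP => y; rewrite /= -[LHS]gc homeo_invK.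
Qed.

Lemma same_orbit_trans p q s : same_orbit p q -> same_orbit q s -> same_orbit p s.
Proof.
move=> [g /color_stabilizerP gc <-] [h /color_stabilizerP hc <-].
by exists (homeo_mul h g) => //; apply/color_stabilizerP => y /=; rewrite hc gc.
Qed.

Lemma color_height_orbit (R : realType) (n : nat) :
  (forall p, (c p <= n)%N) ->
  (forall i, (i <= n)%N -> exists p, c p = i) ->
  (forall p, \forall q \near p, (c p <= c q)%N) ->
  (forall p q, c p = c q -> same_orbit p q) ->
  height R (color_stabilizer c) = n%:R%:E.
Proof.
move=> cn surj lsc trans; apply: color_height => // p q D cpq _ DG Dp.
by have [g gc <-] := trans _ _ cpq; exact: DG.
Qed.

End SameOrbit.

(** * Increasing bijections of the line *)

Section IncreasingBijections.
Variable R : realType.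

(** No continuity field: order alone gives it ([incr_continuous]), and the order is what the
    lexicographic square needs as well. *)
Record increasing_bijection := IncreasingBijection {
  incr_fun :> R -> R;
  incr_inv : R -> R;
  incr_funK : cancel incr_fun incr_inv;
  incr_invK : cancel incr_inv incr_fun;
  incr_le : {mono incr_fun : x y / x <= y} }.

Implicit Types f g : increasing_bijection.

Lemma incr_inv_le f : {mono incr_inv f : x y / x <= y}.
Proof. by move=> x y; rewrite -(incr_le f) !incr_invK. Qed.

Definition incr_recip f :=
  IncreasingBijection (incr_invK f) (incr_funK f) (incr_inv_le f).

Lemma incr_lt f : {mono f : x y / x < y}.
Proof. exact: leW_mono (incr_le f). Qed.

Lemma incr_continuous f : continuous f.
Proof.
move=> x; apply/cvgrPdist_lt => e e0.
have xl : incr_inv f (f x - e) < x by rewrite -(incr_lt f) incr_invK; lra.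
have xr : x < incr_inv f (f x + e) by rewrite -(incr_lt f) incr_invK; lra.
near=> z.
have : z \in `]incr_inv f (f x - e), incr_inv f (f x + e)[.
  by near: z; apply: near_in_itvoo; rewrite in_itv /= xl xr.
rewrite in_itv /= -(incr_lt f _ z) -(incr_lt f z) !incr_invK => /andP[? ?].
by rewrite ltr_norml; apply/andP; split; lra.
Unshelve. all: by end_near. Qed.

Program Definition increasing_comp f g :=
  @IncreasingBijection (f \o g) (incr_inv g \o incr_inv f) _ _ _.
Next Obligation. by move=> f g x /=; rewrite !incr_funK. Qed.
Next Obligation. by move=> f g x /=; rewrite !incr_invK. Qed.
Next Obligation. by move=> f g x y /=; rewrite !incr_le. Qed.

Definition supported01 f := forall x, ~~ (0 < x < 1) -> f x = x.

Lemma supported01_recip f : supported01 f -> supported01 (incr_recip f).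
Proof. by move=> sf x x01 /=; rewrite -{1}(sf x x01) incr_funK. Qed.

Lemma supported01_comp f g :
  supported01 f -> supported01 g -> supported01 (increasing_comp f g).
Proof. by move=> sf sg x x01 /=; rewrite sg// sf. Qed.

Lemma supported01_0 f : supported01 f -> f 0 = 0.
Proof. by apply; rewrite ltxx. Qed.

Lemma supported01_1 f : supported01 f -> f 1 = 1.
Proof. by apply; rewrite ltxx andbF. Qed.

Lemma supported01_in f x : supported01 f -> (0 < f x < 1) = (0 < x < 1).
Proof.
by move=> sf; rewrite -{1}(supported01_0 sf) -{1}(supported01_1 sf) !incr_lt.
Qed.

(** The log-odds coordinate, an order isomorphism of (0, 1) with the line. It turns translations of
    the line into maps of [0, 1] fixing both ends. *)
Definition logit (x : R) := ln (x / (1 - x)).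
Definition expit (w : R) := expR w / (1 + expR w).

Lemma expit_itv w : 0 < expit w < 1.
Proof.
have e0 := expR_gt0 w; have d0 : 0 < 1 + expR w by lra.
rewrite /expit divr_gt0//= ltr_pdivrMr//; lra.
Qed.

Lemma expitK : cancel expit logit.
Proof.
move=> w; rewrite /logit; have e0 := expR_gt0 w.
have d0 : 1 + expR w != 0 by apply: lt0r_neq0; lra.
have -> : 1 - expit w = (1 + expR w)^-1.
  rewrite /expit -[X in X - _](divff d0) -mulrBl -[RHS]mul1r; congr (_ * _); lra.
by rewrite /expit invrK mulfVK// expRK.
Qed.

Lemma logitK x : 0 < x < 1 -> expit (logit x) = x.
Proof.
move=> /andP[x0 x1]; have y0 : 0 < 1 - x by lra.
have q0 : 0 < x / (1 - x) by rewrite divr_gt0.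
rewrite /expit /logit lnK ?posrE//.
have yn0 := lt0r_neq0 y0.
have -> : 1 + x / (1 - x) = (1 - x)^-1.
  rewrite -[X in X + _](divff yn0) -mulrDl -[RHS]mul1r; congr (_ * _); lra.
by rewrite invrK mulfVK.
Qed.

Lemma expit_le : {mono expit : x y / x <= y}.
Proof.
apply: le_mono => x y xy; rewrite /expit.
have ex := expR_gt0 x; have ey := expR_gt0 y.
have exy : expR x < expR y by rewrite ltr_expR.
rewrite ltr_pdivrMr; last lra.
rewrite mulrAC ltr_pdivlMr; last lra.
nra.
Qed.

Lemma logit_le : {in [pred x | 0 < x < 1] &, {mono logit : x y / x <= y}}.
Proof. by move=> x y x01 y01; rewrite -expit_le !logitK. Qed.

Section Transport.
Variable h : increasing_bijection.

Let tfun (h : R -> R) x := if 0 < x < 1 then expit (h (logit x)) else x.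

Let tfunK (k k' : R -> R) : cancel k k' -> cancel (tfun k) (tfun k').
Proof.
move=> kK x; rewrite /tfun; have [x01|/negbTE x01] := boolP (0 < x < 1); last by rewrite x01.
by rewrite expit_itv expitK kK logitK.
Qed.

Let tfun_le : {mono tfun h : x y / x <= y}.
Proof.
move=> x y; rewrite /tfun; case: ifPn => x01; case: ifPn => y01 //.
- by rewrite expit_le incr_le logit_le.
- have /andP[] := expit_itv (h (logit x)).
  set e := expit _ => e0 e1; move: x01 y01 => /andP[x0 x1].
  by rewrite negb_and -!leNgt => /orP[y0|y1]; apply/idP/idP; lra.
- have /andP[] := expit_itv (h (logit y)).
  set e := expit _ => e0 e1; move: y01 x01 => /andP[x0 x1].
  by rewrite negb_and -!leNgt => /orP[y0|y1]; apply/idP/idP; lra.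
Qed.

Definition transport01 :=
  IncreasingBijection (tfunK (incr_funK h)) (tfunK (incr_invK h)) tfun_le.

Lemma transport01E x : 0 < x < 1 -> transport01 x = expit (h (logit x)).
Proof. by rewrite /= /tfun => ->. Qed.

Lemma transport01_supported : supported01 transport01.
Proof. by move=> x x01; rewrite /= /tfun (negbTE x01). Qed.

End Transport.

Program Definition translation (a : R) :=
  @IncreasingBijection (fun x => x + a) (fun x => x - a) _ _ _.
Next Obligation. by move=> a x; rewrite addrK. Qed.
Next Obligation. by move=> a x; rewrite subrK. Qed.
Next Obligation. by move=> a x y; rewrite lerD2r. Qed.

(** Conjugation by a translation: a map supported in (0, 1) becomes one supported in (a, a + 1), a
    gap of the integer lattice when a is an integer. *)
Program Definition shifted (a : R) f :=
  @IncreasingBijection (fun x => a + f (x - a)) (fun x => a + incr_inv f (x - a)) _ _ _.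
Next Obligation. by move=> a f x; rewrite addrAC subrr add0r incr_funK addrC subrK. Qed.
Next Obligation. by move=> a f x; rewrite addrAC subrr add0r incr_invK addrC subrK. Qed.
Next Obligation. by move=> a f x y; rewrite lerD2l incr_le lerD2r. Qed.

Program Definition dilated (k : R) (k0 : 0 < k) f :=
  @IncreasingBijection (fun x => k * f (x / k)) (fun x => k * incr_inv f (x / k)) _ _ _.
Next Obligation.
move=> k k0 f x; have kn0 := lt0r_neq0 k0.
by rewrite [_ / k]mulrC mulKf// incr_funK mulrC divfK.
Qed.
Next Obligation.
move=> k k0 f x; have kn0 := lt0r_neq0 k0.
by rewrite [_ / k]mulrC mulKf// incr_invK mulrC divfK.
Qed.
Next Obligation. by move=> k k0 f x y; rewrite ler_pM2l// incr_le ler_pM2r// invr_gt0. Qed.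

Lemma unit_transitive x y : 0 < x < 1 -> 0 < y < 1 ->
  exists2 f, supported01 f & f x = y.
Proof.
move=> x01 y01; exists (transport01 (translation (logit y - logit x))).
  exact: transport01_supported.
by rewrite transport01E//= addrC subrK logitK.
Qed.

(** [unit_transitive] scaled to (0, t); the support stays inside (0, t), so t is fixed. This moves
    points below the diagonal within one column of the Alexandroff square. *)
Lemma lower_transitive t x y : 0 < t < 1 -> 0 < x < t -> 0 < y < t ->
  exists f, [/\ supported01 f, f t = t & f x = y].
Proof.
move=> /andP[t0 t1] /andP[x0 xt] /andP[y0 yt].
have dv z : 0 < z -> z < t -> 0 < z / t < 1.
  by move=> z0 zt; rewrite divr_gt0//= ltr_pdivrMr// mul1r.
have [f sf fxy] := unit_transitive (dv x x0 xt) (dv y y0 yt).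
have fix_out z : ~~ (0 < z < t) -> dilated t0 f z = z.
  move=> zt; rewrite /= sf; first by rewrite mulrC divfK// lt0r_neq0.
  by rewrite ltr_pdivrMr// mul1r pmulr_lgt0// invr_gt0.
exists (dilated t0 f); split.
- move=> z z01; apply: fix_out; apply: contra z01 => /andP[-> zt] /=.
  exact: lt_trans t1.
- by apply: fix_out; rewrite ltxx andbF.
- by rewrite /= fxy mulrC divfK// lt0r_neq0.
Qed.

(* Via [logit], the integers get colour 0 and every gap between consecutive
   integers carries a copy of the previous pattern. Adding a whole lattice at a
   time, and not one fixed point, which would also split an interval into two
   orbits, raises the number of orbits by exactly one. *)
Fixpoint pattern (r : nat) (x : R) : nat :=
  if r is r'.+1 then
    let w := logit x in
    if w == (Num.floor w)%:~R then 0%N else (pattern r' (w - (Num.floor w)%:~R)).+1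
  else 0%N.

Lemma pattern_le r x : (pattern r x <= r)%N.
Proof. by elim: r x => //= r IH x; case: ifP => // _; rewrite ltnS. Qed.

Lemma pattern_surj r i : (i <= r)%N -> exists2 x, 0 < x < 1 & pattern r x = i.
Proof.
elim: r i => [|r IH] [|i] //= ir.
- by exists (1 / 2) => //; lra.
- exists (expit 0); first exact: expit_itv.
  by rewrite expitK floor0 eqxx.
- have [x x01 xi] := IH i ir; exists (expit x); first exact: expit_itv.
  have fx : Num.floor x = 0.
    by apply: floor_def; move: x01 => /andP[x0 x1]; rewrite add0r (ltW x0) x1.
  rewrite expitK fx subr0 xi ifF//; apply/negbTE/lt0r_neq0.
  by case/andP: x01.
Qed.

Lemma logit_continuous (x : R) : 0 < x < 1 -> {for x, continuous logit}.
Proof.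
move=> /andP[x0 x1]; rewrite /logit.
apply: (@continuous_comp _ _ _ (fun x : R => x / (1 - x)) (@ln R)).
  apply: cvgM; first exact: cvg_id.
  apply: cvgV; first by apply: lt0r_neq0; lra.
  apply: cvgB; [exact: cvg_cst|exact: cvg_id].
by apply: continuous_ln; rewrite divr_gt0//; lra.
Qed.

(** Lattice points have the least colour. In a gap the floor is locally constant, so the fractional
    part varies continuously and the induction hypothesis applies to it. *)
Lemma pattern_lsc r (x : R) : 0 < x < 1 ->
  \forall z \near x, (pattern r x <= pattern r z)%N.
Proof.
elim: r x => [|r IH] x x01; first by near=> z.
rewrite [pattern r.+1 x]/=; set w := logit x; set n := Num.floor w.
have [wn|wn] := eqVneq w n%:~R; first by near=> z.
have nw : n%:~R < w by rewrite lt_neqAle eq_sym wn ge_floor.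
have wn1 : w < n%:~R + 1 by have := floorD1_gt w; rewrite -/n intrD.
have near_w : \forall z \near x, n%:~R < logit z < n%:~R + 1.
  have nI : nbhs w [set u | n%:~R < u < n%:~R + 1].
    have := @near_in_itvoo R n%:~R (n%:~R + 1) w.
    rewrite in_itv /= nw wn1 => /(_ isT); apply: filterS => z.
    by rewrite in_itv.
  exact: (logit_continuous x01 nI).
have near_p : \forall z \near x, (pattern r (w - n%:~R) <= pattern r (logit z - n%:~R))%N.
  have wn01 : 0 < w - n%:~R < 1 by apply/andP; split; lra.
  have c : {for x, continuous (fun z => logit z - n%:~R)}.
    by apply: cvgB; [exact: logit_continuous|exact: cvg_cst].
  exact: c (IH _ wn01).
near=> z => /=.
have /andP[z1 z2] : n%:~R < logit z < n%:~R + 1 by near: z.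
have -> : Num.floor (logit z) = n.
  by apply: floor_def; rewrite (ltW z1) intrD.
rewrite ifF; last by apply/negbTE; rewrite gt_eqF.
by rewrite ltnS; near: z.
Unshelve. all: by end_near. Qed.

(** Integer translations in the [logit] coordinate preserve the pattern and are transitive on the
    lattice. Two points in gaps are first brought into the same gap, where the map of the induction
    hypothesis is inserted. *)
Lemma pattern_transitive r x y : 0 < x < 1 -> 0 < y < 1 ->
  pattern r x = pattern r y ->
  exists f, [/\ supported01 f, f x = y & forall z, 0 < z < 1 -> pattern r (f z) = pattern r z].
Proof.
elim: r x y => [|r IH] x y x01 y01.
  by move=> _; have [f sf fx] := unit_transitive x01 y01; exists f.
rewrite /=; set n := Num.floor (logit x); set m := Num.floor (logit y).
have shift (k : int) z : 0 < z < 1 ->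
    pattern r.+1 (transport01 (translation k%:~R) z) = pattern r.+1 z.
  move=> z01; rewrite transport01E//= expitK.
  have -> : Num.floor (logit z + k%:~R) = Num.floor (logit z) + k.
    by rewrite floorDrz ?intr_int// intrKfloor.
  by rewrite intrD (inj_eq (addIr _)) opprD addrACA subrr addr0.
have [xn|xn] := eqVneq (logit x) n%:~R; have [ym|ym] := eqVneq (logit y) m%:~R => //.
  move=> _.
  exists (transport01 (translation (m - n)%:~R)); split.
  - exact: transport01_supported.
  - by rewrite transport01E//= xn intrB addrC subrK -ym logitK.
  - exact: shift.
move=> [exy]; have frac01 (w : R) : w != (Num.floor w)%:~R -> 0 < w - (Num.floor w)%:~R < 1.
  move=> wn; have := ge_floor w; rewrite le_eqVlt eq_sym (negbTE wn)/= => h1.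
  have := floorD1_gt w; rewrite intrD => h2; apply/andP; split; lra.
have [g [sg gx gp]] := IH _ _ (frac01 _ xn) (frac01 _ ym) exy.
(* Acting by g inside (k, k + 1) alone keeps all floors and changes fractional parts there by g,
   which respects the inner pattern. *)
have gap (k : int) z : 0 < z < 1 ->
    pattern r.+1 (transport01 (shifted k%:~R g) z) = pattern r.+1 z.
  move=> z01; rewrite transport01E//= expitK.
  set w := logit z; set v := k%:~R + g (w - k%:~R).
  have [w01|w01] := boolP (0 < w - k%:~R < 1); last first.
    by have -> : v = w by rewrite /v sg// addrC subrK.
  have v01 : 0 < v - k%:~R < 1.
    by rewrite /v addrAC subrr add0r supported01_in.
  have fl (u : R) : 0 < u - k%:~R < 1 -> Num.floor u = k /\ (u == k%:~R) = false.
    move=> /andP[u0 u1]; split; last by apply/negbTE; rewrite gt_eqF// -subr_gt0.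
    by apply: floor_def; rewrite intrD; apply/andP; split; lra.
  have [-> ->] := fl _ v01; have [-> ->] := fl _ w01.
  by rewrite /v addrAC subrr add0r gp.
exists (increasing_comp (transport01 (shifted m%:~R g))
          (transport01 (translation (m - n)%:~R))); split.
- by apply: supported01_comp; exact: transport01_supported.
- change (transport01 (shifted m%:~R g)
    (transport01 (translation (m - n)%:~R) x) = y).
  rewrite (transport01E _ x01) transport01E ?expit_itv// expitK /=.
  have -> : logit x + (m - n)%:~R - m%:~R = logit x - n%:~R by rewrite intrB; lra.
  by rewrite gx addrC subrK logitK.
- move=> z z01; rewrite -[LHS]/(pattern r.+1 _) gap ?shift//.
  by rewrite supported01_in//; exact: transport01_supported.
Qed.

End IncreasingBijections.

(** * The unit interval and its order-preserving maps *)

Section UnitInterval.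
Variable R : realType.
Local Notation I := (unit_interval R).

Lemma unit_itv (u : I) : 0 <= \val u <= 1.
Proof. by have := set_mem (valP u); rewrite /= in_itv. Qed.

Lemma unit_ge0 (u : I) : 0 <= \val u.
Proof. by case/andP: (unit_itv u). Qed.

Lemma unit_le1 (u : I) : \val u <= 1.
Proof. by case/andP: (unit_itv u). Qed.

Lemma clamp_subproof (x : R) : Num.max 0 (Num.min 1 x) \in `[0 : R, 1]%classic.
Proof.
rewrite inE /= in_itv /= le_max lexx /= ge_max ler01 /=.
by rewrite ge_min lexx.
Qed.

(** A retraction of the whole line: curves are parametrized by all of R, and maps of R descend to
    the interval through it. *)
Definition clamp (x : R) : I := Sub (Num.max 0 (Num.min 1 x)) (clamp_subproof x).

Lemma clampE x : 0 <= x <= 1 -> \val (clamp x) = x.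
Proof. by case/andP=> x0 x1; rewrite /= (min_r x1) (max_r x0). Qed.

Lemma clampK (u : I) : clamp (\val u) = u.
Proof. by apply: val_inj; rewrite clampE// unit_itv. Qed.

Lemma unit_nbhsP (u : I) (U : set I) :
  nbhs u U <-> exists2 e : R, 0 < e & forall v : I, `|\val u - \val v| < e -> U v.
Proof.
split.
  case=> V [[W oW <-] Wu] sVU.
  have : nbhs (\val u) W by exact: open_nbhs_nbhs.
  move=> /nbhs_ballP[e e0 eW]; exists e => // v uv; apply: sVU.
  exact: eW.
case=> e e0 eU; exists (\val @^-1` (ball (\val u) e)); split.
- by exists (ball (\val u) e) => //; exact: ball_open.
- exact: ballxx.
- by move=> v /eU.
Qed.

Lemma unit_val_continuous : continuous (fun u : I => \val u).
Proof.
move=> u U /nbhs_ballP[e e0 eU]; apply/unit_nbhsP; exists e => // v uv.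
exact: eU.
Qed.

Lemma unit_continuousP (T : topologicalType) (f : T -> I) (x : T) :
  {for x, continuous (fun y : T => \val (f y))} -> {for x, continuous f}.
Proof.
move=> cf U /unit_nbhsP[e e0 eU].
apply: (@filterS _ _ _ (fun y => ball (\val (f x)) e (\val (f y)))).
  by move=> y; exact: eU.
exact: (cf _ (nbhsx_ballx _ _ e0)).
Qed.

Lemma clamp_continuous : continuous clamp.
Proof.
move=> x; apply: unit_continuousP => /=.
apply: continuous_max; first exact: cvg_cst.
by apply: continuous_min; [exact: cvg_cst|exact: cvg_id].
Qed.

Lemma unit_leE (u v : I) : (u <= v)%O = (\val u <= \val v).
Proof. by []. Qed.


Definition I0 := clamp 0.
Definition I1 := clamp 1.

Lemma I0E : \val I0 = 0. Proof. by rewrite clampE ?lexx ?ler01. Qed.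
Lemma I1E : \val I1 = 1. Proof. by rewrite clampE ?lexx ?ler01. Qed.

Definition onem_unit (u : I) : I := clamp (1 - \val u).

Lemma onem_unitE u : \val (onem_unit u) = 1 - \val u.
Proof. by rewrite clampE//; have := unit_itv u; lra. Qed.

Lemma onem_unitK : involutive onem_unit.
Proof. by move=> u; apply: val_inj; rewrite !onem_unitE; lra. Qed.

Lemma unit_lift_continuous (g : R -> R) :
  continuous g -> continuous (fun u : I => clamp (g (\val u))).
Proof.
move=> cg u; apply: (@continuous_comp _ _ _ (fun u : I => \val u) (clamp \o g)).
  exact: unit_val_continuous.
by apply: continuous_comp; [exact: cg|exact: clamp_continuous].
Qed.

Lemma onem_unit_continuous : continuous onem_unit.
Proof.
apply: (@unit_lift_continuous (fun x => 1 - x)) => x.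
by apply: cvgB; [exact: cvg_cst|exact: cvg_id].
Qed.

Variable f : increasing_bijection R.
Hypothesis sf : supported01 f.

Definition unit_map (u : I) : I := clamp (f (\val u)).

Lemma unit_mapE u : \val (unit_map u) = f (\val u).
Proof.
have /andP[u0 u1] := unit_itv u; rewrite clampE//; apply/andP; split.
  by rewrite -[X in X <= _](supported01_0 sf) incr_le.
by rewrite -[X in _ <= X](supported01_1 sf) incr_le.
Qed.

End UnitInterval.

Section UnitMap.
Variable R : realType.
Local Notation I := (unit_interval R).
Variable f : increasing_bijection R.
Hypothesis sf : supported01 f.

Lemma unit_mapK : cancel (unit_map f) (unit_map (incr_recip f)).
Proof.
move=> u; apply: val_inj; rewrite !unit_mapE//; last exact: supported01_recip.
exact: incr_funK.
Qed.

Lemma unit_map_continuous : continuous (unit_map f).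
Proof. exact/unit_lift_continuous/incr_continuous. Qed.

Lemma unit_map0 : unit_map f (I0 R) = I0 R.
Proof. by apply: val_inj; rewrite unit_mapE// I0E supported01_0. Qed.

Lemma unit_map1 : unit_map f (I1 R) = I1 R.
Proof. by apply: val_inj; rewrite unit_mapE// I1E supported01_1. Qed.

End UnitMap.

(** * The coloured extreme columns *)

Section EdgeColor.
Variables (R : realType) (r : nat).
Local Notation I := (unit_interval R).
Local Notation I0 := (I0 R).
Local Notation I1 := (I1 R).

Program Definition unit_homeo (f : increasing_bijection R) (sf : supported01 f) : homeo I :=
  @Homeo I (unit_map f) (unit_map (incr_recip f)) _ _ _ _.
Next Obligation. by move=> f sf; exact: unit_mapK. Qed.
Next Obligation. by move=> f sf; exact: (unit_mapK (supported01_recip sf)). Qed.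
Next Obligation. by move=> f sf; exact: unit_map_continuous. Qed.
Next Obligation. by move=> f sf; exact: unit_map_continuous. Qed.

Definition onem_homeo : homeo I :=
  Homeo (@onem_unitK R) (@onem_unitK R) (@onem_unit_continuous R) (@onem_unit_continuous R).

Lemma I0_neq_I1 : I0 != I1.
Proof.
by apply/eqP => /(congr1 \val); rewrite I0E I1E => /esym/eqP; rewrite oner_eq0.
Qed.

Lemma unit_interior (u : I) : (0 < \val u < 1) = (u != I0) && (u != I1).
Proof.
have /andP[u0 u1] := unit_itv u.
rewrite !lt_neqAle u0 u1 !andbT eq_sym; congr (~~ _ && ~~ _).
  by rewrite -(inj_eq val_inj) I0E.
by rewrite -(inj_eq val_inj) I1E.
Qed.

Lemma onem_unit0 : onem_unit I0 = I1.
Proof. by apply: val_inj; rewrite onem_unitE I0E I1E subr0. Qed.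

Lemma onem_unit1 : onem_unit I1 = I0.
Proof. by apply: val_inj; rewrite onem_unitE I0E I1E subrr. Qed.

Lemma onem_unit_eq (u v : I) : (onem_unit u == v) = (u == onem_unit v).
Proof. by rewrite -{1}(onem_unitK v) (inj_eq (can_inj (@onem_unitK R))). Qed.

Definition edge_color (y : I) : nat :=
  if y == I0 then 0%N else if y == I1 then 1%N else (pattern r (\val y)).+2.

Lemma edge_color_le y : (edge_color y <= r.+2)%N.
Proof. by rewrite /edge_color; do 2!case: ifP => // _; rewrite !ltnS pattern_le. Qed.

Lemma edge_color_surj i : (i <= r.+2)%N -> exists y, edge_color y = i.
Proof.
case: i => [|[|i]]; rewrite ?ltnS.
- by exists I0; rewrite /edge_color eqxx.
- by exists I1; rewrite /edge_color eqxx eq_sym (negbTE I0_neq_I1).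
move=> /(@pattern_surj R)[x /andP[x0 x1] xi]; exists (clamp x).
have vx : \val (clamp x) = x by rewrite clampE// !ltW.
have : 0 < \val (clamp x) < 1 by rewrite vx x0.
by rewrite /edge_color unit_interior => /andP[/negbTE-> /negbTE->]; rewrite vx xi.
Qed.

Lemma unit_near_neq (y z : I) : y != z -> \forall u \near y, u != z.
Proof.
move=> yz; apply/unit_nbhsP; exists `|\val y - \val z|.
  by rewrite normr_gt0 subr_eq0 (inj_eq val_inj).
by move=> v; apply: contraTneq => ->; rewrite ltxx.
Qed.

Lemma edge_color_lsc y : \forall z \near y, (edge_color y <= edge_color z)%N.
Proof.
have [->|y0] := eqVneq y I0.
  by near=> z; rewrite {1}/edge_color eqxx.
have := unit_near_neq y0; have [->|y1] := eqVneq y I1.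
  apply: filterS => z z0; rewrite {1}/edge_color eq_sym (negbTE I0_neq_I1) eqxx.
  by rewrite /edge_color (negbTE z0); case: ifP.
move=> n0; have n1 := unit_near_neq y1.
have y01 : 0 < \val y < 1 by rewrite unit_interior y0.
have np := unit_val_continuous (pattern_lsc r y01).
near=> z; rewrite /edge_color (negbTE y0) (negbTE y1).
have z0 : z != I0 by near: z.
have z1 : z != I1 by near: z.
rewrite (negbTE z0) (negbTE z1) !ltnS; near: z.
exact: np.
Unshelve. all: by end_near. Qed.

Lemma edge_color_transitive y z : edge_color y = edge_color z ->
  exists2 f : increasing_bijection R, supported01 f &
    unit_map f y = z /\ forall u, edge_color (unit_map f u) = edge_color u.
Proof.
have pres f : supported01 f ->
    (forall x : R, 0 < x < 1 -> pattern r (f x) = pattern r x) ->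
    forall u, edge_color (unit_map f u) = edge_color u.
  move=> sf fp u; rewrite /edge_color.
  have fi := can_inj (unit_mapK sf).
  rewrite -{1}(unit_map0 sf) -{1}(unit_map1 sf) !(inj_eq fi).
  have [//|u0] := eqVneq u I0; have [//|u1] := eqVneq u I1.
  by rewrite unit_mapE// fp// unit_interior u0.
(* When y and z are the same end, any pattern-preserving map will do, since all of them fix the
   ends; the one taking 1/2 to itself is used. *)
have h01 : 0 < (1 / 2 : R) < 1 by lra.
rewrite {1 2}/edge_color.
have [->|y0] := eqVneq y I0; have [->|z0] := eqVneq z I0; rewrite ?eqxx; try by case: ifP.
  move=> _; have [f [sf _ fp]] := pattern_transitive h01 h01 (erefl (pattern r _)).
  by exists f => //; split; [exact: unit_map0|exact: pres].
have [->|y1] := eqVneq y I1; have [->|z1] := eqVneq z I1 => //.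
  move=> _; have [f [sf _ fp]] := pattern_transitive h01 h01 (erefl (pattern r _)).
  by exists f => //; split; [exact: unit_map1|exact: pres].
move=> [yz]; have [||f [sf fyz fp]] := @pattern_transitive R r (\val y) (\val z) _ _ yz.
- by rewrite unit_interior y0.
- by rewrite unit_interior z0.
exists f => //; split; last exact: pres.
by apply: val_inj; rewrite unit_mapE.
Qed.

End EdgeColor.

(** * The Alexandroff square *)

Section AlexandroffSquare.
Variable R : realType.
Local Notation I := (unit_interval R).
Local Notation I0 := (I0 R).
Local Notation I1 := (I1 R).
Local Notation A := (alexandroff_square R).

Lemma alexandroff_nbhs_base (p : A) (U : set A) :
  nbhs p U <-> exists2 B, alexandroff_base B & B p /\ B `<=` U.
Proof.
split; last first.
  move=> [B bB [Bp BU]]; rewrite nbhsE; exists B => //; split => //.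
  exists [set B]; last by rewrite bigcup_set1.
  by move=> _ ->.
rewrite nbhsE => -[V [[D sD <-] [B DB Bp]] VU]; exists B; first exact: sD.
by split => // q Bq; apply: VU; exists B.
Qed.

(** The column without its diagonal point is open and carries the Euclidean topology. *)
Lemma alexandroff_nbhs_off (x y : I) (U : set A) : y != x ->
  nbhs ((x, y) : A) U <-> nbhs y [set z | U (x, z)].
Proof.
move=> yx; rewrite alexandroff_nbhs_base; split.
  move=> [_ [[t [V [oV tV ->]]]|[V [F [oV fF ->]]]] [[/=]]].
    move=> -> Vy sU; rewrite nbhsE; exists V => // z Vz.
    exact: sU.
  move=> [_ Vy] nF sU; rewrite nbhsE; exists V => // z Vz.
  by apply: sU; split => // -[].
rewrite nbhsE => -[V [oV Vy] VU].
exists ([set x] `*` (V `&` [set z | z != x])); last first.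
  by split => // -[_ z] /= [-> [Vz _]]; exact: VU.
left; exists x, (V `&` [set z | z != x]); split => //; last by rewrite /= eqxx => -[].
apply: openI => //; rewrite openE => z zx; exact: unit_near_neq.
Qed.

(** Basic sets inside one column avoid its diagonal point, so only strips with finitely many columns
    removed count here. *)
Lemma alexandroff_nbhs_diag (x : I) (U : set A) :
  nbhs ((x, x) : A) U <->
  exists2 F : set I, finite_set F &
    ~ F x /\ (\forall y \near x, forall z, ~ F z -> U (z, y)).
Proof.
rewrite alexandroff_nbhs_base; split.
  move=> [_ [[t [V [oV tV ->]]]|[V [F [oV fF ->]]]] [[/=]]].
    by move=> xt Vx _; case: tV; rewrite -xt.
  move=> [_ Vy] nF sU; exists F => //; split; first by move=> Fx; apply: nF.
  have : nbhs x V by exact: open_nbhs_nbhs.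
  apply: filterS => y Vy' z Fz.
  by apply: sU; split => // -[].
move=> [F fF [nFx nU]].
have : nbhs x [set y | forall z, ~ F z -> U (z, y)] by [].
rewrite nbhsE => -[V [oV Vx] VU].
exists (([set: _] `*` V) `\` (F `*` [set: _])).
  by right; exists V, F.
split; first by split => //= -[].
move=> [z y] [[_ /= Vy] nF]; apply: VU => // Fz.
exact: nF.
Qed.

Section SquareMap.
Variable f : homeo I.

Let sq (g : homeo I) (p : A) : A := (g p.1, g p.2).

Let sq_continuous g : continuous (sq g).
Proof.
move=> [x y] U /=.
have [->|yx] := eqVneq y x.
  move=> /alexandroff_nbhs_diag[F fF [nF nU]]; apply/alexandroff_nbhs_diag.
  exists (homeo_inv g @` F); first exact: finite_image.
  split; first by move=> [z Fz zx]; apply: nF; rewrite -zx homeo_invK.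
  have : nbhs x [set t | forall z, ~ F z -> U (z, g t)].
    exact: @homeo_fun_continuous _ g _ _ nU.
  apply: filterS => t /= H z nz.
  by apply: H => Fz; apply: nz; exists (g z) => //; rewrite homeo_funK.
have gyx : g y != g x by rewrite (inj_eq (can_inj (homeo_funK g))).
move=> /(alexandroff_nbhs_off _ gyx) nU; apply/alexandroff_nbhs_off => //.
exact: @homeo_fun_continuous _ g _ _ nU.
Qed.

(** One map acts on both coordinates, which sends the diagonal, where neighbourhoods change type, to
    itself. *)
Program Definition square_homeo : homeo A :=
  @Homeo A (sq f) (sq (homeo_recip f)) _ _
    (@sq_continuous f) (@sq_continuous (homeo_recip f)).
Next Obligation. by move=> [x y]; rewrite /sq /= !homeo_funK. Qed.
Next Obligation. by move=> [x y]; rewrite /sq /= !homeo_invK. Qed.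

Lemma square_homeoE x y : square_homeo (x, y) = (f x, f y).
Proof. by []. Qed.

End SquareMap.

Section ColumnMap.
Variables (t : I) (f : homeo I).
Hypothesis ft : f t = t.

Let col (g : homeo I) (p : A) : A := (p.1, if p.1 == t then g p.2 else p.2).

Let col_continuous (g : homeo I) : g t = t -> continuous (col g).
Proof.
move=> gt [x y] U; rewrite /col /=.
have [->|yx] := eqVneq y x.
  have -> : (if x == t then g x else x) = x by case: eqP => // ->.
  move=> /alexandroff_nbhs_diag[F fF [nF nU]]; apply/alexandroff_nbhs_diag.
  have [xt|xt] := eqVneq x t.
    exists F => //; split => //; have gx : g x = x by rewrite xt.
    have nU' : nbhs (g x) (fun y => forall z, ~ F z -> U (z, y)) by rewrite gx.
    have gU : nbhs x [set y | forall z, ~ F z -> U (z, g y)].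
      exact: @homeo_fun_continuous _ g _ _ nU'.
    near=> v => z Fz /=.
    by case: ifP => _; move: z Fz; near: v; [exact: gU|exact: nU].
  (* At (x, x) with x != t the moved column is just one more finite exception; this is why a single
     column can be moved alone. *)
  exists (F `|` [set t]); first by rewrite finite_setU.
  split; first by move=> [//|/= xt']; rewrite xt' eqxx in xt.
  apply: filterS nU => z H s nz /=; case: eqP => [st|_].
    by exfalso; apply: nz; right.
  by apply: H => Fs; apply: nz; left.
have gyx : (if x == t then g y else y) != x.
  have [xt|//] := eqVneq x t; move: yx.
  by rewrite xt -[X in _ -> _ != X]gt (inj_eq (can_inj (homeo_funK g))).
move=> /(alexandroff_nbhs_off _ gyx) nU; apply/alexandroff_nbhs_off => //.
by have [xt|xt] := boolP (x == t); move: nU; rewrite /mkset /= ?xt ?(negbTE xt) // => nU;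
  exact: @homeo_fun_continuous _ g _ _ nU.
Unshelve. all: by end_near. Qed.

Lemma recip_fixed : homeo_recip f t = t.
Proof. by rewrite -{1}ft /= homeo_funK. Qed.

Program Definition column_homeo : homeo A :=
  @Homeo A (col f) (col (homeo_recip f)) _ _ (col_continuous ft) (col_continuous recip_fixed).
Next Obligation. by move=> [x y]; rewrite /col /=; case: (x == t); rewrite ?homeo_funK. Qed.
Next Obligation. by move=> [x y]; rewrite /col /=; case: (x == t); rewrite ?homeo_invK. Qed.

Lemma column_homeoE x y : column_homeo (x, y) = (x, if x == t then f y else y).
Proof. by []. Qed.

End ColumnMap.
End AlexandroffSquare.

(** * Colourings with patterned extreme columns *)

Section FramedColor.
Variables (R : realType) (r : nat).
Local Notation I := (unit_interval R).
Local Notation I0 := (I0 R).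
Local Notation I1 := (I1 R).

(** The right column is read upside down, so that the half turn exchanges the two columns together
    with their colours. The columns use up the colours 0 to [r.+2], whence the offset of the inner
    ones. *)
Definition framed_color (m : I -> I -> nat) (p : I * I) : nat :=
  if p.1 == I0 then edge_color r p.2
  else if p.1 == I1 then edge_color r (onem_unit p.2)
  else (r.+3 + m p.1 p.2)%N.

Variables (m : I -> I -> nat) (k : nat).
Hypothesis mk : forall x y, (m x y <= k)%N.

Lemma framed_color0 y : framed_color m (I0, y) = edge_color r y.
Proof. by rewrite /framed_color eqxx. Qed.

Lemma framed_color1 y : framed_color m (I1, y) = edge_color r (onem_unit y).
Proof. by rewrite /framed_color eqxx eq_sym (negbTE (I0_neq_I1 R)). Qed.

Lemma framed_color_in x y : x != I0 -> x != I1 ->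
  framed_color m (x, y) = (r.+3 + m x y)%N.
Proof. by move=> /negbTE x0 /negbTE x1; rewrite /framed_color x0 x1. Qed.

Lemma framed_color_le p : (framed_color m p <= r.+3 + k)%N.
Proof.
have el y : (edge_color r y <= r.+3 + k)%N.
  by apply: leq_trans (edge_color_le r y) _; rewrite ltnW// leq_addr.
by rewrite /framed_color; do 2!case: ifP => // _; rewrite leq_add2l.
Qed.

Lemma framed_color_surj :
  (forall i, (i <= k)%N ->
     exists2 x, (x != I0) && (x != I1) & exists y, m x y = i) ->
  forall i, (i <= r.+3 + k)%N -> exists p, framed_color m p = i.
Proof.
move=> msurj i ik; have [ir|ir] := leqP i r.+2.
  by have [y yi] := edge_color_surj R ir; exists (I0, y); rewrite framed_color0.
have : (i - r.+3 <= k)%N by rewrite leq_subLR.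
move=> /msurj[x /andP[x0 x1] [y mxy]]; exists (x, y).
by rewrite framed_color_in// mxy subnKC.
Qed.

Lemma onem_interior x : (x != I0) && (x != I1) = (onem_unit x != I0) && (onem_unit x != I1).
Proof. by rewrite !onem_unit_eq onem_unit0 onem_unit1 andbC. Qed.

Lemma framed_color_onem x y :
  (forall x y, m (onem_unit x) (onem_unit y) = m x y) ->
  framed_color m (onem_unit x, onem_unit y) = framed_color m (x, y).
Proof.
move=> mo; have [->|x0] := eqVneq x I0.
  by rewrite onem_unit0 framed_color1 framed_color0 onem_unitK.
have [->|x1] := eqVneq x I1.
  by rewrite onem_unit1 framed_color1 framed_color0.
have /andP[ox0 ox1] : (onem_unit x != I0) && (onem_unit x != I1).
  by rewrite -onem_interior x0.
by rewrite !framed_color_in// mo.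
Qed.

End FramedColor.

Section AlexandroffRealization.
Variables (R : realType) (r : nat).
Local Notation I := (unit_interval R).
Local Notation I0 := (I0 R).
Local Notation I1 := (I1 R).
Local Notation A := (alexandroff_square R).

Definition alexandroff_inner (x y : I) : nat :=
  if y == x then 0%N else if (y == I0) || (y == I1) then 1%N else 2%N.

Definition alexandroff_color : A -> nat := framed_color r alexandroff_inner.
Local Notation c := alexandroff_color.

Lemma alexandroff_inner_le x y : (alexandroff_inner x y <= 2)%N.
Proof. by rewrite /alexandroff_inner; case: ifP => // _; case: ifP. Qed.

Lemma alexandroff_color_surj i : (i <= r.+3 + 2)%N -> exists p, c p = i.
Proof.
apply: framed_color_surj.
have vc (a : R) : 0 < a < 1 -> (clamp a != I0) && (clamp a != I1).
  by move=> a01; rewrite -unit_interior clampE//; case/andP: a01 => /ltW-> /ltW->.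
have h2 : 0 < (1 / 2 : R) < 1 by lra.
have h3 : 0 < (1 / 3 : R) < 1 by lra.
have /andP[a0 a1] := vc _ h2; have /andP[b0 b1] := vc _ h3.
case=> [|[|[|//]]] _; exists (clamp (1 / 2)); rewrite ?a0//.
- by exists (clamp (1 / 2)); rewrite /alexandroff_inner eqxx.
- by exists I0; rewrite /alexandroff_inner eq_sym (negbTE a0) eqxx.
- exists (clamp (1 / 3)); rewrite /alexandroff_inner (negbTE b0) (negbTE b1).
  rewrite ifF//; apply/negbTE/eqP => /(congr1 \val).
  by rewrite !clampE; lra.
Qed.

Lemma alexandroff_color_lsc p : \forall q \near p, (c p <= c q)%N.
Proof.
case: p => x y; have inner u v : u != I0 -> u != I1 -> (r.+3 <= c (u, v))%N.
  by move=> u0 u1; rewrite /c framed_color_in// leq_addr.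
have [->|x0] := eqVneq x I0.
  have [->|y0] := eqVneq y I0.
    by near=> q; rewrite {1}/c framed_color0 /edge_color eqxx.
  apply/(alexandroff_nbhs_off _ y0); rewrite /c framed_color0.
  apply: filterS (edge_color_lsc r y) => z; rewrite /mkset => yz.
  by rewrite framed_color0.
have [->|x1] := eqVneq x I1.
  have [->|y1] := eqVneq y I1.
    by near=> q; rewrite {1}/c framed_color1 onem_unit1 /edge_color eqxx.
  apply/(alexandroff_nbhs_off _ y1); rewrite /c framed_color1.
  have : nbhs (onem_unit y) [set z | (edge_color r (onem_unit y) <= edge_color r z)%N].
    exact: edge_color_lsc.
  move=> /(@onem_unit_continuous R y) nE.
  have : nbhs y [set z | (edge_color r (onem_unit y) <= edge_color r (onem_unit z))%N] by [].
  apply: filterS => z; rewrite /mkset => yz.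
  by rewrite framed_color1.
have [->|yx] := eqVneq y x.
  (* Removing the two extreme columns from the neighbourhood leaves only colours of at least [r.+3],
     the colour of the point itself. *)
  apply/alexandroff_nbhs_diag; exists [set I0; I1]; first by rewrite finite_setU; split.
  split; first by move=> [/= x0'|/= x1']; [rewrite x0' eqxx in x0|rewrite x1' eqxx in x1].
  near=> y' => z nz; rewrite {1}/c framed_color_in// /alexandroff_inner eqxx addn0.
  by apply: inner; apply/eqP => zE; apply: nz; [left|right].
apply/(alexandroff_nbhs_off _ yx).
have nx : nbhs y [set z | z != x] := unit_near_neq yx.
have [ye|ye] := boolP ((y == I0) || (y == I1)).
  apply: filterS nx => z; rewrite {1}/mkset => zx; rewrite /mkset /c !framed_color_in// leq_add2l.
  by rewrite /alexandroff_inner (negbTE yx) (negbTE zx) ye; case: ifP.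
move: (ye); rewrite negb_or => /andP[/unit_near_neq n0 /unit_near_neq n1].
near=> z; rewrite /mkset /c !framed_color_in// leq_add2l.
have z0 : z != I0 by near: z.
have z1 : z != I1 by near: z.
have zx : z != x by near: z.
by rewrite /alexandroff_inner (negbTE yx) (negbTE zx) (negbTE ye) (negbTE z0) (negbTE z1).
Unshelve. all: by end_near. Qed.

Local Notation "p ~~> q" := (same_orbit c p q) (at level 70).

Lemma alexandroff_orbit_onem x y : (x, y) ~~> (onem_unit x, onem_unit y).
Proof.
exists (square_homeo (onem_homeo R)) => //; apply/color_stabilizerP => -[u v].
rewrite square_homeoE; apply: framed_color_onem => a b.
rewrite /alexandroff_inner (inj_eq (can_inj (@onem_unitK R))).
by rewrite !onem_unit_eq onem_unit0 onem_unit1 orbC.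
Qed.

Lemma alexandroff_orbit_column t y (g : homeo I) : g t = t ->
  (forall z, c (t, g z) = c (t, z)) -> (t, y) ~~> (t, g y).
Proof.
move=> gt gc; exists (column_homeo gt); last by rewrite column_homeoE eqxx.
apply/color_stabilizerP => -[u v]; rewrite column_homeoE.
by case: eqP => // ->.
Qed.

Lemma alexandroff_orbit_edge y z : edge_color r y = edge_color r z -> (I0, y) ~~> (I0, z).
Proof.
move=> /edge_color_transitive[f sf [<- fc]].
apply: (@alexandroff_orbit_column I0 y (unit_homeo sf)) => [|v].
  exact: unit_map0.
by rewrite /c !framed_color0 fc.
Qed.

(* [square_homeo f] disturbs the pattern on the two extreme columns, where it
   is undone by a column homeomorphism. *)
Lemma alexandroff_orbit_square (f : increasing_bijection R) x y :
  supported01 f -> x != I0 -> x != I1 ->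
  (x, y) ~~> (unit_map f x, unit_map f y).
Proof.
move=> sf x0 x1; pose g := unit_homeo sf; pose g' := homeo_recip g.
have g0 : g I0 = I0 by exact: unit_map0.
have g1 : g I1 = I1 by exact: unit_map1.
have g'0 : g' I0 = I0 by rewrite -{1}g0 /g' /= unit_mapK.
have g'1 : g' I1 = I1 by rewrite -{1}g1 /g' /= unit_mapK.
have gi := can_inj (homeo_funK g).
exists (homeo_mul (square_homeo g) (homeo_mul (column_homeo g'0) (column_homeo g'1))).
  apply/color_stabilizerP => -[u v].
  rewrite -[LHS]/(c (g u, g (if u == I0 then g' (if u == I1 then g' v else v)
                             else if u == I1 then g' v else v))).
  have [->|u0] := eqVneq u I0.
    rewrite (negbTE (I0_neq_I1 R)) g0 /c !framed_color0.
    by rewrite -[g (g' v)]/(homeo_fun g (homeo_inv g v)) homeo_invK.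
  have [->|u1] := eqVneq u I1.
    rewrite g1 /c !framed_color1.
    by rewrite -[g (g' v)]/(homeo_fun g (homeo_inv g v)) homeo_invK.
  have gu0 : g u != I0 by rewrite -{1}g0 (inj_eq gi).
  have gu1 : g u != I1 by rewrite -{1}g1 (inj_eq gi).
  rewrite /c !framed_color_in// /alexandroff_inner (inj_eq gi).
  by rewrite -{1}g0 -{1}g1 !(inj_eq gi).
by rewrite /= (negbTE x0) (negbTE x1).
Qed.

Lemma alexandroff_orbit_lower t y z : t != I0 -> t != I1 ->
  0 < \val y < \val t -> 0 < \val z < \val t -> (t, y) ~~> (t, z).
Proof.
move=> t0 t1 yt zt; have t01 : 0 < \val t < 1 by rewrite unit_interior t0.
have [f [sf ft fyz]] := lower_transitive t01 yt zt.
have -> : z = unit_homeo sf y by apply: val_inj; rewrite -fyz -unit_mapE.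
have gt : unit_homeo sf t = t by apply: val_inj; rewrite -[RHS]ft -unit_mapE.
apply: alexandroff_orbit_column => // v; rewrite /c !framed_color_in//.
have gi := can_inj (homeo_funK (unit_homeo sf)).
have g0 : unit_homeo sf I0 = I0 by exact: unit_map0.
have g1 : unit_homeo sf I1 = I1 by exact: unit_map1.
rewrite /alexandroff_inner -{1}gt (inj_eq gi).
by rewrite -{1}g0 -{1}g1 !(inj_eq gi).
Qed.

Lemma alexandroff_orbit_shift x y t : x != I0 -> x != I1 -> t != I0 -> t != I1 ->
  exists f, supported01 f /\ unit_map f x = t /\ (x, y) ~~> (t, unit_map f y).
Proof.
move=> x0 x1 t0 t1.
have x01 : 0 < \val x < 1 by rewrite unit_interior x0.
have t01 : 0 < \val t < 1 by rewrite unit_interior t0.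
have [f sf fxt] := unit_transitive x01 t01; exists f; split=> //.
have ft : unit_map f x = t by apply: val_inj; rewrite unit_mapE.
by split => //; rewrite -ft; exact: alexandroff_orbit_square.
Qed.

(** The half turn reverses column t but carries it to column 1 - t; a square map brings it back. The
    net effect exchanges the parts above and below the diagonal point. *)
Lemma alexandroff_orbit_swap t y : t != I0 -> t != I1 ->
  exists z, (t, y) ~~> (t, z) /\ [/\ (z == I0) = (y == I1), (z == I1) = (y == I0)
    & (\val z < \val t) = (\val t < \val y)].
Proof.
move=> t0 t1; have /andP[ot0 ot1] : (onem_unit t != I0) && (onem_unit t != I1).
  by rewrite -onem_interior t0.
have [f [sf [ft H]]] := alexandroff_orbit_shift (onem_unit y) ot0 ot1 t0 t1.
exists (unit_map f (onem_unit y)); split.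
  exact: same_orbit_trans (alexandroff_orbit_onem t y) H.
have fi := can_inj (unit_mapK sf).
split.
- by rewrite -{1}(unit_map0 sf) (inj_eq fi) onem_unit_eq onem_unit0.
- by rewrite -{1}(unit_map1 sf) (inj_eq fi) onem_unit_eq onem_unit1.
by rewrite -{1}ft !unit_mapE// incr_lt !onem_unitE; apply/idP/idP; lra.
Qed.

Lemma alexandroff_orbit p q : c p = c q -> p ~~> q.
Proof.
have side (x y : I) : x == I0 \/ x == I1 -> exists z, (x, y) ~~> (I0, z).
  move=> [/eqP->|/eqP->]; first by exists y; exact: same_orbit_refl.
  by exists (onem_unit y); rewrite -onem_unit1; exact: alexandroff_orbit_onem.
have cE p' q' : p' ~~> q' -> c p' = c q' by move=> [g /color_stabilizerP gc <-]; rewrite gc.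
have elt y (n : nat) : edge_color r y <> (r.+3 + n)%N.
  by move=> e; have := edge_color_le r y; rewrite e addSn ltnNge leq_addr.
have rim (x y : I) : (x == I0) || (x == I1) || (x != I0) && (x != I1).
  by case: (x == I0); case: (x == I1).
case: p q => [x y] [x' y'] cpq.
have [/orP/(side x y)[z xz]|] := boolP ((x == I0) || (x == I1)).
  have [/orP/(side x' y')[z' xz']|] := boolP ((x' == I0) || (x' == I1)).
    apply: (same_orbit_trans xz (same_orbit_trans _ (same_orbit_sym xz'))).
    apply: alexandroff_orbit_edge.
    by move: cpq; rewrite (cE _ _ xz) (cE _ _ xz') /c !framed_color0.
  rewrite negb_or => /andP[x'0 x'1]; move: cpq.
  by rewrite (cE _ _ xz) /c framed_color0 framed_color_in// => /elt.
rewrite negb_or => /andP[x0 x1].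
have [/orP/(side x' y')[z' xz']|] := boolP ((x' == I0) || (x' == I1)).
  by move: cpq; rewrite (cE _ _ xz') /c framed_color0 framed_color_in// => /esym/elt.
rewrite negb_or => /andP[x'0 x'1].
(* Both points are put into one column t; it remains to compare heights within that column. *)
have [f [_ [_ xy]]] := alexandroff_orbit_shift y x0 x1 x'0 x'1.
apply: (same_orbit_trans xy _); move: cpq; rewrite (cE _ _ xy).
move: {xy f x x0 x1 y} (unit_map f y) x'0 x'1; rename x' into t; rename y' into z => y t0 t1.
rewrite /c !framed_color_in// => /addnI.
rewrite /alexandroff_inner.
have [->|yt] := eqVneq y t.
  have [-> _|_] := eqVneq z t; first exact: same_orbit_refl.
  by case: ifP.
have [//|zt] := eqVneq z t; first by case: ifP.
have [ye|ye] := boolP (_ || _); have [ze|ze] := boolP (_ || _) => // _.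
  have [->|yz] := eqVneq y z; first exact: same_orbit_refl.
  have [w [yw [w0 w1 _]]] := alexandroff_orbit_swap y t0 t1.
  suff <- : w = z by [].
  case/orP: ye yz w0 w1 => /eqP ->; case/orP: ze => /eqP ->; rewrite ?eqxx//.
    by move=> _ _ /eqP.
  by move=> _ /eqP.
(* A point above the diagonal is swapped below it, where [alexandroff_orbit_lower] acts
   transitively. *)
have lower u : u != t -> ~~ ((u == I0) || (u == I1)) ->
    exists2 w, (t, u) ~~> (t, w) & 0 < \val w < \val t.
  move=> ut; rewrite negb_or => /andP[u0 u1].
  have /andP[u0' u1'] : 0 < \val u < 1 by rewrite unit_interior u0.
  have [ltut|] := ltP (\val u) (\val t).
    by exists u; [exact: same_orbit_refl|rewrite u0'].
  rewrite le_eqVlt (inj_eq val_inj) eq_sym (negbTE ut)/= => lttu.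
  have [w [uw [w0 w1 wt]]] := alexandroff_orbit_swap u t0 t1.
  exists w => //; rewrite wt lttu andbT.
  have : 0 < \val w < 1 by rewrite unit_interior w0 w1 u0 u1.
  by case/andP.
have [w yw wt] := lower y yt ye; have [w' zw w't] := lower z zt ze.
apply: (same_orbit_trans yw (same_orbit_trans _ (same_orbit_sym zw))).
exact: alexandroff_orbit_lower.
Qed.

Lemma alexandroff_height : height R (color_stabilizer c) = (r.+3 + 2)%N%:R%:E.
Proof.
apply: color_height_orbit.
- by move=> p; apply: framed_color_le => x y; exact: alexandroff_inner_le.
- exact: alexandroff_color_surj.
- exact: alexandroff_color_lsc.
- exact: alexandroff_orbit.
Qed.

End AlexandroffRealization.

(** * The lexicographic square *)

Section OrderTopology.
Context {d : Order.disp_t} {oT : orderTopologicalType d}.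

Lemma order_cvg (F : set_system oT) {FF : Filter F} (x : oT) :
  (forall a : oT, (a < x)%O -> F [set q : oT | (a < q)%O]) ->
  (forall b : oT, (x < b)%O -> F [set q : oT | (q < b)%O]) -> F --> x.
Proof.
move=> Fl Fr U; rewrite nbhs_simpl itv_nbhsE => -[i [oi xi] /filterS]; apply.
case: i oi xi => [[[]l|[]] [[]s|[]]] //= _; rewrite in_itv /= ?andbT => xi.
- case/andP: xi => /Fl H1 /Fr H2; apply: filterS2 H1 H2 => q /= lq qs.
  by rewrite in_itv /= lq.
- by apply: filterS (Fl _ xi) => q lq /=; rewrite in_itv /= andbT.
- by apply: filterS (Fr _ xi) => q lq /=; rewrite in_itv.
- by apply: filterE => q /=; rewrite in_itv.
Qed.

Lemma nbhs_order_gt (a x : oT) : (a < x)%O -> nbhs x [set q | (a < q)%O].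
Proof.
move=> ax; have -> : [set q | (a < q)%O] = `]a, +oo[%classic by rewrite set_itvE.
by apply: open_nbhs_nbhs; split; [exact: rray_open|rewrite set_itvE].
Qed.

Lemma nbhs_order_lt (b x : oT) : (x < b)%O -> nbhs x [set q | (q < b)%O].
Proof.
move=> xb; have -> : [set q | (q < b)%O] = `]-oo, b[%classic by rewrite set_itvE.
by apply: open_nbhs_nbhs; split; [exact: lray_open|rewrite set_itvE].
Qed.

Lemma order_mono_continuous (f g : oT -> oT) : cancel f g -> cancel g f ->
  {mono f : x y / (x <= y)%O} -> continuous f.
Proof.
move=> fK gK fm x; have fl := leW_mono fm.
apply: order_cvg => a ax.
- have /nbhs_order_gt : (g a < x)%O by rewrite -fl gK.
  by apply: filterS => q /=; rewrite -(fl (g a)) gK.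
- have /nbhs_order_lt : (x < g a)%O by rewrite -fl gK.
  by apply: filterS => q /=; rewrite -(fl q) gK.
Qed.

Lemma order_anti_continuous (f : oT -> oT) : involutive f ->
  {mono f : x y /~ (x <= y)%O} -> continuous f.
Proof.
move=> fK fm x; have fl := leW_nmono fm.
apply: order_cvg => a ax.
- have /nbhs_order_lt : (x < f a)%O by rewrite -(fl (f a)) fK.
  by apply: filterS => q /=; rewrite -(fl (f a)) fK.
- have /nbhs_order_gt : (f a < x)%O by rewrite -(fl x) fK.
  by apply: filterS => q /=; rewrite -(fl q) fK.
Qed.

End OrderTopology.

Section LexicographicSquare.
Variable R : realType.
Local Notation I := (unit_interval R).
Local Notation I0 := (I0 R).
Local Notation I1 := (I1 R).
(* [lexicographic_square] is a bare topological space; this is the same space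
   together with its order. *)
Definition lex_square : orderTopologicalType _ := order_topology (I *l I).
Local Notation L := lex_square.

Lemma lex_squareE : lexicographic_square R = lex_square.
Proof. by []. Qed.

Lemma lex_leE (p q : L) :
  (p <= q)%O = (\val p.1 < \val q.1) || (p.1 == q.1) && (\val p.2 <= \val q.2).
Proof.
rewrite [LHS]Order.ProdLexiOrder.leEprodlexi !unit_leE -(inj_eq val_inj).
by case: ltgtP.
Qed.

Lemma lex_ltE (p q : L) :
  (p < q)%O = (\val p.1 < \val q.1) || (p.1 == q.1) && (\val p.2 < \val q.2).
Proof.
rewrite ltNge lex_leE negb_or negb_and -leNgt -ltNge.
rewrite -!(inj_eq val_inj).
by have [h|h|h] := ltgtP (\val p.1) (\val q.1).
Qed.

Lemma lex_pair_ltE (x y u v : I) : (((x, y) : L) < ((u, v) : L))%O =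
  (\val x < \val u) || (x == u) && (\val y < \val v).
Proof. by rewrite lex_ltE. Qed.

Lemma lex_pair_leE (x y u v : I) : (((x, y) : L) <= ((u, v) : L))%O =
  (\val x < \val u) || (x == u) && (\val y <= \val v).
Proof. by rewrite lex_leE. Qed.

Lemma lex_fiber_continuous (x : I) : continuous (fun y : I => (x, y) : L).
Proof.
move=> y; apply: (@order_cvg _ L _ (fmap_filter _ (nbhs_filter y))) => -[a b]; rewrite lex_pair_ltE.
- move=> /orP[ax|/andP[/eqP-> by_]].
    by apply: (@filterS _ (nbhs y) _ setT); [|exact: filterT] => z _;
      change (((a, b) : L) < ((x, z) : L))%O; rewrite lex_pair_ltE ax.
  apply: (@filterS _ _ _ (fun z : I => \val b < \val z)).
    by move=> z bz; change (((x, b) : L) < ((x, z) : L))%O; rewrite lex_pair_ltE eqxx bz orbT.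
  apply/unit_nbhsP; exists (\val y - \val b); first by rewrite subr_gt0.
  by move=> z; rewrite ltr_norml => /andP[_]; lra.
- move=> /orP[xa|/andP[/eqP-> yb]].
    by apply: (@filterS _ (nbhs y) _ setT); [|exact: filterT] => z _;
      change (((x, z) : L) < ((a, b) : L))%O; rewrite lex_pair_ltE xa.
  apply: (@filterS _ _ _ (fun z : I => \val z < \val b)).
    by move=> z bz; change (((a, z) : L) < ((a, b) : L))%O; rewrite lex_pair_ltE eqxx bz orbT.
  apply/unit_nbhsP; exists (\val b - \val y); first by rewrite subr_gt0.
  by move=> z; rewrite ltr_norml => /andP[+ _]; lra.
Qed.

Lemma unit_nbhs_itv (y : I) (U : set I) : 0 < \val y < 1 -> nbhs y U ->
  exists a b : I, \val a < \val y < \val b /\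
    forall z : I, \val a < \val z < \val b -> U z.
Proof.
move=> /andP[y0 y1] /unit_nbhsP[e e0 eU].
exists (clamp (Num.max 0 (\val y - e))), (clamp (Num.min 1 (\val y + e))).
have ae : \val (clamp (Num.max 0 (\val y - e)) : I) = Num.max 0 (\val y - e).
  by rewrite clampE// le_max lexx ge_max ler01 orTb !andTb; lra.
have be : \val (clamp (Num.min 1 (\val y + e)) : I) = Num.min 1 (\val y + e).
  by rewrite clampE// le_min ge_min lexx ler01 orTb !andTb andbT; lra.
rewrite ae be gt_max lt_min y0 y1 !andTb; split; first by apply/andP; split; lra.
move=> z; rewrite gt_max lt_min => /andP[/andP[_ ?] /andP[_ ?]].
by apply: eU; rewrite ltr_norml; apply/andP; split; lra.
Qed.

(** The order interval from (x, a) to (x, b) stays inside column x, so such a point has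
    neighbourhoods within its column. *)
Lemma lex_nbhs_fiber (x y : I) (U : set L) : 0 < \val y < 1 ->
  nbhs ((x, y) : L) U <-> nbhs y [set z | U (x, z)].
Proof.
move=> y01; split; first exact: lex_fiber_continuous.
move=> /(unit_nbhs_itv y01)[a [b [/andP[ay yb] abU]]].
have l : nbhs ((x, y) : L) [set q | ((x, a) : L) < q]%O.
  by apply: nbhs_order_gt; rewrite lex_pair_ltE eqxx ay orbT.
have g : nbhs ((x, y) : L) [set q | q < ((x, b) : L)]%O.
  by apply: nbhs_order_lt; rewrite lex_pair_ltE eqxx yb orbT.
apply: filterS2 l g => -[u v]; rewrite /mkset !lex_pair_ltE.
move=> /orP[xu|/andP[/eqP <- av]] /orP[ux|/andP[/eqP ux vb]].
- by have := lt_trans xu ux; rewrite ltxx.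
- by rewrite ux ltxx in xu.
- by rewrite ltxx in ux.
- by apply: abU; rewrite av.
Qed.

(** The least point of the order has one-sided neighbourhoods, which fit into the left column. *)
Lemma lex_nbhs_min (U : set L) :
  nbhs ((I0, I0) : L) U <-> nbhs I0 [set z | U (I0, z)].
Proof.
split; first exact: lex_fiber_continuous.
move=> /unit_nbhsP[e e0 eU]; pose b : I := clamp (Num.min 1 e).
have be : \val b = Num.min 1 e.
  by rewrite clampE// le_min ge_min lexx ler01 (ltW e0).
have g : nbhs ((I0, I0) : L) [set q | q < ((I0, b) : L)]%O.
  by apply: nbhs_order_lt; rewrite lex_pair_ltE eqxx I0E be lt_min ltr01 e0 orbT.
apply: filterS g => -[u v]; rewrite /mkset lex_pair_ltE I0E be lt_min.
move=> /orP[u0|/andP[/eqP -> /andP[_ ve]]].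
  by have := unit_ge0 u; rewrite leNgt u0.
apply: eU; rewrite I0E sub0r normrN ger0_norm//; exact: unit_ge0.
Qed.

(** The union of the inner columns is the open order interval from (0, 1) to (1, 0). *)
Lemma lex_nbhs_strip (x y : I) : x != I0 -> x != I1 ->
  nbhs ((x, y) : L) [set q : L | (q.1 != I0) && (q.1 != I1)].
Proof.
move=> x0 x1; have /andP[x0' x1'] : 0 < \val x < 1 by rewrite unit_interior x0.
have l : nbhs ((x, y) : L) [set q | ((I0, I1) : L) < q]%O.
  by apply: nbhs_order_gt; rewrite lex_pair_ltE I0E x0'.
have g : nbhs ((x, y) : L) [set q | q < ((I1, I0) : L)]%O.
  by apply: nbhs_order_lt; rewrite lex_pair_ltE I1E x1'.
apply: filterS2 l g => -[u v]; rewrite /mkset !lex_pair_ltE I0E I1E.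
rewrite -unit_interior => /orP[->|/andP[_ v1]]; last by have := unit_le1 v; rewrite leNgt v1.
by move=> /orP[->|/andP[_ v1]] //; have := unit_ge0 v; rewrite leNgt v1.
Qed.

Definition lex_homeo (f g : L -> L) (fK : cancel f g) (gK : cancel g f)
    (fm : {mono f : x y / (x <= y)%O}) (gm : {mono g : x y / (x <= y)%O}) : homeo L :=
  Homeo fK gK (order_mono_continuous fK gK fm) (order_mono_continuous gK fK gm).

Section LexHomeos.
Variables (f : increasing_bijection R) (sf : supported01 f).
Let f' := incr_recip f.
Let sf' : supported01 f' := supported01_recip sf.

Let base (f : increasing_bijection R) (p : L) : L := (unit_map f p.1, p.2).

Let base_mono g (sg : supported01 g) : {mono base g : x y / (x <= y)%O}.
Proof.
move=> [x y] [u v].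
change (((unit_map g x, y) : L) <= ((unit_map g u, v) : L) = (((x, y) : L) <= (u, v)))%O.
rewrite !lex_pair_leE !unit_mapE// incr_lt.
by rewrite (inj_eq (can_inj (unit_mapK sg))).
Qed.

Let baseK g (sg : supported01 g) : cancel (base g) (base (incr_recip g)).
Proof. by move=> [x y]; rewrite /base /= unit_mapK. Qed.

Definition lex_base_homeo : homeo L :=
  lex_homeo (baseK sf) (baseK sf') (base_mono sf) (base_mono sf').

Lemma lex_base_homeoE x y : lex_base_homeo (x, y) = (unit_map f x, y).
Proof. by []. Qed.

Variable t : I.

Let col (f : increasing_bijection R) (p : L) : L :=
  (p.1, if p.1 == t then unit_map f p.2 else p.2).

Let col_mono g (sg : supported01 g) : {mono col g : x y / (x <= y)%O}.
Proof.
move=> [x y] [u v].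
change (((x, if x == t then unit_map g y else y) : L) <=
  ((u, if u == t then unit_map g v else v) : L) = (((x, y) : L) <= (u, v)))%O.
rewrite !lex_pair_leE; have [->|//] := eqVneq x u.
by case: ifP => // _; rewrite !unit_mapE// incr_le.
Qed.

Let colK g (sg : supported01 g) : cancel (col g) (col (incr_recip g)).
Proof. by move=> [x y]; rewrite /col /=; case: (x == t); rewrite ?unit_mapK. Qed.

Definition lex_column_homeo : homeo L :=
  lex_homeo (colK sf) (colK sf') (col_mono sf) (col_mono sf').

Lemma lex_column_homeoE x y :
  lex_column_homeo (x, y) = (x, if x == t then unit_map f y else y).
Proof. by []. Qed.

End LexHomeos.

Let onem (p : L) : L := (onem_unit p.1, onem_unit p.2).

Let onemK : involutive onem.
Proof. by move=> [x y]; rewrite /onem /= !onem_unitK. Qed.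

Let onem_anti : {mono onem : x y /~ (x <= y)%O}.
Proof.
move=> [x y] [u v].
change (((onem_unit x, onem_unit y) : L) <= ((onem_unit u, onem_unit v) : L) =
  (((u, v) : L) <= (x, y)))%O.
rewrite !lex_pair_leE !onem_unitE (inj_eq (can_inj (@onem_unitK R))) eq_sym.
by congr (_ || (_ && _)); apply/idP/idP; lra.
Qed.

Definition lex_onem_homeo : homeo L :=
  Homeo onemK onemK (order_anti_continuous onemK onem_anti)
    (order_anti_continuous onemK onem_anti).

Lemma lex_onem_homeoE x y : lex_onem_homeo (x, y) = (onem_unit x, onem_unit y).
Proof. by []. Qed.

End LexicographicSquare.

Section LexicographicRealization.
Variables (R : realType) (r : nat).
Local Notation I := (unit_interval R).
Local Notation I0 := (I0 R).
Local Notation I1 := (I1 R).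
Local Notation L := (lex_square R).

Definition lex_inner (x y : I) : nat := if (y == I0) || (y == I1) then 0%N else 1%N.

Definition lex_color : L -> nat := framed_color r lex_inner.
Local Notation c := lex_color.

Lemma lex_inner_le x y : (lex_inner x y <= 1)%N.
Proof. by rewrite /lex_inner; case: ifP. Qed.

Lemma lex_color_surj i : (i <= r.+3 + 1)%N -> exists p, c p = i.
Proof.
apply: framed_color_surj.
have h01 : 0 < \val (clamp (1 / 2) : I) < 1 by rewrite clampE; lra.
move: (h01); rewrite unit_interior => h.
case=> [|[|//]] _; exists (clamp (1 / 2)) => //.
  by exists I0; rewrite /lex_inner eqxx.
by exists (clamp (1 / 2)); move: h; rewrite /lex_inner => /andP[/negbTE-> /negbTE->].
Qed.

Lemma lex_color_onem x y : c (onem_unit x, onem_unit y) = c (x, y).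
Proof.
apply: framed_color_onem => a b.
by rewrite /lex_inner !onem_unit_eq onem_unit0 onem_unit1 orbC.
Qed.


Lemma lex_color_lsc_edge y : \forall q \near ((I0, y) : L), (c (I0, y) <= c q)%N.
Proof.
have [y01|] := boolP (0 < \val y < 1).
  apply/(lex_nbhs_fiber _ _ y01); apply: filterS (edge_color_lsc r y) => z.
  by rewrite /mkset /c !framed_color0.
rewrite unit_interior negb_and !negbK => /orP[] /eqP ->.
  by near=> q; rewrite {1}/c framed_color0 /edge_color eqxx.
(* The point (0, 1) has colour 1, and only the corners (0, 0) and (1, 1) have a smaller one, so it
   is enough to avoid these two points. *)
have cl (p : L) : p != (I0, I1) -> nbhs ((I0, I1) : L) [set q | q != p].
  move=> pI; have := @order_hausdorff _ L; rewrite open_hausdorff => /(_ _ _ pI).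
  move=> [[U V] /= [/set_mem pU /set_mem qV] [oU oV /eqP]].
  rewrite setIC => /disjoints_subset VU.
  have : nbhs ((I0, I1) : L) V by exact: open_nbhs_nbhs.
  by apply: filterS => q /VU; apply: contra_notT; rewrite negbK => /eqP ->.
have n0 : nbhs ((I0, I1) : L) [set q | q != (I0, I0)].
  by apply: cl; rewrite xpair_eqE eqxx /= I0_neq_I1.
have n1 : nbhs ((I0, I1) : L) [set q | q != (I1, I1)].
  by apply: cl; rewrite xpair_eqE eqxx /= eq_sym negb_and I0_neq_I1.
apply: filterS2 n0 n1 => -[u v]; rewrite /mkset => q0 q1.
rewrite {1}/c framed_color0 {1}/edge_color eqxx eq_sym (negbTE (I0_neq_I1 R)).
have [u0|u0] := eqVneq u I0.
  rewrite u0 /c framed_color0 /edge_color ifF; first by case: ifP.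
  by apply/negbTE; apply: contra_neq q0 => ->; rewrite u0.
have [u1|u1] := eqVneq u I1; last by rewrite /c framed_color_in.
rewrite u1 /c framed_color1 /edge_color ifF; first by case: ifP.
rewrite onem_unit_eq onem_unit0.
by apply/negbTE; apply: contra_neq q1 => ->; rewrite u1.
Unshelve. all: by end_near. Qed.

Lemma lex_color_lsc p : \forall q \near p, (c p <= c q)%N.
Proof.
case: p => x y; have [->|x0] := eqVneq x I0; first exact: lex_color_lsc_edge.
have [->|x1] := eqVneq x I1.
  have := lex_color_lsc_edge (onem_unit y).
  have E : (I0, onem_unit y) = lex_onem_homeo R (I1, y).
    by rewrite lex_onem_homeoE onem_unit1.
  rewrite E => H.
  have := @homeo_fun_continuous _ (lex_onem_homeo R) (I1, y) _ H => H'.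
  have : nbhs ((I1, y) : L) [set q | (c (lex_onem_homeo R (I1, y)) <= c (lex_onem_homeo R q))%N].
    exact: H'.
  apply: filterS => -[u v]; rewrite /mkset.
  by rewrite !lex_onem_homeoE !lex_color_onem.
have [y01|] := boolP (0 < \val y < 1).
  apply/(lex_nbhs_fiber _ _ y01).
  move: (y01); rewrite unit_interior => /andP[y0 y1].
  have n0 : nbhs y [set z | z != I0] := unit_near_neq y0.
  have n1 : nbhs y [set z | z != I1] := unit_near_neq y1.
  apply: filterS2 n0 n1 => z; rewrite /mkset => /negbTE z0 /negbTE z1.
  by rewrite /c !framed_color_in// leq_add2l /lex_inner z0 z1; case: ifP.
rewrite unit_interior negb_and !negbK => ye.
have := lex_nbhs_strip y x0 x1; apply: filterS => -[u v] /andP[u0 u1].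
by rewrite /c !framed_color_in// leq_add2l {1}/lex_inner ye.
Qed.

Local Notation "p ~~> q" := (same_orbit c p q) (at level 70).

Lemma lex_orbit_onem x y : (x, y) ~~> (onem_unit x, onem_unit y).
Proof.
exists (lex_onem_homeo R) => //; apply/color_stabilizerP => -[u v].
by rewrite lex_onem_homeoE lex_color_onem.
Qed.

Lemma lex_orbit_column (f : increasing_bijection R) (sf : supported01 f) t y :
  (forall z, c (t, unit_map f z) = c (t, z)) -> (t, y) ~~> (t, unit_map f y).
Proof.
move=> fc; exists (lex_column_homeo sf t); last by rewrite lex_column_homeoE eqxx.
apply/color_stabilizerP => -[u v]; rewrite lex_column_homeoE.
by have [->|//] := eqVneq u t.
Qed.

Lemma lex_orbit_edge y z : edge_color r y = edge_color r z -> (I0, y) ~~> (I0, z).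
Proof.
move=> /edge_color_transitive[f sf [<- fc]]; apply: lex_orbit_column => // v.
by rewrite /c !framed_color0 fc.
Qed.

Lemma lex_orbit_base x t y : x != I0 -> x != I1 -> t != I0 -> t != I1 ->
  (x, y) ~~> (t, y).
Proof.
move=> x0 x1 t0 t1.
have x01 : 0 < \val x < 1 by rewrite unit_interior x0.
have t01 : 0 < \val t < 1 by rewrite unit_interior t0.
have [f sf fxt] := unit_transitive x01 t01.
have ft : unit_map f x = t by apply: val_inj; rewrite unit_mapE.
exists (lex_base_homeo sf); last by rewrite lex_base_homeoE ft.
have fi := can_inj (unit_mapK sf).
apply/color_stabilizerP => -[u v]; rewrite lex_base_homeoE.
have [->|u0] := eqVneq u I0; first by rewrite unit_map0.
have [->|u1] := eqVneq u I1; first by rewrite unit_map1.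
rewrite /c !framed_color_in//.
  by rewrite -(unit_map0 sf) (inj_eq fi).
by rewrite -(unit_map1 sf) (inj_eq fi).
Qed.

Lemma lex_orbit p q : c p = c q -> p ~~> q.
Proof.
have side (x y : I) : x == I0 \/ x == I1 -> exists z, (x, y) ~~> (I0, z).
  move=> [/eqP->|/eqP->]; first by exists y; exact: same_orbit_refl.
  by exists (onem_unit y); rewrite -onem_unit1; exact: lex_orbit_onem.
have cE p' q' : p' ~~> q' -> c p' = c q' by move=> [g /color_stabilizerP gc <-]; rewrite gc.
have elt y (n : nat) : edge_color r y <> (r.+3 + n)%N.
  by move=> e; have := edge_color_le r y; rewrite e addSn ltnNge leq_addr.
case: p q => [x y] [x' y'] cpq.
have [/orP/(side x y)[z xz]|] := boolP ((x == I0) || (x == I1)).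
  have [/orP/(side x' y')[z' xz']|] := boolP ((x' == I0) || (x' == I1)).
    apply: (same_orbit_trans xz (same_orbit_trans _ (same_orbit_sym xz'))).
    apply: lex_orbit_edge.
    by move: cpq; rewrite (cE _ _ xz) (cE _ _ xz') /c !framed_color0.
  rewrite negb_or => /andP[x'0 x'1]; move: cpq.
  by rewrite (cE _ _ xz) /c framed_color0 framed_color_in// => /elt.
rewrite negb_or => /andP[x0 x1].
have [/orP/(side x' y')[z' xz']|] := boolP ((x' == I0) || (x' == I1)).
  by move: cpq; rewrite (cE _ _ xz') /c framed_color0 framed_color_in// => /esym/elt.
rewrite negb_or => /andP[x'0 x'1].
have xy := lex_orbit_base y x0 x1 x'0 x'1.
apply: (same_orbit_trans xy); move: cpq; rewrite (cE _ _ xy).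
rewrite /c !framed_color_in// => /addnI.
rewrite /lex_inner; have [ye|ye] := boolP (_ || _); have [ze|ze] := boolP (_ || _) => // _.
  have [->|yz] := eqVneq y y'; first exact: same_orbit_refl.
  (* Top and bottom ends of inner columns are exchanged by the half turn, after which a base map
     restores the column. *)
  have -> : y' = onem_unit y.
    case/orP: ye yz => /eqP ->; case/orP: ze => /eqP ->; rewrite ?eqxx//.
      by rewrite onem_unit0.
    by rewrite onem_unit1.
  apply: same_orbit_trans (lex_orbit_onem _ _) _.
  by apply: lex_orbit_base => //; rewrite onem_unit_eq ?onem_unit0 ?onem_unit1.
have y01 : 0 < \val y < 1 by rewrite unit_interior -negb_or.
have z01 : 0 < \val y' < 1 by rewrite unit_interior -negb_or.
have [f sf fyz] := unit_transitive y01 z01.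
have -> : y' = unit_map f y by apply: val_inj; rewrite unit_mapE.
apply: lex_orbit_column => // v; rewrite /c !framed_color_in// /lex_inner.
have fi := can_inj (unit_mapK sf).
by rewrite -{1}(unit_map0 sf) -{1}(unit_map1 sf) !(inj_eq fi).
Qed.

Lemma lex_height : height R (color_stabilizer c) = (r.+3 + 1)%N%:R%:E.
Proof.
apply: color_height_orbit.
- by move=> p; apply: framed_color_le => x y; exact: lex_inner_le.
- exact: lex_color_surj.
- exact: lex_color_lsc.
- exact: lex_orbit.
Qed.

End LexicographicRealization.

(** * Curves, and topological invariance of the colours *)

Lemma connected_open_sub (T : topologicalType) (C U V : set T) :
  connected C -> open U -> open V -> C `<=` U `|` V ->
  C `&` U `&` V `<=` set0 -> C `&` U !=set0 -> C `<=` U.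
Proof.
move=> cC oU oV CUV dis CU.
have <- : C `&` U = C; last exact: subIsetr.
apply: cC => //; first by exists U.
exists (~` V); first exact: open_closedC.
apply/seteqP; split => p [Cp].
  by move=> Up; split => // Vp; exact: (dis p).
by have [] := CUV p Cp.
Qed.

Lemma continuous_image_connected (T U : topologicalType) (A : set T) (f : T -> U) :
  connected A -> continuous f -> connected (f @` A).
Proof.
move=> cA cf; apply: connected_continuous_connected => //.
exact: continuous_subspaceT.
Qed.

Section ArcPoints.
Variables (R : realType) (X : topologicalType).

(* In both non-metrizable squares these are the points having a neighbourhood
   inside a single vertical segment. *)
Definition arc_points : set X :=
  [set p | exists2 gamma : R -> X, continuous gamma & nbhs p (range gamma)].

Definition arc_component (p : X) := connected_component arc_points p.

(** The components turn out to be intervals, and deleting a point leaves an interval connected only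
    if the point is one of its ends. *)
Definition arc_ends : set X :=
  [set p | arc_points p /\ connected (arc_component p `\ p)].

Lemma image_nbhs (h : homeo X) p (U : set X) : nbhs p U -> nbhs (h p) (h @` U).
Proof.
move=> nU; have : nbhs (homeo_inv h (h p)) U by rewrite homeo_funK.
move=> /(@homeo_inv_continuous _ h (h p)) H.
have : nbhs (h p) [set q | U (homeo_inv h q)] by [].
by apply: filterS => q Uq; exists (homeo_inv h q) => //; exact: homeo_invK.
Qed.

Lemma arc_points_homeo (h : homeo X) p : arc_points (h p) <-> arc_points p.
Proof.
have imp (g : homeo X) q : arc_points q -> arc_points (g q).
  move=> [gamma cg ng]; exists (g \o gamma).
    by move=> t; apply: continuous_comp; [exact: cg|exact: homeo_fun_continuous].
  by have := image_nbhs g ng; apply: filterS => _ [_ [t _ <-] <-]; exists t.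
split; last exact: imp.
by move=> /(imp (homeo_recip h)) /=; rewrite homeo_funK.
Qed.

Lemma connected_homeo (h : homeo X) (C : set X) : connected C -> connected (h @` C).
Proof. by move=> cC; apply: continuous_image_connected => //; exact: homeo_fun_continuous. Qed.

Lemma arc_component_homeo (h : homeo X) p :
  arc_component (h p) = h @` arc_component p.
Proof.
have imp (g : homeo X) q : g @` arc_component q `<=` arc_component (g q).
  move=> _ [y [C [Cq CY cC] Cy] <-]; exists (g @` C); last by exists y.
  split; first by exists q.
  - by move=> _ [z /CY Yz <-]; apply/arc_points_homeo.
  - exact: connected_homeo.
apply/seteqP; split; last exact: imp.
move=> q Hq; exists (homeo_inv h q); last exact: homeo_invK.
have := imp (homeo_recip h) (h p) (homeo_inv h q); rewrite /= homeo_funK.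
by apply; exists q.
Qed.

Lemma arc_ends_homeo (h : homeo X) p : arc_ends (h p) <-> arc_ends p.
Proof.
have imp (g : homeo X) q : arc_ends q -> arc_ends (g q).
  move=> [Yq cq]; split; first exact/arc_points_homeo.
  rewrite arc_component_homeo.
  rewrite (_ : _ `\ _ = g @` (arc_component q `\ q)); first exact: connected_homeo.
  apply/seteqP; split => [_ [[y Ky <-] gy]|_ [y [Ky yq] <-]].
    by exists y => //; split => // yq; apply: gy; rewrite /= yq.
  split; first by exists y.
  by move=> /= /(can_inj (homeo_funK g)).
split; last exact: imp.
by move=> /(imp (homeo_recip h)) /=; rewrite homeo_funK.
Qed.

Lemma closure_homeo (S : set X) : (forall (h : homeo X) p, S p -> S (h p)) ->
  forall (h : homeo X) p, closure S (h p) <-> closure S p.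
Proof.
move=> Sh; have imp (g : homeo X) q : closure S q -> closure S (g q).
  move=> cS U nU.
  have : nbhs q [set z | U (g z)] by exact: homeo_fun_continuous nU.
  by move=> /cS[z [Sz Uz]]; exists (g z); split => //; exact: Sh.
move=> h p; split; last exact: imp.
by move=> /(imp (homeo_recip h)) /=; rewrite homeo_funK.
Qed.

(* The image of a curve is separable. *)
Lemma curve_countable_family (gamma : R -> X) (S : set R) (W : R -> set X) :
  continuous gamma -> (forall t, S t -> open (W t)) ->
  (forall t, S t -> W t `&` range gamma !=set0) ->
  (forall t u, S t -> S u -> W t `&` W u !=set0 -> t = u) -> countable S.
Proof.
move=> cg oW Wg inj.
(* Each [W t] is met over a nonempty open set of parameters, hence at a rational one; disjointness
   makes the choice injective. *)
have qP t : exists q : rat, S t -> W t (gamma (ratr q)).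
  have [St|nSt] := pselect (S t); last by exists 0.
  have [x [Wx [s _ sx]]] := Wg t St.
  have [||y [Wy [q _ qy]]] := @dense_rat R (gamma @^-1` W t).
  - by exists s; rewrite /preimage /= sx.
  - by apply: open_comp; [move=> ? _; exact: cg|exact: oW].
  by exists q => _; rewrite qy.
have [f fP] := choice qP.
apply/countable_injP; exists (pickle \o f) => t u /set_mem St /set_mem Su /= fE.
apply: inj => //; exists (gamma (ratr (f t))); split; first exact: fP.
by rewrite (pcan_inj pickleK fE); exact: fP.
Qed.

(** A countable set is null, while this interval has measure b - a. *)
Lemma itv_uncountable (a b : R) : a < b -> ~ countable `]a, b[%classic.
Proof.
move=> ab /countable_lebesgue_measure0; rewrite lebesgue_measure_itv /= lte_fin ab.
by move=> /eqP; rewrite -EFinD eqe subr_eq0 gt_eqF.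
Qed.

End ArcPoints.

Lemma unit_lt1 (R : realType) (u : unit_interval R) : (\val u < 1) = (u != I1 R).
Proof. by rewrite lt_neqAle unit_le1 andbT -(inj_eq val_inj) I1E. Qed.

Lemma unit_gt0 (R : realType) (u : unit_interval R) : (0 < \val u) = (u != I0 R).
Proof. by rewrite lt_neqAle unit_ge0 andbT eq_sym -(inj_eq val_inj) I0E. Qed.

(** * Topological description of the colours of the lexicographic square *)

Section LexicographicInvariance.
Variable R : realType.
Local Notation I := (unit_interval R).
Local Notation I0 := (I0 R).
Local Notation I1 := (I1 R).
Local Notation L := (lex_square R).
Local Notation c := (lex_color 0).
Local Notation Y := (@arc_points R L).
Local Notation K := (@arc_component R L).
Local Notation E := (@arc_ends R L).

Lemma interval_connected (i : interval R) : connected [set` i].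
Proof. by apply/connected_intervalP; exact: interval_is_interval. Qed.

Lemma itvooP (a b t : R) : `]a, b[%classic t <-> a < t < b.
Proof. by rewrite /= in_itv. Qed.

Lemma itvcoP (a b t : R) : `[a, b[%classic t <-> a <= t < b.
Proof. by rewrite /= in_itv. Qed.

(** No point lies between (x, 1) and the columns to its right, so (t, y) converges to (x, 1) as t
    decreases to x, whatever the height y. *)
Lemma open_fiber_near_top (x y : I) (U : set L) : x != I1 -> 0 < \val y < 1 ->
  nbhs ((x, I1) : L) U ->
  exists2 e : R, \val x < e <= 1 &
    forall t : R, \val x < t < e -> U (clamp t, y).
Proof.
move=> x1 y01 nU.
have x1' : \val x < 1 by rewrite unit_lt1.
have : (fun t : R => (clamp t, y) : L) @ (\val x)^'+ --> ((x, I1) : L).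
  apply: (@order_cvg _ L _ (fmap_filter _ (at_right_proper_filter (\val x)))).
    move=> -[a b]; rewrite lex_pair_ltE => ab.
    suff : \forall t \near (\val x)^'+, (((a, b) : L) < (clamp t, y))%O by [].
    near=> t; rewrite lex_pair_ltE.
    have xt : \val x < t by near: t; exact: nbhs_right_gt.
    have t1 : t < 1 by near: t; exact: nbhs_right_lt.
    have x0 := unit_ge0 x.
    rewrite clampE; last by apply/andP; split; lra.
    by case/orP: ab => [?|/andP[/eqP-> _]]; apply/orP; left; lra.
  move=> -[a b]; rewrite lex_pair_ltE => /orP[xa|/andP[_ b1]]; last first.
    by move: b1; rewrite I1E ltNge unit_le1.
  suff : \forall t \near (\val x)^'+, (((clamp t, y) : L) < (a, b))%O by [].
  near=> t; rewrite lex_pair_ltE.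
  have xt : \val x < t by near: t; exact: nbhs_right_gt.
  have ta : t < \val a by near: t; exact: nbhs_right_lt.
  have x0 := unit_ge0 x; have a1 := unit_le1 a.
  by rewrite clampE ?ta//; apply/andP; split; lra.
move=> /(_ U nU); rewrite /fmap /at_right /within => /nbhs_ballP[e' e'0 e'U].
have [e [e0 eU]] : exists e : R, 0 < e /\
    forall t : R, `|\val x - t| < e -> \val x < t -> U (clamp t, y).
  by exists e'.
exists (Num.min 1 (\val x + e)).
  by rewrite lt_min ge_min lexx x1' orTb andTb andbT ltrDl.
move=> t /andP[xt]; rewrite lt_min => /andP[t1 te]; apply: eU => //.
by rewrite ltr_norml; apply/andP; split; lra.
Unshelve. all: by end_near. Qed.

Lemma open_fiber_set (x : I) : open [set q : L | q.1 = x /\ 0 < \val q.2 < 1].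
Proof.
rewrite openE => -[u v] /= [-> v01]; apply/(lex_nbhs_fiber _ _ v01).
have v01' := v01; move: v01'; rewrite unit_interior => /andP[v0 v1].
have n0 : nbhs v [set z | z != I0] := unit_near_neq v0.
have n1 : nbhs v [set z | z != I1] := unit_near_neq v1.
apply: filterS2 n0 n1 => z z0 z1; split => //.
by rewrite unit_interior z0.
Qed.

Lemma lex_path_continuous (x : I) : continuous (fun t : R => (x, clamp t) : L).
Proof.
move=> t; apply: (@continuous_comp _ _ _ (@clamp R) (fun y : I => (x, y) : L)).
  exact: clamp_continuous.
exact: lex_fiber_continuous.
Qed.

Lemma arc_points_interior (x y : I) : 0 < \val y < 1 -> Y (x, y).
Proof.
move=> y01; exists (fun t : R => (x, clamp t) : L); first exact: lex_path_continuous.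
apply/(lex_nbhs_fiber _ _ y01); apply: filterE => z.
by exists (\val z) => //; rewrite clampK.
Qed.

Lemma arc_points_min : Y (I0, I0).
Proof.
exists (fun t : R => (I0, clamp t) : L); first exact: lex_path_continuous.
apply/lex_nbhs_min; apply: filterE => z.
by exists (\val z) => //; rewrite clampK.
Qed.

(** A curve filling a neighbourhood of (x, 1) would meet the interiors of uncountably many columns,
    which are disjoint open sets. *)
Lemma not_arc_points_top (x : I) : x != I1 -> ~ Y (x, I1).
Proof.
move=> x1 [gamma cg ng].
have h01 : 0 < \val (clamp (1 / 2) : I) < 1 by rewrite clampE; lra.
have [e /andP[xe e1] eU] := open_fiber_near_top x1 h01 ng.
apply: (@itv_uncountable R (\val x) e) => //.
have /= x0 := unit_ge0 x.
apply: (@curve_countable_family R L gamma _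
  (fun t => [set q : L | q.1 = clamp t /\ 0 < \val q.2 < 1])) => //.
- by move=> t _; exact: open_fiber_set.
- move=> t /=; rewrite in_itv /= => xt; exists (clamp t, clamp (1 / 2)).
  by split; [split|exact: eU].
- move=> t u /=; rewrite !in_itv /= => /andP[t1 t2] /andP[u1 u2].
  move=> [q [[qt _] [qu _]]].
  have : clamp t = clamp u :> I by rewrite -qt -qu.
  move=> /(congr1 \val).
  by rewrite !clampE//; apply/andP; split; lra.
Qed.

Lemma lex_onem_arc (x y : I) : Y (onem_unit x, onem_unit y) <-> Y (x, y).
Proof. exact: (@arc_points_homeo R L (lex_onem_homeo R) (x, y)). Qed.


Lemma not_arc_points_bottom (x : I) : x != I0 -> ~ Y (x, I0).
Proof.
move=> x0; rewrite -(onem_unitK x) -onem_unit1 => /lex_onem_arc.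
by apply: not_arc_points_top; rewrite onem_unit_eq onem_unit1.
Qed.

Lemma fiber_component (x y z : I) : 0 < \val y < 1 -> 0 < \val z < 1 ->
  K (x, y) (x, z).
Proof.
move=> y01 z01; exists ((fun t : R => (x, clamp t) : L) @` `]0, 1[%classic).
  split.
  - by exists (\val y); rewrite ?clampK//= in_itv.
  - move=> _ [t /= + <-]; rewrite in_itv /= => t01; apply: arc_points_interior.
    by rewrite clampE//; case/andP: t01 => /ltW-> /ltW->.
  - by apply: continuous_image_connected (@interval_connected _) (@lex_path_continuous x).
by exists (\val z); rewrite ?clampK//= in_itv.
Qed.

Lemma min_component (z : I) : z != I1 -> K (I0, I0) (I0, z).
Proof.
move=> z1; have z1' : \val z < 1 by rewrite unit_lt1.
exists ((fun t : R => (I0, clamp t) : L) @` `[0, 1[%classic).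
  split.
  - by exists 0 => //; rewrite /= in_itv /= lexx ltr01.
  - move=> _ [t /= + <-]; rewrite in_itv /= => /andP[]; rewrite le_eqVlt => /orP[/eqP <- _|t0 t1].
      exact: arc_points_min.
    by apply: arc_points_interior; rewrite clampE ?t0 ?t1//; apply/andP; split; lra.
  - by apply: continuous_image_connected (@interval_connected _) (@lex_path_continuous I0).
by exists (\val z); rewrite ?clampK//= in_itv /= unit_ge0.
Qed.

(** The component consists of arc points, so it avoids b, and the two open rays at b cannot split
    it. *)
Lemma component_below (p q b : L) : K p q -> ~ Y b -> (p < b)%O -> (q < b)%O.
Proof.
move=> [C [Cp CY cC] Cq] Yb pb.
have := @connected_open_sub L C `]-oo, b[%classic `]b, +oo[%classic cC.
move=> /(_ (lray_open b) (rray_open b)).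
suff H : C `<=` `]-oo, b[ -> (q < b)%O.
  move=> H'; apply: H; apply: H'.
  - move=> z Cz /=; rewrite !in_itv /= andbT.
    by have [|/ltW|zb] := ltgtP z b; [left|right|case: Yb; rewrite -zb; exact: CY].
  - move=> z [[_]] /=; rewrite !in_itv /= andbT => zb bz.
    by have := lt_trans zb bz; rewrite ltxx.
  - by exists p; split => //=; rewrite in_itv.
by move=> /(_ q Cq) /=; rewrite in_itv.
Qed.

Lemma min_component_sub q : K (I0, I0) q -> q.1 = I0 /\ q.2 != I1.
Proof.
move=> Kq; have ltb : (((I0, I0) : L) < (I0, I1))%O.
  by rewrite lex_pair_ltE eqxx I0E I1E ltr01 orbT.
have := component_below Kq (not_arc_points_top (I0_neq_I1 R)) ltb.
case: q {Kq} => u v; rewrite lex_pair_ltE I0E => /orP[u0|/andP[/eqP ->]].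
  by have := unit_ge0 u; rewrite leNgt u0.
by rewrite I1E unit_lt1.
Qed.

Lemma max_component_sub q : K (I1, I1) q -> q.1 = I1.
Proof.
move=> Kq; have : K (lex_onem_homeo R (I1, I1)) (lex_onem_homeo R q).
  by rewrite arc_component_homeo; exists q.
rewrite lex_onem_homeoE onem_unit1 => /min_component_sub[q1 _].
by apply: (can_inj (@onem_unitK R)); rewrite onem_unit1 -q1.
Qed.

Lemma arc_end_min : E (I0, I0).
Proof.
split; first exact: arc_points_min.
have -> : K (I0, I0) `\ (I0, I0) = (fun t : R => (I0, clamp t) : L) @` `]0, 1[%classic.
  apply/seteqP; split => [[u v] [/min_component_sub[/= -> v1] v0]|_ [t + <-]].
    exists (\val v); last by rewrite clampK.
    apply/itvooP; rewrite unit_interior v1 andbT.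
    by apply/eqP => v0'; apply: v0; rewrite /= v0'.
  move=> /itvooP/andP[t0 t1].
  have vt : \val (clamp t : I) = t by rewrite clampE// !ltW.
  split; first by apply: min_component; rewrite -unit_lt1 vt.
  by move=> /(congr1 (fun p : L => \val p.2)); rewrite vt I0E => t0'; rewrite t0' ltxx in t0.
exact: continuous_image_connected (@interval_connected _) (@lex_path_continuous I0).
Qed.

(** Once the point is deleted, the two open rays at it separate its component; the midpoints between
    y and the ends of the column witness both sides. *)
Lemma not_arc_end_interior (x y : I) : 0 < \val y < 1 -> ~ E (x, y).
Proof.
move=> y01 [_ cK]; have /andP[y0 y1] := y01.
have K_of (t : R) : 0 < t < 1 -> K (x, y) (x, clamp t).
  move=> t01; apply: fiber_component => //.
  by rewrite clampE//; case/andP: t01 => /ltW-> /ltW->.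
pose a : I := clamp (\val y / 2); pose b : I := clamp ((\val y + 1) / 2).
have av : \val a = \val y / 2 by rewrite clampE//; apply/andP; split; lra.
have bv : \val b = (\val y + 1) / 2 by rewrite clampE//; apply/andP; split; lra.
have Ka : K (x, y) (x, a) by apply: K_of; apply/andP; split; lra.
have Kb : K (x, y) (x, b) by apply: K_of; apply/andP; split; lra.
have := @connected_open_sub L _ _ _ cK (lray_open ((x, y) : L)) (rray_open ((x, y) : L)).
suff H : ~ (K (x, y) `\ (x, y) `<=` `]-oo, ((x, y) : L)[).
  move=> H'; apply: H; apply: H'.
  - move=> z [_ zp] /=; rewrite !in_itv /= andbT.
    by have [h|h|h] := ltgtP z ((x, y) : L); [left|right|case: zp].
  - move=> z [[_]] /=; rewrite !in_itv /= andbT => zb bz.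
    by have := lt_trans zb bz; rewrite ltxx.
  - exists (x, a); split.
      split => // -[] /(congr1 \val); rewrite av => h; lra.
    rewrite /mkset in_itv /= lex_pair_ltE eqxx av; apply/orP; right; rewrite andTb; lra.
have xb : (x, b) <> (x, y) by move=> [] /(congr1 \val); rewrite bv => h; lra.
move=> /(_ (x, b) (conj Kb xb)); rewrite /mkset in_itv /= lex_pair_ltE ltxx eqxx bv.
by move=> h; lra.
Qed.

Lemma arc_end_cases (q : L) : E q -> q = (I0, I0) \/ q = (I1, I1).
Proof.
case: q => u v Eq; have [v01|] := boolP (0 < \val v < 1).
  by case: (not_arc_end_interior v01 Eq).
have [Yq _] := Eq; rewrite unit_interior negb_and !negbK => /orP[] /eqP v0.
  left; rewrite v0; congr pair; apply/eqP; apply: contrapT => /negP u0.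
  by apply: (not_arc_points_bottom u0); rewrite -v0.
right; rewrite v0; congr pair; apply/eqP; apply: contrapT => /negP u0.
by apply: (not_arc_points_top u0); rewrite -v0.
Qed.

(** The left column without its top and the right one without its bottom. The closure adds (0, 1)
    and (1, 0) but no end of an inner column, which tells colour 1 from colour 3. *)
Let M : set L := [set q | exists2 p, E p & K p q].

Let M_homeo (h : homeo L) p : closure M (h p) <-> closure M p.
Proof.
apply: closure_homeo => {}h {}p [q Eq Kq]; exists (h q); first exact/arc_ends_homeo.
by rewrite arc_component_homeo; exists p.
Qed.

Let K_homeo (h : homeo L) p : K (h p) `&` E !=set0 <-> K p `&` E !=set0.
Proof.
rewrite arc_component_homeo; split => [[_ [[q Kq <-] Eq]]|[q [Kq Eq]]].
  by exists q; split => //; apply/(arc_ends_homeo _ h).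
by exists (h q); split; [exists q|apply/arc_ends_homeo].
Qed.

(* The values of [lex_color 0] are told apart by predicates that every
   homeomorphism preserves. *)
Let lex_profile (p : L) (n : nat) :=
  [/\ Y p <-> ~~ odd n, E p <-> n = 0%N, odd n -> (closure M p <-> n = 1%N)
    & ~~ odd n -> (K p `&` E !=set0 <-> (n < 4)%N)].

Let lex_profile_homeo (h : homeo L) p n : lex_profile (h p) n <-> lex_profile p n.
Proof.
rewrite /lex_profile; split => -[h1 h2 h3 h4]; split.
- by rewrite -h1; split => /arc_points_homeo.
- by rewrite -h2; split => /arc_ends_homeo.
- by move=> /h3 <-; split => /M_homeo.
- by move=> /h4 <-; split => /K_homeo.
- by rewrite -h1; split => /arc_points_homeo.
- by rewrite -h2; split => /arc_ends_homeo.
- by move=> /h3 <-; split => /M_homeo.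
- by move=> /h4 <-; split => /K_homeo.
Qed.

Let M_top : closure M (I0, I1).
Proof.
move=> U /(lex_fiber_continuous (x := I0)) nU.
have [e e0 eU] : exists2 e : R, 0 < e & forall v : I, `|\val I1 - \val v| < e -> U (I0, v).
  by have /unit_nbhsP := nU.
pose t := Num.max 0 (1 - e / 2); have t0 : 0 <= t by rewrite le_max lexx.
have t1 : t < 1 by rewrite gt_max ltr01 andTb; lra.
have tv : \val (clamp t : I) = t by rewrite clampE// t0 ltW.
exists (I0, clamp t); split.
  exists (I0, I0); first exact: arc_end_min.
  by apply: min_component; rewrite -unit_lt1 tv.
apply: eU; rewrite tv I1E ger0_norm; last by lra.
have : 1 - e / 2 <= t by rewrite le_max lexx orbT.
lra.
Qed.

Let lex_profileP (p : L) : lex_profile p (c p).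
Proof.
have edge (y : I) : lex_profile (I0, y) (c (I0, y)).
  rewrite /c framed_color0 /edge_color; case: eqP => [->|/eqP y0].
    split => //=.
    - by split => // _; exact: arc_points_min.
    - by split => // _; exact: arc_end_min.
    - move=> _; split => // _; exists (I0, I0); split; last exact: arc_end_min.
      by apply: min_component; exact: I0_neq_I1.
  case: eqP => [->|/eqP y1].
    have nY := not_arc_points_top (I0_neq_I1 R).
    by split => //=; split => // -[].
  have y01 : 0 < \val y < 1 by rewrite unit_interior y0.
  split => //=.
  - by split => // _; exact: arc_points_interior.
  - by split => // /(not_arc_end_interior y01).
  - move=> _; split => // _; exists (I0, I0); split; last exact: arc_end_min.
    apply: connected_component_sym; exact: min_component.
case: p => x y; have [->|x0] := eqVneq x I0; first exact: edge.
have [->|x1] := eqVneq x I1.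
  apply/(lex_profile_homeo (lex_onem_homeo R)); rewrite lex_onem_homeoE onem_unit1.
  by rewrite /c framed_color1 -(framed_color0 0 (@lex_inner R)); exact: edge.
have [y01|] := boolP (0 < \val y < 1).
  rewrite /c framed_color_in// /lex_inner.
  move: (y01); rewrite unit_interior => /andP[/negbTE-> /negbTE->].
  split => //=.
  - by split => // _; exact: arc_points_interior.
  - by split => // /(not_arc_end_interior y01).
  - move=> _; split => // -[q [Kq]] /arc_end_cases[] qE; move: Kq; rewrite qE => /connected_component_sym.
      by move=> /min_component_sub[/= xE]; rewrite xE eqxx in x0.
    by move=> /max_component_sub/= xE; rewrite xE eqxx in x1.
rewrite unit_interior negb_and !negbK.
(* The half turn preserves profiles and colours and reduces bottom ends to top ends. *)
wlog : x y x0 x1 / y = I1.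
  move=> H /orP[] /eqP yE; last by apply: H => //; rewrite yE eqxx orbT.
  apply/(lex_profile_homeo (lex_onem_homeo R)); rewrite -lex_color_onem lex_onem_homeoE.
  have /andP[ox0 ox1] : (onem_unit x != I0) && (onem_unit x != I1).
    by rewrite -onem_interior x0.
  by apply: H; rewrite // yE onem_unit0 ?eqxx ?orbT.
move=> -> _; rewrite /c framed_color_in// /lex_inner eqxx orbT.
have nY := not_arc_points_top x1.
split => //=; first by split => // -[].
move=> _; split => // /(_ _ (lex_nbhs_strip I1 x0 x1))[[u v] [[p Ep Kp] /= /andP[u0 u1]]].
have [pE|pE] := arc_end_cases Ep; move: Kp; rewrite pE.
  by move=> /min_component_sub[/= uE]; rewrite uE eqxx in u0.
by move=> /max_component_sub/= uE; rewrite uE eqxx in u1.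
Qed.

(** A profile determines its colour among 0 to 4: parity, being 0, being 1 among the odd ones, and
    being below 4 among the even ones leave no ambiguity. *)
Lemma lex_color_homeo (h : homeo L) p : c (h p) = c p.
Proof.
have := lex_profileP (h p); move=> /(lex_profile_homeo h); have := lex_profileP p.
have := framed_color_le 0 (@lex_inner_le R) p.
have := framed_color_le 0 (@lex_inner_le R) (h p).
rewrite -/(c p) -/(c (h p)); move: (c p) (c (h p)) => m n.
move=> n4 m4 [h1 h2 h3 h4] [k1 k2 k3 k4].
have e1 : odd m = odd n.
  by apply: (can_inj negbK); apply/idP/idP => [/h1/k1|/k1/h1].
have e2 : (m == 0%N) = (n == 0%N).
  by apply/eqP/eqP => [/h2/k2|/k2/h2].
have e3 : odd m -> (m == 1%N) = (n == 1%N).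
  move=> om; have on : odd n by rewrite -e1.
  by apply/eqP/eqP => [/(h3 om)/(k3 on)|/(k3 on)/(h3 om)].
have e4 : ~~ odd m -> (m < 4)%N = (n < 4)%N.
  move=> om; have on : ~~ odd n by rewrite -e1.
  by apply/idP/idP => [/(h4 om)/(k4 on)|/(k4 on)/(h4 om)].
have [om|om] := boolP (odd m); [move: (e3 om)|move: (e4 om)];
  move: n4 m4 e1 e2 om {h1 h2 h3 h4 k1 k2 k3 k4 e3 e4};
  by case: n => [|[|[|[|[|n]]]]] //; case: m => [|[|[|[|[|m]]]]].
Qed.

End LexicographicInvariance.

(** * Topological description of the colours of the Alexandroff square *)

Section AlexandroffInvariance.
Variable R : realType.
Local Notation I := (unit_interval R).
Local Notation I0 := (I0 R).
Local Notation I1 := (I1 R).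
Local Notation A := (alexandroff_square R).
Local Notation c := (@alexandroff_color R 0).
Local Notation Y := (@arc_points R A).
Local Notation K := (@arc_component R A).
Local Notation E := (@arc_ends R A).
Local Notation flip := (square_homeo (onem_homeo R)).

Lemma alexandroff_fiber_continuous (x : I) : continuous (fun y : I => (x, y) : A).
Proof.
move=> y U; have [->|yx] := eqVneq y x.
  move=> /alexandroff_nbhs_diag[F _ [nFx nU]].
  have : nbhs x [set v | forall z, ~ F z -> U (z, v)] by [].
  by apply: filterS => v; apply.
by move=> /(alexandroff_nbhs_off _ yx).
Qed.

Lemma alexandroff_path_continuous (x : I) : continuous (fun t : R => (x, clamp t) : A).
Proof.
move=> t; apply: (@continuous_comp _ _ _ (@clamp R) (fun y : I => (x, y) : A)).
  exact: clamp_continuous.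
exact: alexandroff_fiber_continuous.
Qed.

Lemma arc_points_off (x y : I) : y != x -> Y (x, y).
Proof.
move=> yx; exists (fun t : R => (x, clamp t) : A); first exact: alexandroff_path_continuous.
apply/(alexandroff_nbhs_off _ yx); apply: filterE => z.
by exists (\val z) => //; rewrite clampK.
Qed.

Lemma open_off_fiber (x : I) (U : set I) : open U -> ~ U x -> open ([set x] `*` U : set A).
Proof.
move=> oU Ux; exists [set [set x] `*` U]; last by rewrite bigcup_set1.
by move=> _ ->; left; exists x, U.
Qed.

(** A neighbourhood of (x, x) contains (z, x) for all but finitely many z. These points lie in
    columns deprived of their diagonal points, which are uncountably many disjoint open sets. *)
Lemma not_arc_points_diag (x : I) : ~ Y (x, x).
Proof.
move=> [gamma cg /alexandroff_nbhs_diag[F fF [nFx nU]]].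
have Ux z : ~ F z -> range gamma (z, x) by exact: (nbhs_singleton nU).
pose S := `]0, 1[%classic `\` ((fun z : I => \val z) @` F `|` [set \val x]).
have Sval t : S t -> [/\ 0 < t < 1, ~ F (clamp t) & clamp t != x].
  move=> [/itvooP t01 nF]; have tv : \val (clamp t : I) = t.
    by rewrite clampE//; case/andP: t01 => /ltW-> /ltW->.
  split => //; first by move=> Ft; apply: nF; left; exists (clamp t).
  by apply/eqP => tx; apply: nF; right; rewrite -tx tv.
have cS : countable S.
  apply: (@curve_countable_family R A gamma _
    (fun t => [set clamp t] `*` [set z | z != clamp t])) => //.
  - move=> t _; apply: open_off_fiber; last by rewrite /mkset eqxx.
    by rewrite openE => z; exact: unit_near_neq.
  - move=> t /Sval[_ nF tx]; exists (clamp t, x).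
    by split; [split => //=; rewrite eq_sym|exact: Ux].
  - move=> t u /Sval[t01 _ _] /Sval[u01 _ _] [q [[qt _] [qu _]]].
    have : clamp t = clamp u :> I by rewrite -qt -qu.
    move=> /(congr1 \val); rewrite !clampE//.
      by case/andP: u01 => /ltW-> /ltW->.
    by case/andP: t01 => /ltW-> /ltW->.
apply: (@itv_uncountable R 0 1) => //.
(* S and finitely many exceptions cover (0, 1), so a countable S would make (0, 1) countable. *)
pose B b := if b then S else (fun z : I => \val z) @` F `|` [set \val x].
apply: (@sub_countable _ _ _ (\bigcup_(b in [set: bool]) B b)).
  apply: subset_card_le => t t01.
  have [nt|nt] := pselect (((fun z : I => \val z) @` F `|` [set \val x]) t).
    by exists false.
  by exists true.
apply: bigcup_countable => // -[] _ //; apply: finite_set_countable.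
by rewrite finite_setU; split => //; exact: finite_image.
Qed.

Lemma lower_component (x y z : I) : \val y < \val x -> \val z < \val x -> K (x, y) (x, z).
Proof.
move=> yx zx; exists ((fun t : R => (x, clamp t) : A) @` `[0, \val x[%classic).
  split.
  - by exists (\val y); [apply/itvcoP; rewrite unit_ge0|rewrite clampK].
  - move=> _ [t /itvcoP/andP[t0 tx] <-].
    apply: arc_points_off; apply/eqP => /(congr1 \val) tE.
    have x1 := unit_le1 x; have : t <= 1 by apply: le_trans (ltW tx) x1.
    by move=> t1; move: tE; rewrite clampE ?t0// => tE; move: tx; rewrite -tE /= ltxx.
  - exact: continuous_image_connected (@interval_connected _ _) (@alexandroff_path_continuous x).
by exists (\val z); [apply/itvcoP; rewrite unit_ge0|rewrite clampK].
Qed.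

Lemma open_unit_lt (a : R) : open [set z : I | \val z < a].
Proof.
rewrite openE => z za; apply/unit_nbhsP; exists (a - \val z); first by rewrite subr_gt0.
by move=> v; rewrite ltr_norml => /andP[+ _]; rewrite /mkset; lra.
Qed.

Lemma open_unit_gt (a : R) : open [set z : I | a < \val z].
Proof.
rewrite openE => z za; apply/unit_nbhsP; exists (\val z - a); first by rewrite subr_gt0.
by move=> v; rewrite ltr_norml => /andP[_]; rewrite /mkset; lra.
Qed.

(** Among the points off the diagonal, the part of column x below (x, x) is both open and closed,
    and arc points avoid the diagonal. *)
Lemma lower_component_sub (x y : I) (q : A) : \val y < \val x ->
  K (x, y) q -> q.1 = x /\ \val q.2 < \val x.
Proof.
move=> yx [C [Cp CY cC] Cq].
have oU : open ([set x] `*` [set z | \val z < \val x] : set A).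
  by apply: open_off_fiber; [exact: open_unit_lt|rewrite /mkset ltxx].
have oV : open [set p : A | p.2 != p.1 /\ ~ ([set x] `*` [set z | \val z < \val x]) p].
  rewrite openE => -[u v] [/= vu nuv]; apply/(alexandroff_nbhs_off _ vu).
  have nu : nbhs v [set z | z != u] := unit_near_neq vu.
  have [ux|ux] := eqVneq u x; last first.
    by apply: filterS nu => z zu; split => // -[/= ux' _]; rewrite ux' eqxx in ux.
  have xv : \val x < \val v.
    rewrite lt_neqAle (inj_eq val_inj) -ux eq_sym vu /= leNgt; apply/negP => h.
    by apply: nuv; rewrite -ux.
  have nv : nbhs v [set z | \val x < \val z].
    by apply: open_nbhs_nbhs; split => //; exact: open_unit_gt.
  apply: filterS2 nu nv => z zu xz; split => // -[_].
  by rewrite /mkset ltNge (ltW xz).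
have := connected_open_sub cC oU oV; apply => //.
- move=> p Cp'; have [?|np] := pselect (([set x] `*` [set z | \val z < \val x]) p).
    by left.
  right; split => //; apply/eqP => pE; apply: (@not_arc_points_diag p.1).
  by have := CY p Cp'; rewrite (surjective_pairing p) /= pE.
- by move=> p [[_ Up] [_]].
- by exists (x, y).
Qed.

Lemma arc_end_bottom (x : I) : x != I0 -> E (x, I0).
Proof.
move=> x0; have x0' : 0 < \val x by rewrite unit_gt0.
split; first by apply: arc_points_off; rewrite eq_sym.
have -> : K (x, I0) `\ (x, I0) = (fun t : R => (x, clamp t) : A) @` `]0, \val x[%classic.
  apply/seteqP; split => [[u v]|_ [t + <-]].
    move=> [/lower_component_sub]; rewrite I0E => /(_ x0')[ux vx] v0; rewrite /= in ux.
    exists (\val v); last by rewrite clampK ux.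
    apply/itvooP/andP; split => //; rewrite unit_gt0.
    by apply/eqP => vE; apply: v0; rewrite ux vE.
  move=> /itvooP/andP[t0 tx]; have x1 := unit_le1 x.
  have vt : \val (clamp t : I) = t by rewrite clampE// (ltW t0) (ltW (lt_le_trans tx x1)).
  split; first by apply: lower_component; rewrite ?I0E ?vt.
  by move=> /(congr1 (fun p : A => \val p.2)); rewrite vt I0E => tE; rewrite tE ltxx in t0.
exact: continuous_image_connected (@interval_connected _ _) (@alexandroff_path_continuous x).
Qed.

Lemma not_arc_end_lower (x y : I) : 0 < \val y -> \val y < \val x -> ~ E (x, y).
Proof.
move=> y0 yx [_ cK]; have x1 := unit_le1 x.
pose b : I := clamp ((\val y + \val x) / 2).
have bv : \val b = (\val y + \val x) / 2 by rewrite clampE//; apply/andP; split; lra.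
have oU : open ([set x] `*` [set z | \val z < \val y] : set A).
  apply: open_off_fiber; [exact: open_unit_lt|rewrite /mkset].
  by move=> /(lt_trans yx); rewrite ltxx.
have oV : open ([set x] `*` ([set z | \val y < \val z] `&` [set z | \val z < \val x]) : set A).
  apply: open_off_fiber; last by move=> [_]; rewrite /mkset ltxx.
  by apply: openI; [exact: open_unit_gt|exact: open_unit_lt].
have := connected_open_sub cK oU oV.
suff H : ~ (K (x, y) `\ (x, y) `<=` [set x] `*` [set z | \val z < \val y]).
  move=> H'; apply: H; apply: H'.
  - move=> [u v] [/(lower_component_sub yx)[/= -> vx] vy].
    have [h|h|h] := ltgtP (\val v) (\val y); [by left|by right|].
    by case: vy; rewrite (val_inj h).
  - move=> p [[_ [_ py]] [_ [yp _]]].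
    by have := lt_trans py yp; rewrite ltxx.
  - exists (x, I0); split; last by split => //; rewrite /mkset I0E.
    split; first by apply: lower_component; rewrite ?I0E// (lt_trans y0).
    by move=> /(congr1 (fun p : A => \val p.2)); rewrite I0E => yE; rewrite -yE ltxx in y0.
have Kb : (K (x, y) `\ (x, y)) (x, b).
  split; first by apply: lower_component; rewrite ?bv; lra.
  by move=> /(congr1 (fun p : A => \val p.2)); rewrite bv => h; lra.
by move=> /(_ _ Kb)[_]; rewrite /mkset bv; lra.
Qed.


Lemma arc_end_cases_alexandroff (p : A) : E p ->
  (p.2 = I0 \/ p.2 = I1) /\ p.2 != p.1.
Proof.
case: p => x y /=.
have low (u v : I) : \val v < \val u -> E (u, v) -> v = I0.
  move=> vu Euv; apply/eqP; rewrite -[_ == _]negbK -unit_gt0; apply/negP => v0.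
  exact: (not_arc_end_lower v0 vu Euv).
have [yx|xy|yx] := ltgtP (\val y) (\val x) => Exy.
- split; first by left; exact: low yx Exy.
  by apply/eqP => yE; rewrite yE ltxx in yx.
- split; last by apply/eqP => yE; rewrite yE ltxx in xy.
  right; apply: (can_inj (@onem_unitK R)); rewrite onem_unit1.
  apply: (low (onem_unit x)); first by rewrite !onem_unitE; lra.
  exact: (arc_ends_homeo R flip (x, y)).2 Exy.
- have [Yxy _] := Exy; case: (@not_arc_points_diag x).
  by move: Yxy; rewrite (val_inj yx).
Qed.

(** The corner is a limit of the bottom ends (z, 0) of the other columns: a neighbourhood omits only
    finitely many columns. *)
Lemma closure_arc_ends_corner : closure E (I0, I0).
Proof.
move=> U /alexandroff_nbhs_diag[F fF [_ /nbhs_singleton nU]].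
have [z [nFz z0]] : exists z : I, ~ F z /\ z != I0.
  apply: contrapT => H; apply: (@itv_uncountable R 0 1) => //.
  apply: finite_set_countable; apply: (@sub_finite_set _ _ ((fun z : I => \val z) @` F)).
    move=> t /itvooP t01; exists (clamp t); last first.
      by rewrite clampE//; case/andP: t01 => /ltW-> /ltW->.
    apply: contrapT => nF; apply: H; exists (clamp t); split => //.
    by rewrite -unit_gt0 clampE; case/andP: t01 => // /ltW-> /ltW->.
  exact: finite_image.
by exists (z, I0); split; [exact: arc_end_bottom|exact: nU].
Qed.

(** All ends lie at height 0 or 1, and an inner diagonal point has a neighbourhood without these
    heights. *)
Lemma not_closure_arc_ends (x : I) : 0 < \val x < 1 -> ~ closure E (x, x).
Proof.
rewrite unit_interior => /andP[x0 x1] cE.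
have /cE : nbhs ((x, x) : A) [set q : A | q.2 != I0 /\ q.2 != I1].
  apply/alexandroff_nbhs_diag; exists set0; first exact: finite_set0.
  split => //.
  have n0 : nbhs x [set z | z != I0] := unit_near_neq x0.
  have n1 : nbhs x [set z | z != I1] := unit_near_neq x1.
  by apply: filterS2 n0 n1.
move=> [q [/arc_end_cases_alexandroff[qE _] [q0 q1]]].
by case: qE => qE; [rewrite qE eqxx in q0|rewrite qE eqxx in q1].
Qed.

(** These are exactly the corners (0, 0) and (1, 1), expressed in terms that every homeomorphism
    preserves. *)
Let D : set A := closure E `&` ~` Y.

Let D_homeo (h : homeo A) p : D (h p) <-> D p.
Proof.
rewrite /D; split => -[cE nY]; (split; last by move=> Yp; apply: nY; apply/(arc_points_homeo _ h)).
  by move: cE; apply closure_homeo => g q Eq; exact/arc_ends_homeo.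
by apply/closure_homeo => // g q Eq; exact/arc_ends_homeo.
Qed.

Let K_homeo (h : homeo A) p :
  closure (K (h p)) `&` D !=set0 <-> closure (K p) `&` D !=set0.
Proof.
have imp (g : homeo A) q : closure (K q) `&` D !=set0 -> closure (K (g q)) `&` D !=set0.
  move=> [z [cz Dz]]; exists (g z); split; last exact/D_homeo.
  move=> U nU; have : nbhs z [set v | U (g v)] by exact: homeo_fun_continuous nU.
  by move=> /cz[v [Kv Uv]]; exists (g v); split => //; rewrite arc_component_homeo; exists v.
split; last exact: imp.
by move=> /(imp (homeo_recip h)) /=; rewrite homeo_funK.
Qed.

(** For r = 0 the colours 0 and 3 are the diagonal points, 1 and 4 the column ends off the diagonal,
    2 and 5 the rest. In each pair the first colour belongs to the extreme columns: [closure E]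
    detects this on the diagonal, and a component whose closure reaches D detects it elsewhere. *)
Let profile (p : A) (n : nat) :=
  [/\ Y p <-> (n \notin [:: 0; 3])%N, E p <-> (n \in [:: 1; 4])%N,
    (n \in [:: 0; 3])%N -> (closure E p <-> n = 0%N)
    & (n \notin [:: 0; 3])%N -> (closure (K p) `&` D !=set0 <-> (n < 3)%N)].

Let profile_homeo (h : homeo A) p n : profile (h p) n <-> profile p n.
Proof.
have cE : closure E (h p) <-> closure E p.
  by apply: closure_homeo => g q Eq; exact/arc_ends_homeo.
rewrite /profile; split => -[h1 h2 h3 h4]; split.
- by rewrite -h1; split => /arc_points_homeo.
- by rewrite -h2; split => /arc_ends_homeo.
- by move=> /h3 <-; split => /cE.
- by move=> /h4 <-; split => /K_homeo.
- by rewrite -h1; split => /arc_points_homeo.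
- by rewrite -h2; split => /arc_ends_homeo.
- by move=> /h3 <-; split => /cE.
- by move=> /h4 <-; split => /K_homeo.
Qed.

Let D_corner : D (I0, I0).
Proof. by split; [exact: closure_arc_ends_corner|exact: not_arc_points_diag]. Qed.

Let D_corner1 : D (I1, I1).
Proof. by apply/(D_homeo flip); rewrite square_homeoE /= onem_unit1. Qed.

Let D_sub (q : A) : D q -> q = (I0, I0) \/ q = (I1, I1).
Proof.
case: q => u v [cE nY]; have vu : v = u.
  by apply/eqP; rewrite -[_ == _]negbK; apply/negP => vu; apply: nY; exact: arc_points_off.
rewrite {}vu in cE nY *; have [u01|] := boolP (0 < \val u < 1).
  by case: (not_closure_arc_ends u01).
by rewrite unit_interior negb_and !negbK => /orP[] /eqP ->; [left|right].
Qed.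

Let closure_right_column (y : I) : y != I1 -> closure (K (I1, y)) (I1, I1).
Proof.
move=> y1 U /(alexandroff_fiber_continuous (x := I1)) nU.
have [e e0 eU] : exists2 e : R, 0 < e & forall v : I, `|\val I1 - \val v| < e -> U (I1, v).
  by have /unit_nbhsP := nU.
pose t := Num.max 0 (1 - e / 2); have t0 : 0 <= t by rewrite le_max lexx.
have t1 : t < 1 by rewrite gt_max ltr01 andTb; lra.
have tv : \val (clamp t : I) = t by rewrite clampE// t0 ltW.
exists (I1, clamp t); split.
  by apply: lower_component; rewrite I1E ?tv// unit_lt1.
apply: eU; rewrite tv I1E ger0_norm; last by lra.
have : 1 - e / 2 <= t by rewrite le_max lexx orbT.
lra.
Qed.

(** The component stays in column x, and that column may be removed from a neighbourhood of a corner
    of the diagonal. *)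
Let not_closure_inner (x y : I) : 0 < \val x < 1 -> \val y < \val x ->
  ~ (closure (K (x, y)) `&` D !=set0).
Proof.
move=> x01 yx [q [cK Dq]].
have [z [zx qE]] : exists z, z != x /\ q = (z, z).
  move: x01; rewrite unit_interior => /andP[x0 x1].
  by case: (D_sub Dq) => qE; [exists I0|exists I1]; rewrite eq_sym.
have nz : nbhs q [set p : A | p.1 != x].
  rewrite qE; apply/alexandroff_nbhs_diag; exists [set x]; first exact: finite_set1.
  split; first by move=> /= zx'; rewrite zx' eqxx in zx.
  by apply: filterE => v u /= ux; apply/eqP.
by have [p [/(lower_component_sub yx)[px _]]] := cK _ nz; rewrite /mkset px eqxx.
Qed.

Let profileP (p : A) : profile p (c p).
Proof.
have arrow (P Q : Prop) : P -> Q -> (P <-> Q) by [].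
have narrow (P Q : Prop) : ~ P -> ~ Q -> (P <-> Q) by [].
have nEdiag x : ~ E (x, x) by move=> [/not_arc_points_diag].
have diag0 : profile (I0, I0) (c (I0, I0)).
  rewrite /c framed_color0 /edge_color eqxx; split => //.
  - by apply: narrow => //; exact: not_arc_points_diag.
  - by apply: narrow => //; exact: nEdiag.
  - by move=> _; apply: arrow => //; exact: closure_arc_ends_corner.
have diag x : profile (x, x) (c (x, x)).
  have [->//|x0] := eqVneq x I0.
  have [->|x1] := eqVneq x I1.
    apply/(profile_homeo flip); rewrite square_homeoE /= onem_unit1.
    by rewrite /c framed_color1 onem_unit1 -(framed_color0 0 (@alexandroff_inner R)).
  rewrite /c framed_color_in// /alexandroff_inner eqxx; split => //.
  - by apply: narrow => //; exact: not_arc_points_diag.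
  - by apply: narrow => //; exact: nEdiag.
  - by move=> _; apply: narrow => //; apply: not_closure_arc_ends; rewrite unit_interior x0.
have low (x y : I) : \val y < \val x -> profile (x, y) (c (x, y)).
  move=> yx; have x0 : x != I0.
    by rewrite -unit_gt0; exact: le_lt_trans (unit_ge0 y) yx.
  have y1 : y != I1 by rewrite -unit_lt1; exact: lt_le_trans yx (unit_le1 x).
  have yneqx : y != x by apply/eqP => yE; rewrite yE ltxx in yx.
  have Yxy := arc_points_off yneqx.
  have nE : y != I0 -> ~ E (x, y).
    by rewrite -unit_gt0 => y0; exact: not_arc_end_lower.
  have [xE|x1] := eqVneq x I1.
    have cK : closure (K (x, y)) `&` D !=set0.
      by exists (I1, I1); split => //; rewrite xE; exact: closure_right_column.
    rewrite {2}xE /c framed_color1 /edge_color !onem_unit_eq onem_unit0 onem_unit1.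
    rewrite (negbTE y1); have [y0|y0] := eqVneq y I0; split => //.
    - by apply: arrow => //; rewrite y0; exact: arc_end_bottom.
    - by apply: narrow => //; exact: nE.
  have nK : ~ (closure (K (x, y)) `&` D !=set0).
    by apply: not_closure_inner => //; rewrite unit_interior x0.
  rewrite /c framed_color_in// /alexandroff_inner (negbTE yneqx) (negbTE y1) orbF.
  have [y0|y0] := eqVneq y I0; split => //.
  - by apply: arrow => //; rewrite y0; exact: arc_end_bottom.
  - by apply: narrow => //; exact: nE.
case: p => x y; have [|xy|yx] := ltgtP (\val y) (\val x); first exact: low.
  apply/(profile_homeo flip); rewrite square_homeoE.
  have -> : c (x, y) = c (onem_unit x, onem_unit y).
    symmetry; apply: framed_color_onem => a b.
    rewrite /alexandroff_inner (inj_eq (can_inj (@onem_unitK R))).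
    by rewrite !onem_unit_eq onem_unit0 onem_unit1 orbC.
  by apply: low; rewrite !onem_unitE; lra.
by rewrite (val_inj yx); exact: diag.
Qed.

(** The profile leaves one colour among 0 to 5, and p and its image have the same profile. *)
Lemma alexandroff_color_homeo (h : homeo A) p : c (h p) = c p.
Proof.
have := profileP (h p); move=> /(profile_homeo h); have := profileP p.
have := framed_color_le 0 (@alexandroff_inner_le R) p.
have := framed_color_le 0 (@alexandroff_inner_le R) (h p).
rewrite -/(c p) -/(c (h p)); move: (c p) (c (h p)) => m n.
move=> n4 m4 [h1 h2 h3 h4] [k1 k2 k3 k4].
have e1 : (m \in [:: 0; 3])%N = (n \in [:: 0; 3])%N.
  by apply: negb_inj; apply/idP/idP => [/h1/k1|/k1/h1].
have e2 : (m \in [:: 1; 4])%N = (n \in [:: 1; 4])%N.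
  by apply/idP/idP => [/h2/k2|/k2/h2].
have e3 : (m \in [:: 0; 3])%N -> (m == 0%N) = (n == 0%N).
  move=> om; have on : (n \in [:: 0; 3])%N by rewrite -e1.
  by apply/eqP/eqP => [/(h3 om)/(k3 on)|/(k3 on)/(h3 om)].
have e4 : (m \notin [:: 0; 3])%N -> (m < 3)%N = (n < 3)%N.
  move=> om; have on : (n \notin [:: 0; 3])%N by rewrite -e1.
  by apply/idP/idP => [/(h4 om)/(k4 on)|/(k4 on)/(h4 om)].
have [om|om] := boolP (m \in [:: 0; 3])%N; [move: (e3 om)|move: (e4 om)];
  move: n4 m4 e1 e2 om {h1 h2 h3 h4 k1 k2 k3 k4 e3 e4};
  by case: n => [|[|[|[|[|[|n]]]]]] //; case: m => [|[|[|[|[|[|m]]]]]].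
Qed.

End AlexandroffInvariance.

(** * The Euclidean square *)

Section PlaneMaps.
Variable R : realType.
Local Notation I := (unit_interval R).
Local Notation U := (euclidean_square R).

Definition in_square (p : R * R) := (0 <= p.1 <= 1) && (0 <= p.2 <= 1).

Definition coords (p : U) : R * R := (\val p.1, \val p.2).

Definition square_point (p : R * R) : U := (clamp p.1, clamp p.2).

Lemma coords_in_square p : in_square (coords p).
Proof. by rewrite /in_square /coords !unit_itv. Qed.

Lemma coordsK : cancel coords square_point.
Proof. by move=> [x y]; rewrite /square_point /coords !clampK. Qed.

Lemma square_pointK p : in_square p -> coords (square_point p) = p.
Proof.
case: p => x y /andP[x01 y01]; rewrite /coords /square_point.
by rewrite (clampE x01) (clampE y01).
Qed.

Lemma coords_continuous : continuous coords.
Proof. exact: initial_continuous. Qed.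

Lemma continuous_pair (T : topologicalType) (f g : T -> R) (x : T) :
  {for x, continuous f} -> {for x, continuous g} ->
  {for x, continuous (fun y => (f y, g y) : R * R)}.
Proof.
move=> cf cg W [[P Q] /= [nP nQ] PQW].
have nfP : nbhs x [set y | P (f y)] by exact: cf nP.
have ngQ : nbhs x [set y | Q (g y)] by exact: cg nQ.
by apply: filterS2 nfP ngQ => y Py Qy; exact: PQW.
Qed.

Lemma square_point_continuous : continuous square_point.
Proof.
apply: continuous_comp_initial => -[x y].
have cl (f : R * R -> R) p : {for p, continuous f} ->
    {for p, continuous (fun q => \val (clamp (f q) : I))}.
  move=> cf; apply: (@continuous_comp (R * R)%type R R f (fun t : R => \val (clamp t : I))) => //.
  apply: (@continuous_comp R I R (@clamp R) (fun t : I => \val t)).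
    exact: clamp_continuous.
  exact: unit_val_continuous.
apply: (@continuous_pair _ (fun q : R * R => \val (clamp q.1 : I))
  (fun q : R * R => \val (clamp q.2 : I)) (x, y)).
  by apply: (cl fst); exact: cvg_fst.
by apply: (cl snd); exact: cvg_snd.
Qed.

Section PlaneHomeo.
Variables F F' : R * R -> R * R.
Hypothesis Fin : forall p, in_square p -> in_square (F p).
Hypothesis F'in : forall p, in_square p -> in_square (F' p).
Hypothesis FK : forall p, in_square p -> F' (F p) = p.
Hypothesis F'K : forall p, in_square p -> F (F' p) = p.
Hypothesis cF : forall p, in_square p -> {for p, continuous F}.
Hypothesis cF' : forall p, in_square p -> {for p, continuous F'}.

Let lift (G : R * R -> R * R) (p : U) : U := square_point (G (coords p)).

Let lift_continuous G : (forall p, in_square p -> {for p, continuous G}) ->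
  continuous (lift G).
Proof.
move=> cG p; apply: (@continuous_comp _ _ _ coords (square_point \o G)).
  exact: coords_continuous.
apply: continuous_comp; last exact: square_point_continuous.
by apply: cG; exact: coords_in_square.
Qed.

Program Definition plane_homeo : homeo U :=
  @Homeo U (lift F) (lift F') _ _ (lift_continuous cF) (lift_continuous cF').
Next Obligation.
move=> p; have pin := coords_in_square p.
by rewrite /lift square_pointK ?FK ?coordsK//; exact: Fin.
Qed.
Next Obligation.
move=> p; have pin := coords_in_square p.
by rewrite /lift square_pointK ?F'K ?coordsK//; exact: F'in.
Qed.

Lemma plane_homeoE p : coords (plane_homeo p) = F (coords p).
Proof. by rewrite /= square_pointK//; apply: Fin; exact: coords_in_square. Qed.

End PlaneHomeo.

(** The projective map of [0, 1] that fixes both ends and divides the odds y / (1 - y) by s, so that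
    s^-1 gives the inverse. Being rational, it is jointly continuous in s and y up to the ends, as
    shears require. *)
Definition moebius (s y : R) := y / (y + (1 - y) * s).

Implicit Types y z : R.

Lemma moebius_den (s : R) y : 0 < s -> 0 <= y <= 1 -> 0 < y + (1 - y) * s.
Proof.
move=> s0 /andP[y0 y1]; have [->|yn1] := eqVneq y 1; first by rewrite subrr mul0r addr0.
have y1' : 0 < 1 - y by rewrite subr_gt0 lt_neqAle yn1.
by have := mulr_gt0 y1' s0; lra.
Qed.

Lemma moebius_itv (s : R) y : 0 < s -> 0 <= y <= 1 -> 0 <= moebius s y <= 1.
Proof.
move=> s0 y01; have d := moebius_den s0 y01; move: y01 => /andP[y0 y1].
have h : 0 <= (1 - y) * s by apply: mulr_ge0; [rewrite subr_ge0|exact: ltW].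
by rewrite /moebius divr_ge0 ?(ltW d)//= ler_pdivrMr// mul1r lerDl.
Qed.

Lemma moebiusK (s : R) y : 0 < s -> 0 <= y <= 1 -> moebius s^-1 (moebius s y) = y.
Proof.
move=> s0 y01; have d := moebius_den s0 y01; have dn := lt0r_neq0 d.
rewrite /moebius; set e := y + (1 - y) * s in d dn *.
have -> : 1 - y / e = (1 - y) * s / e.
  by rewrite -[X in X - _](divff dn) -mulrBl; congr (_ / _); rewrite /e; lra.
have -> : (1 - y) * s / e / s = (1 - y) / e.
  by rewrite mulrAC mulfK// lt0r_neq0.
rewrite -mulrDl addrCA subrr addr0 mul1r invrK divfK//.
Qed.

Lemma moebius1 y : moebius 1 y = y.
Proof. by rewrite /moebius mulr1 addrCA subrr addr0 divr1. Qed.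

Lemma moebius_0 (s : R) : moebius s 0 = 0.
Proof. by rewrite /moebius mul0r. Qed.

Lemma moebius_1 (s : R) : moebius s 1 = 1.
Proof. by rewrite /moebius subrr mul0r addr0 divr1. Qed.

Lemma moebius_transitive y z : 0 < y < 1 -> 0 < z < 1 ->
  exists2 s : R, 0 < s & moebius s y = z.
Proof.
move=> /andP[y0 y1] /andP[z0 z1]; have y1' : 0 < 1 - y by rewrite subr_gt0.
have z1' : 0 < 1 - z by rewrite subr_gt0.
(* The quotient of the odds of y by those of z. *)
exists ((y * (1 - z)) / (z * (1 - y))); first by rewrite divr_gt0 ?mulr_gt0.
have zn := lt0r_neq0 z0; have y1n := lt0r_neq0 y1'; rewrite /moebius.
have -> : (1 - y) * ((y * (1 - z)) / (z * (1 - y))) = y * (1 - z) / z.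
  by rewrite invfM mulrCA [X in _ * X]mulrCA divff// mulr1.
have -> : y + y * (1 - z) / z = y / z.
  by rewrite -[X in X + _](mulfK zn) -mulrDl; congr (_ / _); lra.
by rewrite invf_div mulrC divfK// lt0r_neq0.
Qed.

Lemma fst_continuous (p : R * R) : {for p, continuous (@fst R R)}.
Proof. exact: cvg_fst. Qed.

Lemma snd_continuous (p : R * R) : {for p, continuous (@snd R R)}.
Proof. exact: cvg_snd. Qed.

Section Shear.
Variable s : R -> R.
Hypothesis s_gt0 : forall x, 0 < s x.
Hypothesis s_continuous : continuous s.

Let shear (s : R -> R) (p : R * R) : R * R := (p.1, moebius (s p.1) p.2).

Let sV x := (s x)^-1.

Let sV_gt0 x : 0 < sV x. Proof. by rewrite invr_gt0. Qed.

Let sV_continuous : continuous sV.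
Proof. by move=> x; apply: cvgV; [exact: lt0r_neq0|exact: s_continuous]. Qed.

Let shear_in (t : R -> R) p : (forall x, 0 < t x) -> in_square p -> in_square (shear t p).
Proof.
by move=> t0 /andP[p1 p2]; rewrite /in_square /= p1 moebius_itv.
Qed.

Let shear_continuous (t : R -> R) p : (forall x, 0 < t x) -> continuous t ->
  in_square p -> {for p, continuous (shear t)}.
Proof.
move=> t0 ct /andP[p1 p2]; apply: continuous_pair; first exact: fst_continuous.
have ct' : {for p, continuous (fun q : R * R => t q.1)}.
  by apply: continuous_comp; [exact: fst_continuous|exact: ct].
apply: cvgM; first exact: snd_continuous.
apply: cvgV; first by apply: lt0r_neq0; exact: moebius_den.
apply: cvgD; first exact: snd_continuous.
by apply: cvgM => //; apply: cvgB; [exact: cvg_cst|exact: snd_continuous].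
Qed.

Program Definition shear_homeo : homeo U :=
  @plane_homeo (shear s) (shear sV) _ _ _ _ _ _.
Next Obligation. by move=> p; exact: shear_in. Qed.
Next Obligation. by move=> p; exact: shear_in. Qed.
Next Obligation.
move=> [x y] /andP[_ y01].
by rewrite /shear /sV /= moebiusK.
Qed.
Next Obligation.
move=> [x y] /andP[_ y01].
by rewrite /shear /sV /= -{1}[s x]invrK moebiusK// invr_gt0.
Qed.
Next Obligation. by move=> p; exact: shear_continuous. Qed.
Next Obligation. by move=> p; exact: shear_continuous. Qed.

Lemma shear_homeoE p : coords (shear_homeo p) =
  ((coords p).1, moebius (s (coords p).1) (coords p).2).
Proof. exact: plane_homeoE. Qed.

End Shear.
End PlaneMaps.

(** * A twist that moves a corner along the boundary *)

Section CornerMap.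
Variable R : realType.
Implicit Types (k w a b : R) (m : R -> R) (p : R * R).

(* On [-w, w] this is the Moebius map u |-> u / (u + (1 - u) * (1 + w * k)) in
   the coordinate u = (w + a) / (2 * w), with the factor w cancelled so that
   w = 0 is allowed. *)
Definition corner_shift k w a : R := (2 * a - k * w * (w - a)) / (2 + (w - a) * k).

(** For negative k the worst case is a = -w, where the value is 2 * (1 + w * k). *)
Lemma corner_shift_den k w a : - w <= a <= w -> 0 < 1 + w * k -> 0 < 2 + (w - a) * k.
Proof.
move=> /andP[aw wa] wk; have [k0|k0] := leP 0 k; first by nra.
nra.
Qed.

Lemma corner_shift_itv k w a : - w <= a <= w -> 0 < 1 + w * k ->
  - w <= corner_shift k w a <= w.
Proof.
move=> aw wk; have d := corner_shift_den aw wk; move: aw => /andP[aw wa].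
rewrite /corner_shift ler_pdivlMr// ler_pdivrMr//; apply/andP; split; first by lra.
have : 0 <= (w - a) * (1 + w * k) by apply: mulr_ge0; [rewrite subr_ge0|exact: ltW].
lra.
Qed.

(** 1 + w * k is the Moebius parameter, and - k / (1 + w * k) is the value of k that inverts it. *)
Lemma corner_shift_recip_gt0 k w : 0 < 1 + w * k -> 0 < 1 + w * (- k / (1 + w * k)).
Proof.
move=> wk; have wn := lt0r_neq0 wk.
have -> : 1 + w * (- k / (1 + w * k)) = (1 + w * k)^-1.
  rewrite -[X in X + _](divff wn) mulrA -mulrDl -[RHS]mul1r; congr (_ * _); lra.
by rewrite invr_gt0.
Qed.

Lemma corner_shiftK k w a : - w <= a <= w -> 0 < 1 + w * k ->
  corner_shift (- k / (1 + w * k)) w (corner_shift k w a) = a.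
Proof.
move=> aw wk; have d := corner_shift_den aw wk.
have d2 := corner_shift_den (corner_shift_itv aw wk) (corner_shift_recip_gt0 wk).
have wn := lt0r_neq0 wk; apply: (mulIf (lt0r_neq0 d2)).
rewrite [X in X * _ = _]/corner_shift divfK ?lt0r_neq0//.
have Q : corner_shift k w a * (2 + (w - a) * k) = 2 * a - k * w * (w - a).
  by rewrite /corner_shift divfK// lt0r_neq0.
have P : - k / (1 + w * k) * (1 + w * k) = - k by rewrite divfK.
move: Q P; set b := corner_shift k w a; set l := - k / (1 + w * k) => Q P.
apply: (mulIf wn).
have -> : (2 * b - l * w * (w - b)) * (1 + w * k) =
    2 * b * (1 + w * k) - (l * (1 + w * k)) * (w * (w - b)) by lra.
have -> : a * (2 + (w - b) * l) * (1 + w * k) =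
    a * (2 * (1 + w * k) + (w - b) * (l * (1 + w * k))) by lra.
rewrite P; lra.
Qed.

Local Notation U := (euclidean_square R).

(* The coordinates a = x - y and b = min(x, y) open the quadrant at the origin
   into a half plane, so that moving a pushes the corner along the boundary. *)
Definition corner m p : R * R :=
  let b := Num.min p.1 p.2 in
  let a := corner_shift (m b) (1 - b) (p.1 - p.2) in
  (b + Num.max 0 a, b + Num.max 0 (- a)).

(** On the level min(x, y) = b of the square the difference x - y ranges over [-(1 - b), 1 - b]; the
    condition makes the Moebius parameter positive on every level. *)
Definition corner_valid m := forall b, 0 < 1 + (1 - b) * m b.

Definition corner_recip m b := - m b / (1 + (1 - b) * m b).

Lemma corner_recip_valid m : corner_valid m -> corner_valid (corner_recip m).
Proof. by move=> vm b; exact: corner_shift_recip_gt0. Qed.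

Lemma square_corner p : in_square p ->
  0 <= Num.min p.1 p.2 <= 1 /\
  - (1 - Num.min p.1 p.2) <= p.1 - p.2 <= 1 - Num.min p.1 p.2.
Proof.
case: p => x y /andP[/= /andP[x0 x1] /andP[y0 y1]].
by have [xy|xy] := leP x y; split; apply/andP; split; lra.
Qed.

Lemma min_corner m p : Num.min (corner m p).1 (corner m p).2 = Num.min p.1 p.2.
Proof.
rewrite /corner /=; set b := Num.min p.1 p.2; set a := corner_shift _ _ _.
have [a0|a0] := leP 0 a.
  by rewrite [Num.max 0 (- a)]max_l ?oppr_le0// addr0 min_r// lerDl.
by rewrite [Num.max 0 (- a)]max_r ?oppr_ge0 ?ltW// addr0 min_l// lerDl oppr_ge0 ltW.
Qed.

Lemma sub_corner m p : (corner m p).1 - (corner m p).2 =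
  corner_shift (m (Num.min p.1 p.2)) (1 - Num.min p.1 p.2) (p.1 - p.2).
Proof.
rewrite /corner /=; set b := Num.min p.1 p.2; set a := corner_shift _ _ _.
have [a0|a0] := leP 0 a.
  by rewrite [Num.max 0 (- a)]max_l ?oppr_le0//; lra.
by rewrite [Num.max 0 (- a)]max_r ?oppr_ge0 ?ltW//; lra.
Qed.

Lemma corner_rebuild p (b := Num.min p.1 p.2) (a := p.1 - p.2) :
  (b + Num.max 0 a, b + Num.max 0 (- a)) = p.
Proof.
case: p @b @a => x y /=; have [xy|xy] := leP x y.
  rewrite max_l; last by lra. rewrite max_r; last by lra.
  by congr pair; lra.
rewrite max_r; last by lra. rewrite max_l; last by lra.
by congr pair; lra.
Qed.

Lemma cornerK m p : corner_valid m -> in_square p ->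
  corner (corner_recip m) (corner m p) = p.
Proof.
move=> vm /square_corner[b01 aw].
rewrite {1}/corner min_corner sub_corner corner_shiftK//.
exact: corner_rebuild.
Qed.

Lemma corner_recipK m b : corner_valid m -> corner_recip (corner_recip m) b = m b.
Proof.
move=> vm; have v := vm b; have vn := lt0r_neq0 v.
rewrite {1}/corner_recip.
have -> : 1 + (1 - b) * corner_recip m b = (1 + (1 - b) * m b)^-1.
  rewrite -[X in X + _](divff vn) /corner_recip mulrA -mulrDl -[RHS]mul1r.
  by congr (_ * _); lra.
by rewrite /corner_recip invrK -[X in X * _]mulNr opprK divfK.
Qed.

Lemma corner_recip_cornerK m p : corner_valid m -> in_square p ->
  corner m (corner (corner_recip m) p) = p.
Proof.
move=> vm pin; rewrite -{2}(cornerK (corner_recip_valid vm) pin).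
by rewrite /corner !min_corner corner_recipK.
Qed.

Lemma corner_in m p : corner_valid m -> in_square p -> in_square (corner m p).
Proof.
move=> vm /square_corner[b01 aw]; rewrite /corner /in_square /=.
have := corner_shift_itv aw (vm _); set b := Num.min p.1 p.2 in b01 *.
set a := corner_shift _ _ _ => /andP[a1 a2]; move: b01 => /andP[b0 b1].
have h1 : 0 <= Num.max 0 a <= 1 - b by rewrite le_max lexx ge_max a2 /=; lra.
have h2 : 0 <= Num.max 0 (- a) <= 1 - b by rewrite le_max lexx ge_max /=; apply/andP; split; lra.
by apply/andP; split; apply/andP; split; lra.
Qed.

Definition on_boundary p := [|| p.1 == 0, p.1 == 1, p.2 == 0 | p.2 == 1].

(** The left and bottom sides form the level b = 0, and levels are preserved. The other two sides
    consist of the ends of the levels, which the Moebius maps fix. *)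
Lemma on_boundary_corner m p : corner_valid m -> in_square p -> on_boundary p ->
  on_boundary (corner m p).
Proof.
move=> vm pin; have [b01 aw] := square_corner pin; have v := vm (Num.min p.1 p.2).
have [b0|b0] := eqVneq (Num.min p.1 p.2) 0.
  have : Num.min (corner m p).1 (corner m p).2 = 0 by rewrite min_corner.
  by case: leP => _ e _; rewrite /on_boundary e eqxx ?orbT.
move=> bp; have : p.1 - p.2 = 1 - Num.min p.1 p.2 \/ p.1 - p.2 = - (1 - Num.min p.1 p.2).
  move: bp pin b0; case: (p) => x y /=; rewrite /on_boundary /in_square /=.
  move=> bp /andP[/andP[x0 x1] /andP[y0 y1]].
  have [xy|xy] := leP x y => /eqP b0; [right|left]; case/or4P: bp => /eqP e;
    first [lra | by exfalso; apply: b0; lra].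
rewrite /corner /on_boundary; set b := Num.min p.1 p.2 in b01 v *.
move: b01 => /andP[b_ge0 b_le1]; have wn := lt0r_neq0 v.
move=> [] ->.
  rewrite /corner_shift subrr mulr0 mul0r subr0 addr0 mulrAC divff ?pnatr_eq0// mul1r.
  have -> : Num.max 0 (1 - b) = 1 - b by rewrite max_r//; lra.
  by rewrite addrC subrK eqxx orbT.
have -> : corner_shift (m b) (1 - b) (- (1 - b)) = - (1 - b).
  rewrite /corner_shift.
  have -> : 2 + (1 - b - - (1 - b)) * m b = 2 * (1 + (1 - b) * m b) by lra.
  apply: (mulIf (x := 2 * (1 + (1 - b) * m b))); first by rewrite mulf_neq0// pnatr_eq0.
  by rewrite divfK ?mulf_neq0 ?pnatr_eq0//; lra.
rewrite opprK.
have -> : Num.max 0 (1 - b) = 1 - b by rewrite max_r//; lra.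
by rewrite [b + (1 - b)]addrC subrK eqxx !orbT.
Qed.

End CornerMap.

Section EuclideanRealization.
Variable R : realType.
Local Notation I := (unit_interval R).
Local Notation U := (euclidean_square R).
Implicit Types (D : set U) (h d : homeo U).

Lemma corner_continuous (m : R -> R) (p : R * R) : continuous m ->
  corner_valid m -> in_square p -> {for p, continuous (corner m)}.
Proof.
move=> cm vm pin; have [b01 aw] := square_corner pin.
have cb : {for p, continuous (fun q : R * R => Num.min q.1 q.2)}.
  exact: continuous_min (@fst_continuous R p) (@snd_continuous R p).
have ca : {for p, continuous (fun q : R * R => q.1 - q.2)}.
  by apply: cvgB; [exact: fst_continuous|exact: snd_continuous].
have cmb : {for p, continuous (fun q : R * R => m (Num.min q.1 q.2))}.
  by apply: continuous_comp => //; exact: cm.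
have cw : {for p, continuous (fun q : R * R => 1 - Num.min q.1 q.2)}.
  by apply: cvgB => //; exact: cvg_cst.
have cwa : {for p, continuous (fun q : R * R => 1 - Num.min q.1 q.2 - (q.1 - q.2))}.
  exact: cvgB.
pose g (q : R * R) := corner_shift (m (Num.min q.1 q.2)) (1 - Num.min q.1 q.2) (q.1 - q.2).
have cs : {for p, continuous g}.
  apply: cvgM.
    apply: cvgB; first by apply: cvgM => //; exact: cvg_cst.
    by apply: cvgM => //; exact: cvgM.
  apply: cvgV; first by apply: lt0r_neq0; exact: corner_shift_den.
  by apply: cvgD; [exact: cvg_cst|exact: cvgM].
have c0 : {for p, continuous (fun _ : R * R => 0 : R)} by exact: cvg_cst.
have c1 : {for p, continuous (fun q : R * R => Num.max 0 (g q))} by exact: continuous_max.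
have c2 : {for p, continuous (fun q : R * R => Num.max 0 (- g q))}.
  by apply: continuous_max => //; exact: cvgN.
by apply: continuous_pair; exact: cvgD.
Qed.

(** Zero from 1/8 on, so that both the twist and the shears with this weight fix the central
    square. *)
Definition corner_weight (b : R) := Num.max 0 (1 / 8 - b).

Lemma corner_weight_valid : corner_valid corner_weight.
Proof.
move=> b; rewrite /corner_weight; have [h|h] := leP 0 (1 / 8 - b); last first.
  by rewrite mulr0 addr0.
have b1 : 0 <= 1 - b by lra.
by have := mulr_ge0 b1 h; lra.
Qed.

Lemma corner_weight_continuous : continuous corner_weight.
Proof.
move=> b; have c0 : {for b, continuous (fun _ : R => 0 : R)} by exact: cvg_cst.
have c1 : {for b, continuous (fun x : R => 1 / 8 - x)}.
  by apply: cvgB; [exact: cvg_cst|exact: cvg_id].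
exact: continuous_max c0 c1.
Qed.

Lemma corner_recip_weight_continuous : continuous (corner_recip corner_weight).
Proof.
move=> b; apply: cvgM; first by apply: cvgN; exact: corner_weight_continuous.
apply: cvgV; first by apply: lt0r_neq0; exact: corner_weight_valid.
apply: cvgD; first exact: cvg_cst.
apply: cvgM; last exact: corner_weight_continuous.
by apply: cvgB; [exact: cvg_cst|exact: cvg_id].
Qed.

Program Definition corner_homeo : homeo U :=
  @plane_homeo R (corner corner_weight) (corner (corner_recip corner_weight)) _ _ _ _ _ _.
Next Obligation. by move=> p; apply: corner_in; exact: corner_weight_valid. Qed.
Next Obligation.
by move=> p; apply: corner_in; apply: corner_recip_valid; exact: corner_weight_valid.
Qed.
Next Obligation. by move=> p; apply: cornerK; exact: corner_weight_valid. Qed.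
Next Obligation. by move=> p; apply: corner_recip_cornerK; exact: corner_weight_valid. Qed.
Next Obligation.
by move=> p; apply: corner_continuous; [exact: corner_weight_continuous|exact: corner_weight_valid].
Qed.
Next Obligation.
move=> p; apply: corner_continuous; first exact: corner_recip_weight_continuous.
by apply: corner_recip_valid; exact: corner_weight_valid.
Qed.

Program Definition swap_homeo : homeo U :=
  @plane_homeo R (fun p => (p.2, p.1)) (fun p => (p.2, p.1)) _ _ _ _ _ _.
Next Obligation. by move=> p; rewrite /in_square /= andbC. Qed.
Next Obligation. by move=> p; rewrite /in_square /= andbC. Qed.
Next Obligation. by move=> []. Qed.
Next Obligation. by move=> []. Qed.
Next Obligation.
by move=> p _; apply: continuous_pair; [exact: snd_continuous|exact: fst_continuous].
Qed.
Next Obligation.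
by move=> p _; apply: continuous_pair; [exact: snd_continuous|exact: fst_continuous].
Qed.

Let flip_in (p : R * R) : in_square p -> in_square (1 - p.1, p.2).
Proof. by rewrite /in_square /= => /andP[? ->]; rewrite andbT; lra. Qed.

Let flipK (p : R * R) : (1 - (1 - p.1), p.2) = p.
Proof. by case: p => x y /=; congr pair; lra. Qed.

Let flip_continuous (p : R * R) : {for p, continuous (fun p : R * R => (1 - p.1, p.2))}.
Proof.
apply: continuous_pair; last exact: snd_continuous.
by apply: cvgB; [exact: cvg_cst|exact: fst_continuous].
Qed.

Program Definition flip_homeo : homeo U :=
  @plane_homeo R (fun p => (1 - p.1, p.2)) (fun p => (1 - p.1, p.2)) _ _ _ _ _ _.
Next Obligation. by move=> p; exact: flip_in. Qed.
Next Obligation. by move=> p; exact: flip_in. Qed.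
Next Obligation. by move=> p _; exact: flipK. Qed.
Next Obligation. by move=> p _; exact: flipK. Qed.
Next Obligation. by move=> p _; exact: flip_continuous. Qed.
Next Obligation. by move=> p _; exact: flip_continuous. Qed.

Definition plane_point (x y : R) : U := square_point (x, y).

Lemma plane_pointE x y : 0 <= x <= 1 -> 0 <= y <= 1 -> coords (plane_point x y) = (x, y).
Proof. by move=> x01 y01; rewrite square_pointK// /in_square x01. Qed.

Lemma plane_point_coords (p : U) : plane_point (coords p).1 (coords p).2 = p.
Proof. by rewrite /plane_point -surjective_pairing coordsK. Qed.

Lemma coords_inj : injective (@coords R).
Proof. exact: can_inj (@coordsK R). Qed.

Lemma swap_homeo_point x y : 0 <= x <= 1 -> 0 <= y <= 1 ->
  swap_homeo (plane_point x y) = plane_point y x.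
Proof. by move=> x01 y01; apply: coords_inj; rewrite plane_homeoE !plane_pointE. Qed.

Lemma flip_homeo_point x y : 0 <= x <= 1 -> 0 <= y <= 1 ->
  flip_homeo (plane_point x y) = plane_point (1 - x) y.
Proof.
move=> x01 y01; apply: coords_inj; rewrite plane_homeoE !plane_pointE//.
by lra.
Qed.

Definition boundary (p : U) := on_boundary (coords p).

Definition central (p : U) := (1 / 8 <= (coords p).1 <= 7 / 8) && (1 / 8 <= (coords p).2 <= 7 / 8).

(** All marked points lie in the central square, so these maps belong to the colour stabilizer for
    every k, and the boundary is treated once for all k. *)
Definition central_homeo h :=
  (forall p, boundary (h p) = boundary p) /\ (forall p, central p -> h p = p).

Lemma corner_homeo_central : central_homeo corner_homeo.
Proof.
have cE p : coords (corner_homeo p) = corner corner_weight (coords p) by exact: plane_homeoE.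
split => [p|p /andP[/andP[x1 x2] /andP[y1 y2]]].
  rewrite /boundary cE; apply/idP/idP; last first.
    by apply: on_boundary_corner; [exact: corner_weight_valid|exact: coords_in_square].
  move=> /(on_boundary_corner (corner_recip_valid corner_weight_valid)).
  rewrite cornerK//; [|exact: corner_weight_valid|exact: coords_in_square].
  by apply; apply: corner_in; [exact: corner_weight_valid|exact: coords_in_square].
apply: coords_inj; rewrite cE -[RHS]corner_rebuild /corner.
have -> : corner_weight (Num.min (coords p).1 (coords p).2) = 0.
  rewrite /corner_weight max_l// subr_le0 le_min x1 y1//.
by rewrite /corner_shift !mul0r subr0 mulr0 addr0 mulrAC divff ?pnatr_eq0// mul1r.
Qed.

Lemma central_conj d h : (forall p, boundary (d p) = boundary p) ->
  (forall p, central (homeo_inv d p) = central p) -> central_homeo h ->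
  central_homeo (homeo_mul d (homeo_mul h (homeo_recip d))).
Proof.
move=> bd cd [bh ch]; split => [p|p cp] /=.
  by rewrite bd bh -[LHS](bd) homeo_invK.
by rewrite ch ?cd// homeo_invK.
Qed.

Definition central_stable D := forall h p, central_homeo h -> D p -> D (h p).

(** A symmetry may move marked points, so it is never applied within the group; it only conjugates
    central homeomorphisms and carries results from one side to another. *)
Definition symmetry d := (forall p, boundary (d p) = boundary p) /\
  (forall p, central (homeo_inv d p) = central p).

Lemma central_stable_preimage d D : symmetry d -> central_stable D -> central_stable (d @^-1` D).
Proof.
move=> [bd cd] Dst h p ch Dp.
have := Dst _ (d p) (central_conj bd cd ch) Dp.
by rewrite /= homeo_funK.
Qed.

Lemma symmetry_mul d d' : symmetry d -> symmetry d' -> symmetry (homeo_mul d d').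
Proof.
move=> [bd cd] [bd' cd']; split => p /=; first by rewrite bd bd'.
by rewrite cd' cd.
Qed.

Lemma symmetry_swap : symmetry swap_homeo.
Proof.
have cE p : coords (swap_homeo p) = ((coords p).2, (coords p).1) by exact: plane_homeoE.
split => p; first by rewrite /boundary cE /on_boundary /=; do 4!case: (_ == _).
rewrite /central -[homeo_inv _ _]/(swap_homeo p) cE /=.
by rewrite andbC.
Qed.

Lemma symmetry_flip : symmetry flip_homeo.
Proof.
have cE p : coords (flip_homeo p) = (1 - (coords p).1, (coords p).2) by exact: plane_homeoE.
split => p.
  rewrite /boundary cE /on_boundary /= subr_eq0 eq_sym.
  have -> : (1 - (coords p).1 == 1) = ((coords p).1 == 0).
    by apply/eqP/eqP; lra.
  by rewrite orbCA.
rewrite /central -[homeo_inv _ _]/(flip_homeo p) cE.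
move: (coords p).1 (coords p).2 => x y /=; congr (_ && _).
by apply/idP/idP => /andP[? ?]; apply/andP; split; lra.
Qed.

Lemma expR_shear_continuous (w : R -> R) (a : R) : continuous w ->
  continuous (fun x => expR (a * w x)).
Proof.
move=> cw x; apply: (@continuous_comp _ _ _ (fun x => a * w x) (@expR R)).
  by apply: cvgM; [exact: cvg_cst|exact: cw].
exact: continuous_expR.
Qed.

Lemma moebius_eq0 (s y : R) : 0 < s -> 0 <= y <= 1 -> (moebius s y == 0) = (y == 0).
Proof.
move=> s0 y01; apply/eqP/eqP => [e|->]; last exact: moebius_0.
by rewrite -(moebiusK s0 y01) e moebius_0.
Qed.

Lemma moebius_eq1 (s y : R) : 0 < s -> 0 <= y <= 1 -> (moebius s y == 1) = (y == 1).
Proof.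
move=> s0 y01; apply/eqP/eqP => [e|->]; last exact: moebius_1.
by rewrite -(moebiusK s0 y01) e moebius_1.
Qed.

(** The exponential keeps the parameter positive, and vertical lines where w vanishes are fixed
    pointwise. *)
Definition weighted_shear (w : R -> R) (cw : continuous w) (a : R) : homeo U :=
  shear_homeo (s := fun x => expR (a * w x)) (fun=> expR_gt0 _)
    (expR_shear_continuous (a := a) cw).

Lemma weighted_shearE w (cw : continuous w) a p : coords (weighted_shear cw a p) =
  ((coords p).1, moebius (expR (a * w (coords p).1)) (coords p).2).
Proof. exact: shear_homeoE. Qed.

Lemma weighted_shear_boundary w (cw : continuous w) a p :
  boundary (weighted_shear cw a p) = boundary p.
Proof.
have /andP[_ y01] := coords_in_square p.
by rewrite /boundary weighted_shearE /on_boundary moebius_eq0 ?expR_gt0// moebius_eq1 ?expR_gt0.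
Qed.

Lemma weighted_shear_fixed w (cw : continuous w) a p :
  w (coords p).1 = 0 -> weighted_shear cw a p = p.
Proof.
move=> w0; apply: coords_inj.
by rewrite weighted_shearE w0 mulr0 expR0 moebius1 -surjective_pairing.
Qed.

Lemma weighted_shear_transitive w (cw : continuous w) (x y z : R) :
  w x != 0 -> 0 <= x <= 1 -> 0 < y < 1 -> 0 < z < 1 ->
  exists a, weighted_shear cw a (plane_point x y) = plane_point x z.
Proof.
move=> wx x01 y01 z01; have [s s0 sE] := moebius_transitive y01 z01.
have y01' : 0 <= y <= 1 by case/andP: y01 => /ltW-> /ltW->.
have z01' : 0 <= z <= 1 by case/andP: z01 => /ltW-> /ltW->.
exists (ln s / w x); apply: coords_inj.
by rewrite weighted_shearE !plane_pointE//= divfK// lnK ?posrE// sE.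
Qed.

(** Shears are transitive on the open side and closedness adds its ends. If only a corner is given,
    the twist first moves it into the open side. *)
Lemma stable_left_side D y : closed D -> central_stable D -> 0 <= y <= 1 ->
  D (plane_point 0 y) -> forall t, 0 <= t <= 1 -> D (plane_point 0 t).
Proof.
have i0 : 0 <= (0 : R) <= 1 by rewrite lexx ler01.
have i1 : 0 <= (1 : R) <= 1 by rewrite lexx ler01.
have inner E z : closed E -> central_stable E -> 0 < z < 1 -> E (plane_point 0 z) ->
    forall t, 0 <= t <= 1 -> E (plane_point 0 t).
  move=> cE Est z01 Ez t t01; have w0 : corner_weight 0 != 0.
    by rewrite /corner_weight subr0 max_r ?divr_ge0// gt_eqF// divr_gt0.
  have open_side u : 0 < u < 1 -> E (plane_point 0 u).
    move=> u01.
    have [a <-] := weighted_shear_transitive corner_weight_continuous w0 i0 z01 u01.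
    apply: Est => //; split => [q|q /andP[/andP[q0 _] _]].
      exact: weighted_shear_boundary.
    apply: weighted_shear_fixed; rewrite /corner_weight max_l// subr_le0//.
  pose side (u : R) := plane_point 0 u.
  have cside : continuous side.
    move=> u; apply: (@continuous_comp _ _ _ (fun u : R => (0, u) : R * R) (@square_point R)).
      by apply: continuous_pair; [exact: cvg_cst|exact: cvg_id].
    exact: square_point_continuous.
  apply: contrapT => nE; have : nbhs t (~` (side @^-1` E)).
    apply: open_nbhs_nbhs; split => //; apply: closed_openC.
    by apply: closed_comp => // ? _; exact: cside.
  move=> /nbhs_ballP[e' e'0 e'E].
  have [e [e0 eE]] : exists e : R, 0 < e /\ forall u : R, `|t - u| < e -> ~ E (side u).
    by exists e'.
  (* Pulling t towards 1/2 by the fraction d gives a point of the open side at distance at most d /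
     2 < e. *)
  pose d := Num.min e 1; have d0 : 0 < d by rewrite lt_min e0 ltr01.
  have de : d <= e by rewrite ge_min lexx.
  have d1 : d <= 1 by rewrite ge_min lexx orbT.
  move: t01 => /andP[t0 t1]; apply: (eE ((1 - d) * t + d / 2)).
    by rewrite ltr_norml; apply/andP; split; nra.
  by apply: open_side; apply/andP; split; nra.
have corner E : closed E -> central_stable E -> E (plane_point 0 0) ->
    forall t, 0 <= t <= 1 -> E (plane_point 0 t).
  (* At the corner b = 0, w = 1, a = 0 and k = 1/8, so the twist gives a = -(1/8) / (17/8) = -1/17,
     that is, the point (0, 1/17). *)
  move=> cE Est E0; apply: (inner E (1 / 17)) => //; first by apply/andP; split; lra.
  have -> : plane_point 0 (1 / 17) = corner_homeo (plane_point 0 0).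
    apply: coords_inj; rewrite plane_homeoE !plane_pointE//; last by apply/andP; split; lra.
    rewrite /corner /= minxx subr0 subrr /corner_weight subr0 /corner_shift.
    rewrite (max_r (_ : 0 <= 1 / 8)); last by lra.
    have -> : (2 * 0 - 1 / 8 * 1 * (1 - 0)) / (2 + (1 - 0) * (1 / 8)) = - (1 / 17) :> R.
      by apply: (mulIf (x := 2 + (1 - 0) * (1 / 8))); [lra|rewrite divfK; lra].
    rewrite max_l; last by lra. rewrite max_r; last by lra.
    by congr pair; lra.
  by apply: Est => //; exact: corner_homeo_central.
move=> cD Dst y01 Dy; have [y0|y0] := eqVneq y 0.
  by apply: corner => //; move: Dy; rewrite y0.
have [y1|y1] := eqVneq y 1; last first.
  by apply: (inner _ y) => //; rewrite !lt_neqAle eq_sym y0 y1.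
(* The reflection y |-> 1 - y, which takes the corner (0, 1) to (0, 0). *)
pose d := homeo_mul swap_homeo (homeo_mul flip_homeo swap_homeo).
have dE u : 0 <= u <= 1 -> d (plane_point 0 u) = plane_point 0 (1 - u).
  move=> u01; have u01' : 0 <= 1 - u <= 1 by lra.
  rewrite -[LHS]/(swap_homeo (flip_homeo (swap_homeo (plane_point 0 u)))).
  by rewrite swap_homeo_point// flip_homeo_point// swap_homeo_point.
have sd : symmetry d.
  exact: symmetry_mul symmetry_swap (symmetry_mul symmetry_flip symmetry_swap).
move=> t t01; have t01' : 0 <= 1 - t <= 1 by lra.
have : (d @^-1` D) (plane_point 0 (1 - t)).
  apply: corner => //.
  - by apply: closed_comp => // ? _; exact: homeo_fun_continuous.
  - exact: central_stable_preimage.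
  - by rewrite /preimage /mkset dE// subr0 -y1.
by rewrite /preimage /mkset dE// subKr.
Qed.

(* Adjacent sides share a corner, so a central-stable closed set that meets
   the boundary propagates all around it. *)
Lemma stable_boundary D p q : closed D -> central_stable D ->
  boundary p -> D p -> boundary q -> D q.
Proof.
move=> cD Dst.
pose top := homeo_mul swap_homeo flip_homeo.
pose on (d : homeo U) (u : U) := exists2 t, 0 <= t <= 1 & u = d (plane_point 0 t).
have i0 : 0 <= (0 : R) <= 1 by rewrite lexx ler01.
have i1 : 0 <= (1 : R) <= 1 by rewrite lexx ler01.
have side d u v : symmetry d -> on d u -> on d v -> D u -> D v.
  move=> sd [t t01 ->] [t' t'01 ->] Du.
  apply: (@stable_left_side (d @^-1` D) t) => //.
  - by apply: closed_comp => // ? _; exact: homeo_fun_continuous.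
  - exact: central_stable_preimage.
have onL t : 0 <= t <= 1 -> on (homeo_one U) (plane_point 0 t) by exists t.
have onB t : 0 <= t <= 1 -> on swap_homeo (plane_point t 0).
  by move=> t01; exists t => //; rewrite swap_homeo_point.
have onR t : 0 <= t <= 1 -> on flip_homeo (plane_point 1 t).
  by move=> t01; exists t => //; rewrite flip_homeo_point// subr0.
have onT t : 0 <= t <= 1 -> on top (plane_point t 1).
  move=> t01; exists t => //; rewrite -[RHS]/(swap_homeo (flip_homeo (plane_point 0 t))).
  by rewrite flip_homeo_point// subr0 swap_homeo_point.
have sone : symmetry (homeo_one U) by [].
have sL u v := side _ u v sone.
have sB u v := side _ u v symmetry_swap.
have sR u v := side _ u v symmetry_flip.
have sT u v := side _ u v (symmetry_mul symmetry_swap symmetry_flip).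
have cases u : boundary u -> [\/ on (homeo_one U) u, on flip_homeo u, on swap_homeo u | on top u].
  have /andP[x01 y01] := coords_in_square u.
  rewrite -{2 3 4 5}(plane_point_coords u) /boundary /on_boundary.
  by case/or4P => /eqP ->; [constructor 1|constructor 2|constructor 3|constructor 4];
    [exact: onL|exact: onR|exact: onB|exact: onT].
move=> bp Dp bq.
have D00 : D (plane_point 0 0).
  have [pL|pR|pB|pT] := cases p bp.
  - exact: (sL _ _ pL (onL _ i0) Dp).
  - exact: (sB _ _ (onB _ i1) (onB _ i0) (sR _ _ pR (onR _ i0) Dp)).
  - exact: (sB _ _ pB (onB _ i0) Dp).
  - exact: (sL _ _ (onL _ i1) (onL _ i0) (sT _ _ pT (onT _ i0) Dp)).
have [qL|qR|qB|qT] := cases q bq.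
- exact: (sL _ _ (onL _ i0) qL D00).
- exact: (sR _ _ (onR _ i0) qR (sB _ _ (onB _ i0) (onB _ i1) D00)).
- exact: (sB _ _ (onB _ i0) qB D00).
- exact: (sT _ _ (onT _ i0) qT (sL _ _ (onL _ i0) (onL _ i1) D00)).
Qed.

End EuclideanRealization.

(** * Heights realized by fixing marked points *)

Section EuclideanHeight.
Variables (R : realType) (k : nat).
Local Notation U := (euclidean_square R).

(** Infinitely many distinct values in (1/4, 1/2]: within the central square for every k, and away
    from the abscissa 3/4 used as a base. *)
Definition mark (i : nat) : R := 1 / 4 + 1 / 4 / i.+1%:R.

Lemma mark_inj : injective mark.
Proof.
move=> i j /addrI; have q : (1 / 4 : R) != 0 by rewrite lt0r_neq0// divr_gt0.
by move=> /(mulfI q)/invr_inj/eqP; rewrite eqr_nat => /eqP[].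
Qed.

Lemma mark_bounds i : 1 / 4 < mark i <= 1 / 2.
Proof.
have i0 : 0 < i.+1%:R^-1 :> R by rewrite invr_gt0.
have i1 : i.+1%:R^-1 <= 1 :> R by rewrite invf_le1 ?ler1n.
rewrite /mark; move: i.+1%:R^-1 i0 i1 => v v0 v1.
by apply/andP; split; lra.
Qed.

Definition marked_point (i : nat) : U := plane_point (mark i) (1 / 2).

Lemma marked_pointE i : coords (marked_point i) = (mark i, 1 / 2).
Proof.
have /andP[m0 m1] := mark_bounds i.
by rewrite plane_pointE//; apply/andP; split; lra.
Qed.

Lemma marked_point_central i : central (marked_point i).
Proof.
have /andP[m0 m1] := mark_bounds i; rewrite /central marked_pointE /=.
by apply/andP; split; apply/andP; split; lra.
Qed.

Lemma marked_point_not_boundary i : boundary (marked_point i) = false.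
Proof.
have /andP[m0 m1] := mark_bounds i; rewrite /boundary marked_pointE /on_boundary /=.
by apply/negbTE; rewrite !negb_or; apply/and4P; split; apply/eqP; lra.
Qed.

Lemma marked_point_inj : injective marked_point.
Proof. by move=> i j /(congr1 (@coords R)); rewrite !marked_pointE => -[/mark_inj]. Qed.

(** [index] returns k when the abscissa is none of the first k marks, hence the test j < k. The
    boundary lies above the marked points and below the generic interior, which gives lower
    semicontinuity. *)
Definition euclidean_color (p : U) : nat :=
  let j := index (coords p).1 (mkseq mark k) in
  if boundary p then k else if ((coords p).2 == 1 / 2) && (j < k)%N then j else k.+1.
Local Notation c := euclidean_color.

Lemma color_marked_point i : (i < k)%N -> c (marked_point i) = i.
Proof.
move=> ik; rewrite /c marked_point_not_boundary marked_pointE eqxx /=.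
have -> : index (mark i) (mkseq mark k) = i.
  rewrite -{1}(nth_mkseq 0 mark ik) index_uniq ?size_mkseq//.
  by rewrite /mkseq map_inj_uniq ?iota_uniq//; exact: mark_inj.
by rewrite ik.
Qed.

Lemma color_cases p : [\/ boundary p /\ c p = k,
   exists2 i, (i < k)%N & p = marked_point i
 | [/\ ~~ boundary p, c p = k.+1 & forall i, (i < k)%N -> p <> marked_point i]].
Proof.
have [bp|bp] := boolP (boundary p); first by constructor 1; rewrite /c bp.
have [[i ik ->]|nm] := pselect (exists2 i, (i < k)%N & p = marked_point i).
  by constructor 2; exists i.
constructor 3; split => //; last by move=> i ik pE; apply: nm; exists i.
rewrite /c (negbTE bp); case: ifP => // /andP[/eqP y jk]; exfalso; apply: nm.
exists (index (coords p).1 (mkseq mark k)) => //; apply: coords_inj.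
rewrite marked_pointE -y -(nth_mkseq 0 mark jk) nth_index -?surjective_pairing//.
by rewrite -index_mem size_mkseq.
Qed.

Lemma euclidean_color_le p : (c p <= k.+1)%N.
Proof.
have [[_ ->]|[i ik ->]|[_ -> _]] := color_cases p; [exact: leqnSn| |exact: leqnn].
by rewrite color_marked_point// ltnW// ltnW.
Qed.

Lemma euclidean_color_surj i : (i <= k.+1)%N -> exists p, c p = i.
Proof.
rewrite leq_eqVlt => /orP[/eqP ->|].
  exists (plane_point (3 / 4) (1 / 4)).
  have E : coords (plane_point (3 / 4) (1 / 4)) = (3 / 4, 1 / 4) :> R * R.
    by rewrite plane_pointE//; apply/andP; split; lra.
  have [[+ _]|[j _ /(congr1 (@coords R))]|[_ -> _]//] := color_cases (plane_point (3 / 4) (1 / 4)).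
    by rewrite /boundary E /on_boundary /= => /or4P[] /eqP h; exfalso; clear E; lra.
  by rewrite E marked_pointE => -[_ h]; exfalso; clear E; lra.
rewrite ltnS leq_eqVlt => /orP[/eqP ->|ik].
  exists (plane_point 0 0); rewrite /c ifT// /boundary plane_pointE ?lexx ?ler01//.
  by rewrite /on_boundary /= eqxx.
by exists (marked_point i); exact: color_marked_point.
Qed.

Lemma near_coords_neq (p : U) (z : R * R) : coords p != z -> \forall q \near p, coords q != z.
Proof.
move=> pz; have : nbhs (coords p) [set w : R * R | w != z].
  apply: open_nbhs_nbhs; split => //.
  have -> : [set w : R * R | w != z] = ~` [set z].
    by apply/seteqP; split => w /=; [move/eqP|move/eqP].
  apply: closed_openC; apply: accessible_closed_set1.
  exact/hausdorff_accessible/norm_hausdorff.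
exact: coords_continuous.
Qed.

Lemma near_not_boundary (p : U) : ~~ boundary p -> \forall q \near p, ~~ boundary q.
Proof.
have near1 (f : R * R -> R) (a : R) : continuous f -> f (coords p) != a ->
    \forall q \near p, f (coords q) != a.
  move=> cf fa; have : nbhs (f (coords p)) [set t | t != a].
    by apply: open_nbhs_nbhs; split => //; exact: open_neq.
  by move=> /(cf (coords p)); exact: coords_continuous.
rewrite /boundary /on_boundary !negb_or => /and4P[h1 h2 h3 h4].
have n1 := near1 _ _ (@fst_continuous R) h1; have n2 := near1 _ _ (@fst_continuous R) h2.
have n3 := near1 _ _ (@snd_continuous R) h3; have n4 := near1 _ _ (@snd_continuous R) h4.
by near=> q; rewrite !negb_or; apply/and4P; split; near: q.
Unshelve. all: by end_near. Qed.

Lemma near_not_marked (p : U) (m : nat) :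
  \forall q \near p, forall i, (i < m)%N -> q = marked_point i -> q = p.
Proof.
elim: m => [|m IH]; first by near=> q.
have [pE|pm] := eqVneq p (marked_point m).
  near=> q => i; rewrite ltnS leq_eqVlt => /orP[/eqP -> ->//|].
  by move: i; near: q.
have nm : \forall q \near p, coords q != coords (marked_point m).
  by apply: near_coords_neq; rewrite (inj_eq (@coords_inj R)).
near=> q => i; rewrite ltnS leq_eqVlt => /orP[/eqP -> qE|].
  have : coords q != coords (marked_point m) by near: q.
  by rewrite qE eqxx.
by move: i; near: q.
Unshelve. all: by end_near. Qed.

Lemma euclidean_color_lsc p : \forall q \near p, (c p <= c q)%N.
Proof.
have nm := near_not_marked p k.
have [bp|bp] := boolP (boundary p).
  near=> q; have [[_ ->]|[i ik qE]|[_ -> _]] := color_cases q.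
  - by rewrite /c bp.
  - have H : forall i, (i < k)%N -> q = marked_point i -> q = p by near: q.
    by rewrite (H i ik qE).
  - exact: euclidean_color_le.
have nb := near_not_boundary bp; near=> q.
have [[bq _]|[i ik qE]|[_ -> _]] := color_cases q.
- have nq : ~~ boundary q by near: q.
  by rewrite bq in nq.
- have H : forall i, (i < k)%N -> q = marked_point i -> q = p by near: q.
  by rewrite (H i ik qE).
- exact: euclidean_color_le.
Unshelve. all: by end_near. Qed.

Lemma color_stabilizer_fixing (h : homeo U) :
  (forall p, boundary (h p) = boundary p) ->
  (forall i, (i < k)%N -> h (marked_point i) = marked_point i) ->
  h \in color_stabilizer c.
Proof.
move=> bh fh; apply/color_stabilizerP => p.
have [[bp ->]|[i ik ->]|[bp -> nm]] := color_cases p.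
- by rewrite /c bh bp.
- by rewrite fh.
have [[bq _]|[i ik qE]|[_ -> _]//] := color_cases (h p).
  by rewrite -bh bq in bp.
case: (nm i ik); apply: (can_inj (homeo_funK h)); by rewrite qE fh.
Qed.

(** A continuous weight with zeros exactly at the marks, so that vertical shears fix the marked
    points and move all other interior columns. *)
Definition mark_weight (m : nat) (x : R) : R := \prod_(i < m) (x - mark i) ^+ 2.

Lemma mark_weight_continuous m : continuous (mark_weight m).
Proof.
move=> x; rewrite /mark_weight; elim: m => [|m IH].
  rewrite (_ : (fun x => _) = fun=> 1); first exact: cvg_cst.
  by apply/funext => y; rewrite big_ord0.
rewrite (_ : (fun x => _) = fun y => \prod_(i < m) (y - mark i) ^+ 2 * (y - mark m) ^+ 2).
  have cm : {for x, continuous (fun y : R => y - mark m)}.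
    by apply: cvgB; [exact: cvg_id|exact: cvg_cst].
  by apply: cvgM; [exact: IH|apply: cvgM].
by apply/funext => y; rewrite big_ord_recr.
Qed.

Lemma mark_weight_eq0 m i : (i < m)%N -> mark_weight m (mark i) = 0.
Proof.
by move=> im; rewrite /mark_weight (bigD1 (Ordinal im))//= subrr expr0n mul0r.
Qed.

Lemma mark_weight_neq0 m x : (forall i, (i < m)%N -> x <> mark i) -> mark_weight m x != 0.
Proof.
move=> xm; rewrite /mark_weight; apply/prodf_neq0 => i _.
by rewrite expf_neq0// subr_eq0; apply/eqP; exact: xm.
Qed.

(** Zero exactly on the line y = 1/2 of the marked points, for shears in the horizontal
    direction. *)
Definition height_weight (y : R) : R := (y - 1 / 2) ^+ 2.

Lemma height_weight_continuous : continuous height_weight.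
Proof.
move=> y; have cm : {for y, continuous (fun z : R => z - 1 / 2)}.
  by apply: cvgB; [exact: cvg_id|exact: cvg_cst].
exact: cvgM.
Qed.

Local Notation "p ~~> q" := (same_orbit c p q) (at level 70).

Lemma vertical_orbit x y z : (forall i, (i < k)%N -> x <> mark i) ->
  0 <= x <= 1 -> 0 < y < 1 -> 0 < z < 1 -> plane_point x y ~~> plane_point x z.
Proof.
move=> xm x01 y01 z01.
have [a <-] := weighted_shear_transitive (mark_weight_continuous (m := k))
  (mark_weight_neq0 xm) x01 y01 z01.
exists (weighted_shear (mark_weight_continuous (m := k)) a) => //.
apply: color_stabilizer_fixing => [p|i ik]; first exact: weighted_shear_boundary.
by apply: weighted_shear_fixed; rewrite marked_pointE mark_weight_eq0.
Qed.

Lemma horizontal_orbit x y z : y != 1 / 2 ->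
  0 < x < 1 -> 0 < z < 1 -> 0 <= y <= 1 -> plane_point x y ~~> plane_point z y.
Proof.
move=> y2 x01 z01 y01; have w0 : height_weight y != 0.
  by rewrite /height_weight expf_neq0// subr_eq0.
have [a aE] := weighted_shear_transitive height_weight_continuous w0 y01 x01 z01.
have x01' : 0 <= x <= 1 by case/andP: x01 => /ltW-> /ltW->.
have z01' : 0 <= z <= 1 by case/andP: z01 => /ltW-> /ltW->.
pose h := homeo_mul (swap_homeo R)
  (homeo_mul (weighted_shear height_weight_continuous a) (swap_homeo R)).
have hE p : h p = swap_homeo R (weighted_shear height_weight_continuous a (swap_homeo R p)) by [].
exists h; last by rewrite hE swap_homeo_point// aE swap_homeo_point.
have [bs _] := symmetry_swap R.
apply: color_stabilizer_fixing => [p|i ik].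
  by rewrite hE bs weighted_shear_boundary bs.
have /andP[m0 m1] := mark_bounds i.
rewrite hE /marked_point swap_homeo_point; [|by apply/andP; split; lra..].
rewrite weighted_shear_fixed.
  by rewrite swap_homeo_point//; apply/andP; split; lra.
by rewrite plane_pointE ?/height_weight ?subrr ?expr0n//; apply/andP; split; lra.
Qed.

(** Off the line y = 1/2 one moves horizontally to x = 3/4, which is no mark, then vertically. An
    unmarked point on that line has an unmarked abscissa and first leaves the line vertically. *)
Lemma generic_orbit p : ~~ boundary p -> (forall i, (i < k)%N -> p <> marked_point i) ->
  p ~~> plane_point (3 / 4) (1 / 4).
Proof.
move=> bp nm; rewrite -(plane_point_coords p).
have /andP[/andP[x0 x1] /andP[y0 y1]] := coords_in_square p.
move: bp; rewrite /boundary /on_boundary !negb_or => /and4P[xn0 xn1 yn0 yn1].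
have x01 : 0 < (coords p).1 < 1 by rewrite !lt_neqAle eq_sym xn0 x0 xn1.
have y01 : 0 < (coords p).2 < 1 by rewrite !lt_neqAle eq_sym yn0 y0 yn1.
have x01' : 0 <= (coords p).1 <= 1 by rewrite x0.
have q01 : 0 < (1 / 4 : R) < 1 by lra.
have t01 : 0 < (3 / 4 : R) < 1 by lra.
have t01' : 0 <= (3 / 4 : R) <= 1 by lra.
have off y : y != 1 / 2 -> 0 < y < 1 ->
    plane_point (coords p).1 y ~~> plane_point (3 / 4) (1 / 4).
  move=> yn y01'; apply: (same_orbit_trans (q := plane_point (3 / 4) y)).
    by apply: horizontal_orbit => //; case/andP: y01' => /ltW-> /ltW->.
  apply: vertical_orbit => // i _ mi; have := mark_bounds i; rewrite -mi; lra.
have [yh|yh] := eqVneq (coords p).2 (1 / 2); last exact: off.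
apply: (same_orbit_trans (q := plane_point (coords p).1 (1 / 4))).
  apply: vertical_orbit => // i ik xi; apply: (nm i ik); apply: coords_inj.
  by rewrite marked_pointE -xi -yh -surjective_pairing.
by apply: off => //; apply/eqP; lra.
Qed.

Lemma euclidean_height : height R (color_stabilizer c) = k.+1%:R%:E.
Proof.
apply: color_height.
- exact: euclidean_color_le.
- exact: euclidean_color_surj.
- exact: euclidean_color_lsc.
move=> p q D cpq cD Dst Dp.
have Dcentral : central_stable D.
  move=> h u [bh ch]; apply: Dst; apply: color_stabilizer_fixing => // i _.
  exact/ch/marked_point_central.
have [[bp cp]|[i ik pE]|[bp cp pm]] := color_cases p;
  have [[bq cq]|[j jk qE]|[bq cq qm]] := color_cases q.
- exact: (stable_boundary cD Dcentral bp Dp bq).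
- by move: cpq; rewrite cp qE color_marked_point// => kj; rewrite -kj ltnn in jk.
- by move: cpq; rewrite cp cq => /eqP; rewrite ltn_eqF.
- by move: cpq; rewrite cq pE color_marked_point// => kj; rewrite kj ltnn in ik.
- by move: cpq Dp; rewrite pE qE !color_marked_point// => ->.
- by move: cpq; rewrite cq pE color_marked_point// => kj; rewrite kj ltnNge leqnSn in ik.
- by move: cpq; rewrite cp cq => /eqP; rewrite gtn_eqF.
- by move: cpq; rewrite cp qE color_marked_point// => kj; rewrite -kj ltnNge leqnSn in jk.
have [g gc <-] := same_orbit_trans (generic_orbit bp pm) (same_orbit_sym (generic_orbit bq qm)).
exact: Dst.
Qed.

End EuclideanHeight.

(** * The boundary of the Euclidean square is invariant *)

(** For labels below 3, the difference b - a modulo 3 represented by -1, 0 or 1: a step around the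
    cycle of labels. *)
Definition turn (a b : nat) : int :=
  if a == b then 0 else if (a.+1 == b) || ((a == 2) && (b == 0))%N then 1 else -1.

(** With one label missing the cycle is cut open, and a closed walk cannot wind around it. *)
Lemma turn_square a b c d l : (l < 3)%N -> (a < 3)%N -> (b < 3)%N -> (c < 3)%N -> (d < 3)%N ->
  a != l -> b != l -> c != l -> d != l ->
  turn a b + turn b c + turn c d + turn d a = 0.
Proof.
by case: l => [|[|[|//]]] _; case: a => [|[|[|//]]] _; case: b => [|[|[|//]]] _;
  case: c => [|[|[|//]]] _; case: d => [|[|[|//]]].
Qed.

Lemma turnC a b : (a < 3)%N -> (b < 3)%N -> turn b a = - turn a b.
Proof. by case: a => [|[|[|//]]] _; case: b => [|[|[|//]]]. Qed.

(* A discrete Green formula: no cell shows all three labels, so every cell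
   contributes 0. *)
Lemma grid_turns (n : nat) (L : nat -> nat -> nat) :
  (forall i j, (L i j < 3)%N) ->
  (forall i j, (i < n)%N -> (j < n)%N -> exists2 l, (l < 3)%N &
    [/\ L i j != l, L i.+1 j != l, L i.+1 j.+1 != l & L i j.+1 != l]) ->
  \sum_(0 <= i < n) turn (L i 0%N) (L i.+1 0%N) + \sum_(0 <= j < n) turn (L n j) (L n j.+1)
  = \sum_(0 <= i < n) turn (L i n) (L i.+1 n) + \sum_(0 <= j < n) turn (L 0%N j) (L 0%N j.+1).
Proof.
move=> L3 cell; pose h i j := turn (L i j) (L i.+1 j); pose g i j := turn (L i j) (L i j.+1).
have cell0 i j : (i < n)%N -> (j < n)%N -> h i j.+1 - h i j = g i.+1 j - g i j.
  move=> iN jN; have [l l3 [h1 h2 h3 h4]] := cell i j iN jN.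
  have := turn_square l3 (L3 _ _) (L3 _ _) (L3 _ _) (L3 _ _) h1 h2 h3 h4.
  rewrite (turnC (L3 i j.+1) (L3 i.+1 j.+1)) (turnC (L3 i j) (L3 i j.+1)) /h /g => E.
  by apply/eqP; rewrite -subr_eq0 -oppr_eq0 -E; apply/eqP; lra.
(* Both sides expand into double sums over the cells, telescoping in j on one side and in i on the
   other. *)
have H : \sum_(0 <= i < n) (h i n - h i 0%N) = \sum_(0 <= j < n) (g n j - g 0%N j).
  transitivity (\sum_(0 <= i < n) \sum_(0 <= j < n) (h i j.+1 - h i j)).
    by apply: eq_bigr => i _; rewrite telescope_sumr.
  transitivity (\sum_(0 <= i < n) \sum_(0 <= j < n) (g i.+1 j - g i j)).
    rewrite !big_nat; apply: eq_bigr => i /andP[_ iN]; rewrite !big_nat.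
    by apply: eq_bigr => j /andP[_ jN]; exact: cell0.
  rewrite exchange_big_nat; apply: eq_bigr => j _.
  by rewrite (telescope_sumr (fun i => g i j)).
move: H; rewrite !sumrB /h /g => H.
by apply/eqP; rewrite -subr_eq0; apply/eqP; move: H; lra.
Qed.

(** On a side that misses a label, turns are differences of an integer potential, so only the two
    corners count. *)
Lemma sum_turn_potential (n : nat) (l : nat -> nat) (phi : nat -> int) :
  (forall i, (i < n)%N -> turn (l i) (l i.+1) = phi (l i.+1) - phi (l i)) ->
  \sum_(0 <= i < n) turn (l i) (l i.+1) = phi (l n) - phi (l 0%N).
Proof.
move=> H; rewrite -(telescope_sumr (fun i => phi (l i)))// !big_nat.
by apply: eq_bigr => i /andP[_ /H].
Qed.

(** The corners are forced to 0, 1, 2, 0 counterclockwise from the origin. Bottom and right sides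
    turn by 1 + 1, top and left sides by -1 + 0, so the labels wind once around the boundary and the
    identity of [grid_turns] fails. *)
Lemma no_labelled_grid (n : nat) (L : nat -> nat -> nat) :
  (forall i j, (L i j < 3)%N) ->
  (forall i j, (i < n)%N -> (j < n)%N -> exists2 l, (l < 3)%N &
    [/\ L i j != l, L i.+1 j != l, L i.+1 j.+1 != l & L i j.+1 != l]) ->
  (forall j, (j <= n)%N -> L 0%N j = 0%N) ->
  (forall j, (j <= n)%N -> L n j != 0%N) ->
  (forall i, (i <= n)%N -> L i 0%N != 2%N) ->
  (forall i, (i <= n)%N -> L i n != 1%N) -> False.
Proof.
move=> L3 cell left right bottom top.
have := grid_turns L3 cell.
have c00 : L 0%N 0%N = 0%N by exact: left.
have c01 : L 0%N n = 0%N by exact: left.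
have c10 : L n 0%N = 1%N.
  by have := L3 n 0%N; have := right 0%N (leq0n _); have := bottom n (leqnn _);
    case: (L n 0%N) => [|[|[|]]].
have c11 : L n n = 2%N.
  by have := L3 n n; have := right n (leqnn _); have := top n (leqnn _); case: (L n n) => [|[|[|]]].
rewrite (@sum_turn_potential n (fun i => L i 0%N) (fun a => a%:Z)); last first.
  move=> i iN; have := L3 i 0%N; have := L3 i.+1 0%N;
    have := bottom i (ltnW iN); have := bottom i.+1 iN.
  by case: (L i 0%N) => [|[|[|]]] //; case: (L i.+1 0%N) => [|[|[|]]].
rewrite (@sum_turn_potential n (fun j => L n j) (fun a => a%:Z)); last first.
  move=> i iN; have := L3 n i; have := L3 n i.+1; have := right i (ltnW iN); have := right i.+1 iN.
  by case: (L n i) => [|[|[|]]] //; case: (L n i.+1) => [|[|[|]]].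
rewrite (@sum_turn_potential n (fun i => L i n) (fun a => if a == 2%N then -1 else 0)); last first.
  move=> i iN; have := L3 i n; have := L3 i.+1 n; have := top i (ltnW iN); have := top i.+1 iN.
  by case: (L i n) => [|[|[|]]] //; case: (L i.+1 n) => [|[|[|]]].
rewrite (@sum_turn_potential n (fun j => L 0%N j) (fun a => 0)); last first.
  by move=> i iN; rewrite !left// ltnW.
by rewrite c00 c01 c10 c11.
Qed.

(** * The Poincare-Miranda theorem in the plane *)

Section PoincareMiranda.
Variables (R : realType) (g : R * R -> R * R) (q : R * R).
Hypothesis cg : continuous g.
Hypothesis gq : forall z, g z != q.

(** Three regions of the plane that meet together only at q, so a map omitting q sees at most two of
    them locally. *)
Definition quadrant (z : R * R) : nat :=
  if (g z).1 < q.1 then 0%N else if (g z).2 < q.2 then 1%N else 2%N.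

Let near_coord (f : R * R -> R) (x : R * R) : continuous f ->
  (f (g x) < f q -> \forall z \near x, f (g z) < f q) /\
  (f q < f (g x) -> \forall z \near x, f q < f (g z)).
Proof.
move=> cf; have cfg : {for x, continuous (fun z => f (g z))}.
  by apply: continuous_comp; [exact: cg|exact: cf].
split => h.
  have : nbhs (f (g x)) [set t | t < f q].
    by apply: open_nbhs_nbhs; split => //; exact: open_lt.
  by move=> /cfg.
have : nbhs (f (g x)) [set t | f q < t].
  by apply: open_nbhs_nbhs; split => //; exact: open_gt.
by move=> /cfg.
Qed.

(** Since g x differs from q, some coordinate differs strictly; the inequality persists nearby and
    excludes a label. *)
Lemma quadrant_locally (x : R * R) : exists2 l, (l < 3)%N & \forall z \near x, quadrant z != l.
Proof.
have [u1 u2] := near_coord x (@fst_continuous R).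
have [v1 v2] := near_coord x (@snd_continuous R).
have [/u1 h|/u2 h|hu] := ltgtP (g x).1 q.1.
- by exists 1%N => //; apply: filterS h => z zq; rewrite /quadrant zq.
- by exists 0%N => //; apply: filterS h => z zq; rewrite /quadrant ltNge (ltW zq)/=; case: ifP.
have [/v1 h|/v2 h|hv] := ltgtP (g x).2 q.2.
- by exists 2%N => //; apply: filterS h => z zq; rewrite /quadrant zq; case: ifP.
- exists 1%N => //; apply: filterS h => z zq; rewrite /quadrant [(g z).2 < _]ltNge (ltW zq)/=.
  by case: ifP.
by have := gq x; rewrite (surjective_pairing (g x)) hu hv -surjective_pairing eqxx.
Qed.

(** A Lebesgue number argument: by compactness one mesh works for all cells. *)
Lemma quadrant_cells : exists n : nat, forall x : R * R, in_square x ->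
  exists2 l, (l < 3)%N & [/\ quadrant x != l, quadrant (x.1 + n.+1%:R^-1, x.2) != l,
    quadrant (x.1 + n.+1%:R^-1, x.2 + n.+1%:R^-1) != l & quadrant (x.1, x.2 + n.+1%:R^-1) != l].
Proof.
pose K : set (R * R) := `[0, 1]%classic `*` `[0, 1]%classic.
have cK : compact K by apply: compact_setX; exact: segment_compact.
pose P (n : nat) (x : R * R) := exists2 l, (l < 3)%N & [/\ quadrant x != l,
    quadrant (x.1 + n.+1%:R^-1, x.2) != l,
    quadrant (x.1 + n.+1%:R^-1, x.2 + n.+1%:R^-1) != l & quadrant (x.1, x.2 + n.+1%:R^-1) != l].
have /compact_near_coveringP cov := cK.
have : \forall n \near \oo, K `<=` P n.
  apply: cov => x _; have [l l3 /nbhs_ballP[e' e'0 e'l]] := quadrant_locally x.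
  have [e [e0 el]] : exists e : R, 0 < e /\
      forall a b : R, `|x.1 - a| < e -> `|x.2 - b| < e -> quadrant (a, b) != l.
    by exists e'; split => // a b ha hb; apply: e'l.
  (* Half of e is spent on the base point and half on the mesh, which keeps all four corners of the
     cell within e. *)
  have e2 : 0 < e / 2 by rewrite divr_gt0.
  exists (ball x (e / 2), [set n : nat | n.+1%:R^-1 < e / 2]).
    split; first exact: nbhsx_ballx.
    have := near_infty_natSinv_lt (PosNum e2); apply: filterS => n.
    by [].
  move=> [[a b] n] [[/= ha hb] hn]; exists l => //.
  have s0 : 0 < n.+1%:R^-1 :> R by rewrite invr_gt0.
  move: (n.+1%:R^-1) hn s0 => s hn s0; rewrite /mkset /= in hn.
  move: ha hb; rewrite /ball /= => ha hb.
  have near0 c d : `|c - d| < e / 2 -> `|c - d| < e by move=> h; lra.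
  have near1 c d : `|c - d| < e / 2 -> `|c - (d + s)| < e.
    by rewrite !ltr_norml => /andP[h1 h2]; apply/andP; split; lra.
  by split; apply: el => /=; auto.
move=> [n _ /(_ n (leqnn n))] KP; exists n => x /andP[x1 x2]; apply: KP.
by split; rewrite /= in_itv.
Qed.

(** The inequalities, strict on the left and bottom and weak opposite, match the strict tests in
    [quadrant] and give the side conditions of [no_labelled_grid]. *)
Lemma poincare_miranda :
  (forall y, 0 <= y <= 1 -> (g (0, y)).1 < q.1) ->
  (forall y, 0 <= y <= 1 -> q.1 <= (g (1, y)).1) ->
  (forall x, 0 <= x <= 1 -> (g (x, 0)).2 < q.2) ->
  (forall x, 0 <= x <= 1 -> q.2 <= (g (x, 1)).2) -> False.
Proof.
move=> left right bottom top; have [n cells] := quadrant_cells.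
have n0 : 0 < n.+1%:R :> R by [].
pose t (i : nat) : R := i%:R / n.+1%:R.
have t0 : t 0%N = 0 by rewrite /t mul0r.
have t1 : t n.+1 = 1 by rewrite /t divff// lt0r_neq0.
have tS i : t i.+1 = t i + n.+1%:R^-1 by rewrite /t -addn1 natrD mulrDl mul1r.
have t01 i : (i <= n.+1)%N -> 0 <= t i <= 1.
  by move=> iN; rewrite /t divr_ge0//= ler_pdivrMr// mul1r ler_nat.
apply: (@no_labelled_grid n.+1 (fun i j => quadrant (t i, t j))).
- by move=> i j; rewrite /quadrant; case: ifP => // _; case: ifP.
- move=> i j iN jN; rewrite !tS; apply: (cells (t i, t j)).
  by rewrite /in_square /= !t01// ltnW.
- by move=> j jN; rewrite t0 /quadrant left// t01.
- by move=> j jN; rewrite t1 /quadrant ltNge right ?t01//=; case: ifP.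
- by move=> i iN; rewrite t0 /quadrant bottom ?t01//; case: ifP.
- by move=> i iN; rewrite t1 /quadrant (ltNge _ q.2) top ?t01//=; case: ifP.
Qed.

End PoincareMiranda.

(** * Removable points and the chain of length 1 *)

Section RemovablePoints.
Variable X : topologicalType.

(* Z-points: on the square these are exactly the boundary points. *)
Definition removable : set X := [set p | forall N, nbhs p N ->
  exists f : X -> X, [/\ continuous f, forall q, ~ N q -> f q = q & forall q, f q <> p]].

Lemma removable_homeo (h : homeo X) p : removable p -> removable (h p).
Proof.
move=> rp N nN; have : nbhs p [set q | N (h q)] by exact: homeo_fun_continuous nN.
move=> /rp[f [cf fN fp]]; exists (h \o f \o homeo_inv h); split.
- move=> q; apply: continuous_comp; first exact: homeo_inv_continuous.
  by apply: continuous_comp; [exact: cf|exact: homeo_fun_continuous].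
- by move=> q nq /=; rewrite fN ?homeo_invK//= homeo_invK.
- by move=> q /= /(can_inj (homeo_funK h)); exact: fp.
Qed.

End RemovablePoints.

Section EuclideanLowerBound.
Variable R : realType.
Local Notation U := (euclidean_square R).

(** For an interior p, a neighbourhood away from the boundary would yield a self-map of the square
    that fixes the boundary and omits p, against [poincare_miranda]. *)
Lemma removable_boundary (p : U) : removable p -> boundary p.
Proof.
move=> rp; apply: contrapT => /negP bp.
have [f [cf fN fp]] := rp _ (near_not_boundary bp).
have fb q : boundary q -> f q = q by move=> bq; apply: fN; rewrite /mkset bq.
have /andP[/andP[x0 x1] /andP[y0 y1]] := coords_in_square p.
move: bp; rewrite /boundary /on_boundary !negb_or => /and4P[xn0 xn1 yn0 yn1].
have x01 : 0 < (coords p).1 < 1 by rewrite !lt_neqAle eq_sym xn0 x0 xn1.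
have y01 : 0 < (coords p).2 < 1 by rewrite !lt_neqAle eq_sym yn0 y0 yn1.
have i0 : 0 <= (0 : R) <= 1 by rewrite lexx ler01.
have i1 : 0 <= (1 : R) <= 1 by rewrite lexx ler01.
have fE x y : 0 <= x <= 1 -> 0 <= y <= 1 -> on_boundary (x, y) ->
    coords (f (plane_point x y)) = (x, y).
  by move=> xI yI xy; rewrite fb ?/boundary plane_pointE.
apply: (@poincare_miranda R (fun z => coords (f (square_point z))) (coords p)).
- move=> z; apply: (@continuous_comp _ _ _ (@square_point R) (@coords R \o f)).
    exact: square_point_continuous.
  by apply: continuous_comp; [exact: cf|exact: coords_continuous].
- move=> z; rewrite (inj_eq (@coords_inj R)); apply/eqP; exact: fp.
- move=> y yI; have -> : coords (f (square_point (0, y))) = (0, y).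
    by apply: fE => //; rewrite /on_boundary eqxx.
  by case/andP: x01.
- move=> y yI; have -> : coords (f (square_point (1, y))) = (1, y).
    by apply: fE => //; rewrite /on_boundary eqxx orbT.
  by case/andP: x01 => _ /ltW.
- move=> x xI; have -> : coords (f (square_point (x, 0))) = (x, 0).
    by apply: fE => //; rewrite /on_boundary eqxx !orbT.
  by case/andP: y01.
- move=> x xI; have -> : coords (f (square_point (x, 1))) = (x, 1).
    by apply: fE => //; rewrite /on_boundary eqxx !orbT.
  by case/andP: y01 => _ /ltW.
Qed.

Lemma removable_corner : removable (plane_point 0 0 : U).
Proof.
have i0 : 0 <= (0 : R) <= 1 by rewrite lexx ler01.
have cE : coords (plane_point 0 0 : U) = (0, 0) by rewrite plane_pointE.
move=> N [_ [[W oW <-] Wp sN]]; have : nbhs ((0, 0) : R * R) W.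
  by apply: open_nbhs_nbhs; split => //; move: Wp; rewrite /mkset -cE.
move=> /nbhs_ballP[e' e'0 e'W].
have [e [e0 eW]] : exists e : R, 0 < e /\
    forall a b : R, `|0 - a| < e -> `|0 - b| < e -> W (a, b).
  by exists e'; split => // a b ha hb; exact: e'W.
pose d := Num.min e 1; have d0 : 0 < d by rewrite lt_min e0 ltr01.
have de : d <= e by rewrite ge_min lexx.
have d1 : d <= 1 by rewrite ge_min lexx orbT.
(* Pushes the triangle x + y < d horizontally onto the line x + y = d. The triangle lies in the
   neighbourhood as d <= e, its image stays in the square as d <= 1, and the corner is never
   attained. *)
pose F (z : R * R) : R * R := (z.1 + Num.max 0 (d - z.1 - z.2), z.2).
have cF : continuous F.
  move=> z; have c1 : {for z, continuous (fun w : R * R => d - w.1 - w.2)}.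
    apply: cvgB; last exact: snd_continuous.
    by apply: cvgB; [exact: cvg_cst|exact: fst_continuous].
  have c0 : {for z, continuous (fun _ : R * R => 0 : R)} by exact: cvg_cst.
  have c2 : {for z, continuous (fun w : R * R => Num.max 0 (d - w.1 - w.2))}.
    exact: continuous_max c0 c1.
  have c3 : {for z, continuous (fun w : R * R => w.1 + Num.max 0 (d - w.1 - w.2))}.
    by apply: cvgD => //; exact: fst_continuous.
  exact: continuous_pair c3 (@snd_continuous R z).
have Fin z : in_square z -> in_square (F z).
  case: z => x y /andP[/= /andP[x0 x1] /andP[y0 y1]]; rewrite /in_square /F /= y0 y1 andbT.
  by have [h|h] := leP 0 (d - x - y); apply/andP; split; lra.
exists (fun q : U => square_point (F (coords q))); split.
- move=> q; apply: (@continuous_comp _ _ _ (@coords R) (@square_point R \o F)).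
    exact: coords_continuous.
  by apply: continuous_comp; [exact: cF|exact: square_point_continuous].
- move=> q nN; have [a0 [b0 E]] : 0 <= (coords q).1 /\ 0 <= (coords q).2 /\
      d <= (coords q).1 + (coords q).2.
    have /andP[/andP[x0 _] /andP[y0 _]] := coords_in_square q.
    split => //; split => //; rewrite leNgt; apply/negP => h; apply: nN; apply: sN.
    rewrite /preimage /mkset -[(_, _)]/(coords q) (surjective_pairing (coords q)).
    by apply: eW; rewrite sub0r normrN ger0_norm//; lra.
  have -> : F (coords q) = coords q.
    by rewrite /F max_l ?addr0 -?surjective_pairing//; lra.
  exact: coordsK.
- move=> q /(congr1 (@coords R)); have qin := coords_in_square q.
  rewrite square_pointK ?Fin// cE; move: qin; case: (coords q) => x y /=.
  rewrite /in_square /F /= => /andP[/andP[x0 _] _] [+ y0]; rewrite y0 subr0.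
  by have [h|h] := leP 0 (d - x); lra.
Qed.

(** The closure of the removable points contains a corner and stays in the boundary, which is
    closed, so it is neither empty nor everything. *)
Lemma euclidean_chain (G : {pred homeo U}) : exists D, invariant_chain G 1 D.
Proof.
pose Z := closure (@removable U).
have Zb p : Z p -> boundary p.
  move=> Zp; apply: contrapT => /negP /near_not_boundary /Zp[q [/removable_boundary bq]].
  by rewrite /mkset bq.
exists (fun i => if i == 0%N then Z else setT); split => //.
- move=> [|[|//]] _ /=; split; [exact: closed_closure| |exact: closedT|].
    split; first by exists (plane_point 0 0); apply: subset_closure; exact: removable_corner.
    move=> _ [g _] [y Zy <-]; apply/closure_homeo => // h q; exact: removable_homeo.
  by split => //; exists (plane_point 0 0).
- move=> [|//] _ /=; split => // /(_ (marked_point R 0) I) /Zb.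
  by rewrite marked_point_not_boundary.
Qed.

End EuclideanLowerBound.

(** * Infinite height, and the theorem *)

Section TrivialGroup.
Variable R : realType.
Local Notation I := (unit_interval R).

Lemma mark_unitE i : \val (clamp (mark R i) : I) = mark R i.
Proof. by have /andP[m0 m1] := mark_bounds R i; rewrite clampE//; apply/andP; split; lra. Qed.

Lemma column_mark_inj (x : I) : injective (fun i => (x, clamp (mark R i) : I)).
Proof.
move=> i j /(congr1 (fun p => \val p.2)).
by rewrite !mark_unitE => /mark_inj.
Qed.

Lemma closed1_of_near (X : topologicalType) (p : X) :
  (forall q, q != p -> \forall z \near q, z != p) -> closed [set p].
Proof.
move=> H; rewrite -openC openE => q /eqP/H nq.
have {}nq : nbhs q [set z | z != p] by [].
by apply: filterS nq => z /eqP.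
Qed.

Lemma alexandroff_closed1 (p : alexandroff_square R) : closed [set p].
Proof.
apply: closed1_of_near => -[x y] qp; case: p qp => a b qp.
have [ax|ax] := eqVneq a x.
  have yb : y != b by move: qp; rewrite ax xpair_eqE eqxx.
  have nb : nbhs y [set z | z != b] := unit_near_neq yb.
  have [yx|yx] := eqVneq y x.
    rewrite yx in nb *; apply/alexandroff_nbhs_diag; exists set0; first exact: finite_set0.
    split => //; apply: filterS nb => z zb u _.
    by rewrite /mkset xpair_eqE negb_and zb orbT.
  apply/(alexandroff_nbhs_off _ yx); apply: filterS nb => z zb.
  by rewrite /mkset xpair_eqE negb_and zb orbT.
have [yx|yx] := eqVneq y x.
  rewrite yx; apply/alexandroff_nbhs_diag; exists [set a]; first exact: finite_set1.
  split; first by move=> /= xa; rewrite xa eqxx in ax.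
  by apply: filterE => z u /= ua; apply/eqP => -[ua' _]; exact: ua.
apply/(alexandroff_nbhs_off _ yx); apply: filterE => z.
by rewrite /mkset xpair_eqE negb_and eq_sym ax.
Qed.

Lemma euclidean_closed1 (p : euclidean_square R) : closed [set p].
Proof.
apply: closed1_of_near => q qp.
have : coords q != coords p by rewrite (inj_eq (@coords_inj R)).
move=> /near_coords_neq nq; have {}nq : nbhs q [set z | coords z != coords p] by [].
by apply: filterS nq => z; rewrite /mkset (inj_eq (@coords_inj R)).
Qed.

Lemma lex_closed1 (p : lex_square R) : closed [set p].
Proof. apply: accessible_closed_set1; apply: hausdorff_accessible; exact: order_hausdorff. Qed.

End TrivialGroup.

Theorem theorem3p2 (R : realType) :
  [/\ possible_heights R (alexandroff_square R) =
        [set (n%:~R)%:E | n in [set n : int | 5 <= n]] `|` [set +oo%E],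
      possible_heights R (lexicographic_square R) =
        [set (n%:~R)%:E | n in [set n : int | 4 <= n]] `|` [set +oo%E]
    & possible_heights R (euclidean_square R) =
        [set (n%:~R)%:E | n in [set n : int | 1 <= n]] `|` [set +oo%E]].
Proof.
(* Each family of colourings is indexed by the excess r of the height over its minimum m; this
   passes to an arbitrary n >= m. *)
have nat_ge (X : topologicalType) (m : nat) :
    (forall r : nat, exists2 G : {pred homeo X}, group_closed G & height R G = (r + m)%:R%:E) ->
    forall n, (m <= n)%N -> exists2 G : {pred homeo X}, group_closed G & height R G = n%:R%:E.
  by move=> H n mn; have := H (n - m)%N; rewrite subnK.
split.
- apply: (@possible_heightsE R (alexandroff_square R) 5).
  + move=> G; apply: (@color_chain _ G (@alexandroff_color R 0)).
    * by move=> g p _; exact: alexandroff_color_homeo.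
    * by move=> p; apply: framed_color_le => x y; exact: alexandroff_inner_le.
    * exact: (@alexandroff_color_surj R 0).
    * exact: alexandroff_color_lsc.
  + apply: nat_ge => r; exists (color_stabilizer (@alexandroff_color R r)).
      exact: color_stabilizer_group.
    by rewrite alexandroff_height -addn3 -addnA.
  + exists (pred1 (homeo_one (alexandroff_square R)) : {pred homeo _}); first exact: pred1_group.
    exact: height_pred1_one (@alexandroff_closed1 R) (@column_mark_inj R (I0 R)).
- rewrite lex_squareE; apply: (@possible_heightsE R (lex_square R) 4).
  + move=> G; apply: (@color_chain _ G (@lex_color R 0)).
    * by move=> g p _; exact: lex_color_homeo.
    * by move=> p; apply: framed_color_le => x y; exact: lex_inner_le.
    * exact: (@lex_color_surj R 0).
    * exact: lex_color_lsc.
  + apply: nat_ge => r; exists (color_stabilizer (@lex_color R r)).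
      exact: color_stabilizer_group.
    by rewrite lex_height -addn3 -addnA.
  + exists (pred1 (homeo_one (lex_square R)) : {pred homeo _}); first exact: pred1_group.
    exact: height_pred1_one (@lex_closed1 R) (@column_mark_inj R (I0 R)).
- apply: (@possible_heightsE R (euclidean_square R) 1).
  + exact: euclidean_chain.
  + apply: nat_ge => r; exists (color_stabilizer (@euclidean_color R r)).
      exact: color_stabilizer_group.
    by rewrite euclidean_height addn1.
  + exists (pred1 (homeo_one (euclidean_square R)) : {pred homeo _}); first exact: pred1_group.
    exact: height_pred1_one (@euclidean_closed1 R) (@marked_point_inj R).
Qed.
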